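(* Let $\beta>0$, let $n\ge2$, and let $\kappa$ be a partition with $l(\kappa)<n$. For $\Lambda=\mathrm{diag}(\lambda_1,\ldots,\lambda_n)$ real with pairwise distinct diagonal entries and $q$ a unit vector in $\mathbb{R}^n$ with positive entries, let $A(\Lambda,q)$ be the arrow matrix $$A(\Lambda,q)=\begin{pmatrix}\mu_1&&&c_1\\&\ddots&&\vdots\\&&\mu_{n-1}&c_{n-1}\\c_1&\cdots&c_{n-1}&c_n\end{pmatrix}$$ whose eigenvalues are $\lambda_1,\ldots,\lambda_n$ and whose eigenvector matrix has last row $q$, and let $M=\mathrm{diag}(\mu_1,\ldots,\mu_{n-1})$. Then $$C_\kappa^{(\beta)}(\Lambda)\propto\int\prod_{i=1}^n q_i^{\beta-1}\,C_\kappa^{(\beta)}(M)\,dq,$$ i.e. the two sides agree up to a constant factor not depending on $\Lambda$, where the integral is over the part of the unit sphere in $\mathbb{R}^n$ with all coordinates positive and $dq$ is the surface area element.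
   Context: The arrow matrix: for $\Lambda$ with pairwise distinct entries and $q$ with positive entries, there is a unique real symmetric matrix $A(\Lambda,q)$ of the displayed shape (zeros off the diagonal, last row and last column) with $\mu_1>\cdots>\mu_{n-1}$ and $c_1,\ldots,c_{n-1}>0$, such that $q_i$ is the $n$-th coordinate of a unit eigenvector for $\lambda_i$, $i=1,\ldots,n$. So $M$ is a function of $(\Lambda,q)$. Jack polynomials. A partition $\kappa\vdash k$ is a non-increasing sequence $\kappa_1\ge\kappa_2\ge\cdots\ge0$ of integers with sum $|\kappa|=k$; $l(\kappa)$ is the number of nonzero parts. Put $\rho_\kappa=\sum_i\kappa_i(\kappa_i-1-\beta(i-1))$. For partitions of $k$, $\mu\le\kappa$ (dominance) means $\mu_1+\cdots+\mu_j\le\kappa_1+\cdots+\kappa_j$ for all $j$; $m_\mu$ is the monomial symmetric polynomial. For $\kappa\vdash k$ with $l(\kappa)\le n$, the Jack polynomial in the $C$-normalization $C_\kappa^{(\beta)}(x_1,\ldots,x_n)$ is the homogeneous symmetric polynomial of degree $k$ of the form $\sum_{\mu\le\kappa}a_{\kappa\mu}m_\mu$, $a_{\kappa\kappa}\ne0$, which is an eigenfunction of $D_n^*=\sum_{i=1}^n x_i^2\frac{\partial^2}{\partial x_i^2}+\beta\sum_{i\ne j}\frac{x_i^2}{x_i-x_j}\frac{\partial}{\partial x_i}$ with eigenvalue $\rho_\kappa+\beta k(n-1)$, the scalings being fixed by $\sum_{\kappa\vdash k,\,l(\kappa)\le n}C_\kappa^{(\beta)}(x_1,\ldots,x_n)=(x_1+\cdots+x_n)^k$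 for every $k$. For an $n\times n$ matrix $X$ with eigenvalues $x_1,\ldots,x_n$, $C_\kappa^{(\beta)}(X)=C_\kappa^{(\beta)}(x_1,\ldots,x_n)$; the number of variables is the size of the matrix (so $C_\kappa^{(\beta)}(M)$ is a Jack polynomial in $n-1$ variables). *)

(* Defs.v *)
From HB Require Import structures.
From mathcomp Require Import all_boot all_order all_algebra.
(* multinomials notations clash with those of analysis *)
From mathcomp Require Import -(notations) mpoly.
From mathcomp Require Import all_classical all_reals all_analysis.

Set Implicit Arguments.
Unset Strict Implicit.
Unset Printing Implicit Defensive.

Import Order.TTheory GRing.Theory Num.Theory.
Import numFieldNormedType.Exports.

Local Open Scope ring_scope.

(* A partition is the sequence of its nonzero parts, so that l(kappa) is
   [size kappa], |kappa| is [sumn kappa], and kappa_(i+1) is [nth 0 kappa i]. *)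
Definition is_part (s : seq nat) : bool := sorted geq s && (0 \notin s)%N.

(* The partitions of k with at most n parts: every such partition arises from
   an n-tuple over {0, ..., k} by erasing the zeros. *)
Definition parts (k n : nat) : seq (seq nat) :=
  [seq s <- undup [seq [seq x <- [seq val y | y <- tval t] | x != 0%N]
                  | t : n.-tuple 'I_k.+1] | is_part s && (sumn s == k)].

Lemma parts_uniq k n : uniq (parts k n).
Proof. exact/filter_uniq/undup_uniq. Qed.

Lemma mem_parts k n s :
  (s \in parts k n) = [&& is_part s, sumn s == k & (size s <= n)%N].
Proof.
rewrite mem_filter mem_undup -andbA; case: (boolP (is_part s)) => //= hs.
case: eqP => //= hk; apply/mapP/idP => [[t _ ->]|hn].
  rewrite size_filter (leq_trans (count_size _ _))// size_map size_tuple.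
  exact: leqnn.
pose u := [seq inord x | x <- s ++ nseq (n - size s) 0%N] : seq 'I_k.+1.
have su : size u == n by rewrite size_map size_cat size_nseq subnKC.
exists (Tuple su); rewrite ?mem_enum //= -map_comp map_id_in => [|x]; last first.
  rewrite mem_cat mem_nseq => /orP[xs|/andP[_ /eqP->]] /=; last by rewrite inordK.
  rewrite inordK// ltnS -hk; elim: (s) xs => //= y l IH.
  rewrite inE => /orP[/eqP->|/IH h]; first exact: leq_addr.
  by rewrite (leq_trans h)// leq_addl.
rewrite filter_cat (_ : [seq x <- nseq _ _ | _] = [::]).
  rewrite cats0; apply/esym/all_filterP/allP => x xs.
  by apply: contraTneq xs => ->; case/andP: hs.
by elim: (n - size s)%N.
Qed.

Definition dominated (mu kappa : seq nat) : Prop :=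
  forall j, (sumn (take j mu) <= sumn (take j kappa))%N.

Section Jack.
Variables (R : realType) (n : nat).
Implicit Types (beta : R) (kappa mu : seq nat) (p : mpoly n R) (x : 'rV[R]_n).

(* The exponents run over the distinct rearrangements of mu padded with zeros
   to length n; the sum is empty when mu has more than n parts. *)
Definition msym_poly mu : mpoly n R :=
  \sum_(e : bmultinom n (sumn mu).+1 |
        perm_eq (bmnm e) (mu ++ nseq (n - size mu) 0%N))
     mpolyX R (bmnm e).

Definition evalv p x : R := meval (x 0) p.

(* p at the eigenvalues of a diagonal matrix X *)
Definition eval_diag p (X : 'M[R]_n) : R := evalv p (\row_i X i i).

(* D_n^* p at x; meaningful only when the coordinates of x are pairwise
   distinct, whence the restriction in [jack_eigen]. *)
Definition Dstar beta p x : R :=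
  \sum_i x 0 i ^+ 2 * evalv (mderiv i (mderiv i p)) x +
  beta * \sum_i \sum_(j | i != j)
     x 0 i ^+ 2 / (x 0 i - x 0 j) * evalv (mderiv i p) x.

Definition rho beta kappa : R :=
  \sum_(i < size kappa)
     (nth 0%N kappa i)%:R * ((nth 0%N kappa i)%:R - 1 - beta * i%:R).

Definition jack_shape kappa p : Prop :=
  exists2 a : seq nat -> R, a kappa != 0 &
    p = \sum_(mu <- parts (sumn kappa) n | `[< dominated mu kappa >])
           a mu *: msym_poly mu.

Definition jack_eigen beta kappa p : Prop :=
  forall x, injective (x 0) ->
    Dstar beta p x =
    (rho beta kappa + beta * (sumn kappa)%:R * (n%:R - 1)) * evalv p x.

(* C is the family of Jack polynomials in n variables in the C-normalization.
   Its values at sequences that are not partitions with at most n parts are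
   irrelevant. *)
Definition is_jackC beta (C : seq nat -> mpoly n R) : Prop :=
  (forall kappa, is_part kappa -> (size kappa <= n)%N ->
     jack_shape kappa (C kappa) /\ jack_eigen beta kappa (C kappa)) /\
  (forall k, \sum_(kappa <- parts k n) C kappa =
     (\sum_i mpolyX R (mnm1 i)) ^+ k).

End Jack.

Section Arrow.
Variables (R : realType) (m : nat).

Definition arrow_mx (mu c : 'rV[R]_m) (cn : R) : 'M[R]_(m + 1) :=
  block_mx (diag_mx mu) c^T c cn%:M.

(* A is the arrow matrix A(Lambda, q) with Lambda = diag(lambda). The last
   condition says that q_i is the last coordinate of a unit eigenvector for
   lambda_i. *)
Definition is_arrow (lambda q : 'rV[R]_(m + 1)) (A : 'M[R]_(m + 1)) : Prop :=
  (exists mu c cn,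
     [/\ A = arrow_mx mu c cn,
         forall i j : 'I_m, (i < j)%N -> mu 0 j < mu 0 i &
         forall i, 0 < c 0 i]) /\
  (forall i, exists v : 'cV[R]_(m + 1),
     [/\ A *m v = lambda 0 i *: v,
         \sum_j v j 0 ^+ 2 = 1 &
         v (rshift m 0) 0 = q 0 i]).

Definition pos_unit (q : 'rV[R]_(m + 1)) : Prop :=
  (forall i, 0 < q 0 i) /\ \sum_i q 0 i ^+ 2 = 1.

End Arrow.

Section SphereIntegral.
Variable R : realType.
Local Notation TR := (measurableTypeR R).

Definition tcons m (xt : TR * m.-tuple TR) : m.+1.-tuple TR :=
  [tuple of xt.1 :: xt.2].

(* m-dimensional Lebesgue measure, as an iterated product measure *)
Fixpoint lebesgue_tuple (m : nat) : set (m.-tuple TR) -> \bar R :=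
  match m return set (m.-tuple TR) -> \bar R with
  | 0 => dirac [tuple]
  | m'.+1 => pushforward (product_measure1 lebesgue_measure (@lebesgue_tuple m'))
                (@tcons m')
  end.

Lemma measurable_tcons m : measurable_fun setT (@tcons m).
Proof. exact: measurable_cons. Qed.

Lemma measurable_uncons m :
  measurable_fun setT (fun t : m.+1.-tuple TR => (thead t, [tuple of behead t])).
Proof.
apply: measurable_fun_pair; first exact: measurable_tnth.
exact: measurable_behead.
Qed.

Section ConsMeasure.
Variables (m : nat) (mu : {sigma_finite_measure set (m.-tuple TR) -> \bar R}).
Local Open Scope ereal_scope.

Let P : {measure set (TR * m.-tuple TR) -> \bar R} :=
  product_measure1 (@lebesgue_measure R) mu.

Definition cons_measure :=
  pushforward (product_measure1 (@lebesgue_measure R) mu) (@tcons m).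

Let m0 : cons_measure set0 = 0.
Proof. by rewrite /cons_measure /pushforward preimage_set0 measure0. Qed.

Let mge0 A : 0 <= cons_measure A.
Proof. exact: integral_ge0. Qed.

Let madd : semi_sigma_additive cons_measure.
Proof.
move=> F mF tF mUF; rewrite /cons_measure /pushforward preimage_bigcup.
have mf := @measurable_tcons m.
apply: (@measure_semi_sigma_additive _ _ _ P).
- by move=> n; rewrite -[X in measurable X]setTI; exact: mf.
- apply/trivIsetP => /= i j _ _ ij; rewrite -preimage_setI.
  by move/trivIsetP : tF => /(_ _ _ _ _ ij) ->//; rewrite preimage_set0.
- by rewrite -preimage_bigcup -[X in measurable X]setTI; exact: mf.
Qed.

HB.instance Definition _ := isMeasure.Build _ _ _ cons_measure m0 mge0 madd.

Let msf : sigma_finite setT cons_measure.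
Proof.
pose u (t : m.+1.-tuple TR) : TR * m.-tuple TR := (thead t, [tuple of behead t]).
have uK : u \o @tcons m = id.
  by apply/funext => -[x t]; rewrite /u /=; congr pair => //=; apply/val_inj.
have /sigma_finiteP[F [FT ndF mF]] := sigma_finiteT (@lebesgue_measure R).
have /sigma_finiteP[G [GT ndG mG]] := sigma_finiteT mu.
exists (fun i => u @^-1` (F i `*` G i))%classic.
  apply/esym; rewrite -subTset => t _.
  have [i _ Fi] : (\bigcup_i F i)%classic (u t).1 by rewrite -FT.
  have [j _ Gj] : (\bigcup_i G i)%classic (u t).2 by rewrite -GT.
  exists (maxn i j) => //; split.
    by move: Fi; exact/subsetPset/ndF/leq_maxl.
  by move: Gj; exact/subsetPset/ndG/leq_maxr.
move=> i; have [mFi Fi] := mF i; have [mGi Gi] := mG i; split.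
  rewrite -[X in measurable X]setTI; apply: measurable_uncons => //.
  exact: measurableX.
rewrite /cons_measure /pushforward -comp_preimage uK preimage_id.
by rewrite product_measure1E// lte_mul_pinfty// ge0_fin_numE.
Qed.

HB.instance Definition _ := Measure_isSigmaFinite.Build _ _ _ cons_measure msf.

End ConsMeasure.

Lemma lebesgue_tuple_measure m :
  exists mu : {sigma_finite_measure set (m.-tuple TR) -> \bar R},
    (mu : set _ -> \bar R) = @lebesgue_tuple m.
Proof.
elim: m => [|m [mu muE]].
  by exists (\d_([tuple] : 0.-tuple TR)).
by exists (cons_measure mu); rewrite /= -muE.
Qed.

Lemma lebesgue_tuple_box m (D : 'I_m -> set TR) :
  (forall i, measurable (D i)) ->
  @lebesgue_tuple m [set t | forall i, D i (tnth t i)]%classic =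
  (\prod_(i < m) lebesgue_measure (D i))%E.
Proof.
elim: m D => [|m IH] D mD.
  by rewrite big_ord0 /= diracE mem_set// => -[].
have [mu muE] := lebesgue_tuple_measure m.
rewrite big_ord_recl -IH//= /pushforward -muE.
rewrite -product_measure1E//; last first.
  rewrite (_ : mkset _ = \bigcap_(i in [set: 'I_m])
      ((fun t : m.-tuple TR => tnth t i) @^-1` D (lift ord0 i)))%classic.
    apply: fin_bigcap_measurable => // i _.
    by rewrite -[X in measurable X]setTI; apply: measurable_tnth.
  by apply/seteqP; split => t /= h i; [move=> _|]; exact: h.
congr product_measure1.
apply/seteqP; split => -[x t] /=.
  move=> h; split; first exact: (h ord0).
  by move=> i; have := h (lift ord0 i); rewrite tnthS.
move=> [h0 h] i; case: (unliftP ord0 i) => [j|] ->; last by [].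
by rewrite tnthS.
Qed.

Definition sphere_graph m (u : 'rV[R]_m) : R :=
  Num.sqrt (1 - \sum_i u 0 i ^+ 2).

(* density of the surface area of the graph of g with respect to Lebesgue
   measure on the base, i.e. sqrt (1 + |grad g|^2) *)
Definition graph_area m (g : 'rV[R]_m -> R) (u : 'rV[R]_m) : R :=
  Num.sqrt (1 + \sum_i ('D_(delta_mx 0 i) g u) ^+ 2).

(* Surface integral over the part of the unit sphere of R^(m+1) with positive
   coordinates, seen as the graph of [sphere_graph] over the part of the open
   unit ball of R^m with positive coordinates. *)
Definition int_pos_sphere m (f : 'rV[R]_(m + 1) -> R) : \bar R :=
  (\int[@lebesgue_tuple m]_(t in
      [set t : m.-tuple TR | (forall i, 0 < tnth t i) /\
                            \sum_i tnth t i ^+ 2 < 1]%R%classic)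
     let u : 'rV[R]_m := (\row_i tnth t i)%R in
     (f (row_mx u (sphere_graph u)%:M) * graph_area (@sphere_graph m) u)%:E)%E.

End SphereIntegral.

(* Main.v *)
(* Put t_i = q_i^2. Comparing the last diagonal entry of the adjugate of 1 + yA
   computed from the arrow shape and from the spectral decomposition gives
   e_r(mu) = u_r(lambda, t) := sum_i t_i e_r(lambda without lambda_i), so that
   C_kappa(M) = P(lambda, t) for a polynomial P. The operator D*_(n-1) + beta sum mu_i d/dmu_i
   in mu and the operator D*_n - N, where D*_n acts on lambda and
   N = sum_(i <> k) lambda_i lambda_k / (lambda_i - lambda_k)^2 *
         (beta/2 (t_i - t_k) d_ik - t_i t_k d_ik^2),   d_ik = d/dt_i - d/dt_k,
   are of second order, and they and their carres du champ agree on the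
   generators e_r(mu) and u_r(lambda, t); hence (D*_n - N) P = E P with
   E = rho_kappa + beta k (n-1). On the simplex, prod t_i^(beta/2 - 1) dt is
   annihilated by the adjoint of N, so the integral of P is an eigenfunction of D*_n with
   eigenvalue E. Its monomials are dominated by kappa and its coefficient at
   lambda^kappa is nonzero, because the u_r have nonnegative coefficients; since
   kappa is the only exponent dominated by kappa with eigenvalue E, the
   integral is a multiple of C_kappa(Lambda). *)
Require Import Defs.
From HB Require Import structures.
From mathcomp Require Import all_boot all_order all_algebra.
From mathcomp Require Import perm.
From mathcomp Require Import -(notations) mpoly.
From mathcomp Require Import ring lra zify.

Set Implicit Arguments.
Unset Strict Implicit.
Unset Printing Implicit Defensive.

Import Order.TTheory GRing.Theory Num.Theory.

Local Open Scope ring_scope.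

(** * Elementary symmetric functions *)

Section Elsym.
Variables (K : comNzRingType) (n : nat) (x : 'I_n -> K).
Implicit Types (S T : {set 'I_n}) (i j k : 'I_n) (r s : nat).

(** The entries mu of the arrow matrix are only implicit functions of (lambda, t), and
    differentiating them is avoided. At each point the operators in mu and in (lambda, t) are
    compared as linear functionals on words in the generators, where the product rules determine
    them; no chain rule occurs. The operator N is a diffusion on the simplex: each d_ik is tangent
    to it, and the drift beta/2 (t_i - t_k) is dictated by the Dirichlet density prod t_i^(beta/2 -
    1), which is what prod q_i^(beta-1) dq becomes under t_i = q_i^2. Integration over t is a linear
    functional on polynomials given by its moments. Its invariance under N is then a recurrence of
    the Dirichlet moments, and nothing is differentiated under an integral sign. The actual integral
    is still indispensable: the operator identity holds only where sum t_i = 1, not as one between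
    polynomials in t, and it is as an integral over the simplex that the functional depends on
    nothing but values there. *)

Definition elsym S r : K :=
  \sum_(T : {set 'I_n} | (T \subset S) && (#|T| == r)) \prod_(j in T) x j.

(* the derivative of [elsym S r] in [x k], for [k] in [S] *)
Definition elsymD S k r : K := if r is r'.+1 then elsym (S :\ k) r' else 0.

Lemma elsym0 S : elsym S 0 = 1.
Proof.
rewrite /elsym (big_pred1 set0) ?big_set0// => T /=.
by rewrite cards_eq0 andbC; case: eqP => // ->; rewrite sub0set.
Qed.

Lemma elsym_in S k r : k \in S ->
  x k * elsym (S :\ k) r =
  \sum_(T : {set 'I_n} | [&& T \subset S, #|T| == r.+1 & k \in T])
     \prod_(j in T) x j.
Proof.
move=> kS; rewrite /elsym big_distrr /=.
rewrite [RHS](reindex_onto (fun T => k |: T) (fun T => T :\ k)) /=; last first.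
  by move=> T /and3P[_ _ kT]; rewrite setD1K.
apply: eq_big => [T|T /andP[TS _]].
  rewrite subsetD1 subUset sub1set kS /= setU11 andbT cardsU1.
  case: (boolP (k \in T)) => kT /=; last first.
    by rewrite setU1K// eqxx !andbT add1n eqSS.
  rewrite andbF /=; apply/esym; apply/negbTE; rewrite !negb_and; apply/orP; right.
  by apply: contraTneq kT => <-; rewrite !inE eqxx.
rewrite big_setU1 //; apply: contraTN TS => kT.
by apply/subsetPn; exists k => //; rewrite !inE eqxx.
Qed.

Lemma elsym_rem S k r : k \in S ->
  elsym S r = elsym (S :\ k) r + x k * elsymD S k r.
Proof.
case: r => [|r] kS; first by rewrite !elsym0 /= mulr0 addr0.
rewrite [LHS](bigID (fun T : {set 'I_n} => k \in T)) /= addrC elsym_in//.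
congr (_ + _); apply: eq_bigl => T; last by rewrite andbA.
by rewrite subsetD1 andbAC.
Qed.

Lemma elsym_sum_in S r : \sum_(k in S) x k * elsym (S :\ k) r = r.+1%:R * elsym S r.+1.
Proof.
under eq_bigr do rewrite elsym_in//.
rewrite (exchange_big_dep (fun T : {set 'I_n} => (T \subset S) && (#|T| == r.+1))) /=.
  rewrite mulr_sumr; apply: eq_bigr => T /andP[TS /eqP cT].
  rewrite -[in RHS]cT -[in RHS]sum1_card natr_sum mulr_suml.
  rewrite [in RHS]big_mkcond [LHS]big_mkcond /=; apply: eq_bigr => i _.
  rewrite TS cT eqxx /=; case: (boolP (i \in T)) => iT; rewrite ?andbF// andbT.
  by rewrite (subsetP TS)// mul1r.
by move=> k T _ /and3P[-> ->].
Qed.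

Lemma elsymD_sum S r : \sum_(k in S) x k * elsymD S k r = r%:R * elsym S r.
Proof.
case: r => [|r]; last exact: elsym_sum_in.
by rewrite mul0r big1// => k _; rewrite mulr0.
Qed.

Lemma elsym_sum_out S r :
  \sum_(k in S) elsym (S :\ k) r = (#|S|%:R - r%:R) * elsym S r.
Proof.
rewrite mulrBl -elsymD_sum; apply/eqP; rewrite eq_sym subr_eq -big_split /=.
apply/eqP; rewrite -[in LHS]sum1_card natr_sum mulr_suml; apply: eq_bigr => k kS.
by rewrite mul1r -elsym_rem.
Qed.

(* sum_k x_k^2 d_k(e_r) d_k(e_s) *)
Definition elsym_gradprod S r s : K := \sum_(k in S) x k ^+ 2 * (elsymD S k r * elsymD S k s).

(** Shifts a unit from the second index to the first, so that induction on [s] ends at [s = 0],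
    where the sum vanishes. The corrections involve only values of [elsym], which therefore
    determine [elsym_gradprod]. *)
Lemma elsym_gradprod_rec S r s : elsym_gradprod S r s.+1 =
  elsym_gradprod S r.+1 s + s.+1%:R * (elsym S r * elsym S s.+1) - r.+1%:R * (elsym S r.+1 * elsym S s).
Proof.
rewrite mulrCA -elsym_sum_in [in X in _ - X]mulrA -elsym_sum_in.
rewrite mulr_sumr mulr_suml -addrA -sumrB -big_split /=; apply: eq_bigr => k kS.
by rewrite (elsym_rem r kS) (elsym_rem s kS) /=; ring.
Qed.

Lemma setD1C S i k : S :\ i :\ k = S :\ k :\ i.
Proof. by apply/setP => j; rewrite !inE andbCA. Qed.

Lemma elsymDC i k r : elsymD [set~ i] k r = elsymD [set~ k] i r.
Proof.
case: r => //= r; congr elsym; apply/setP => j; rewrite !inE.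
by rewrite andbC.
Qed.

Lemma elsymB i k r : i != k ->
  elsym [set~ i] r - elsym [set~ k] r = (x k - x i) * elsymD [set~ i] k r.
Proof.
move=> ik; rewrite (@elsym_rem [set~ i] k) ?(@elsym_rem [set~ k] i) ?inE//; last first.
  by rewrite eq_sym.
rewrite elsymDC (_ : [set~ i] :\ k = [set~ k] :\ i); first by ring.
by apply/setP => j; rewrite !inE andbC.
Qed.

Variable t : 'I_n -> K.

(* For the arrow matrix with spectrum x and t_i = q_i^2, the values e_r(mu) are
   [usym r]; [usymD k r] is the derivative of [usym r] in [x k]. *)
Definition usym r : K := \sum_i t i * elsym [set~ i] r.
Definition usymD k r : K := \sum_(i | i != k) t i * elsymD [set~ i] k r.

(** The second sum is the contribution of t: by [elsymB], d_ik maps [usym r] to [(x k - x i) *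
    elsymD [set~ i] k r], and the square of this factor cancels the denominator in N. *)
Definition usym_gradprod r s : K :=
  \sum_k x k ^+ 2 * (usymD k r * usymD k s) +
  \sum_i \sum_(k | k != i)
     x i * x k * (t i * t k) * (elsymD [set~ i] k r * elsymD [set~ i] k s).

(** Zero on the diagonal, so that the sums below run over the full index range. *)
Let dd i k r := if i == k then 0 else elsymD [set~ i] k r.

(** It has the form of [elsym_gradprod_rec], which is why the two carres du champ agree. Both sides
    are quadratic forms in [t] and are compared coefficient by coefficient. *)
Lemma usym_gradprod_rec r s : usym_gradprod r s.+1 =
  usym_gradprod r.+1 s + s.+1%:R * (usym r * usym s.+1) - r.+1%:R * (usym r.+1 * usym s).
Proof.
have usymDE k a : usymD k a = \sum_i t i * dd i k a.
  rewrite /usymD big_mkcond /=; apply: eq_bigr => i _.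
  by rewrite /dd; case: eqP; rewrite //= mulr0.
have usym_gradprodE a b : usym_gradprod a b = \sum_i \sum_j t i * t j *
    (\sum_k x k ^+ 2 * (dd i k a * dd j k b) + x i * x j * (dd i j a * dd i j b)).
  under [RHS]eq_bigr do
    (under eq_bigr do rewrite mulrDr; rewrite big_split /=); rewrite big_split /=.
  rewrite /usym_gradprod; congr (_ + _).
    under [LHS]eq_bigr do
      (rewrite !usymDE big_distrlr /= mulr_sumr;
       under eq_bigr do rewrite mulr_sumr).
    rewrite exchange_big /=; apply: eq_bigr => i _; rewrite exchange_big /=.
    by apply: eq_bigr => j _; rewrite mulr_sumr; apply: eq_bigr => k _; ring.
  apply: eq_bigr => i _; rewrite big_mkcond /=; apply: eq_bigr => k _.
  rewrite /dd eq_sym; case: eqP => //= _.  by ring.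
  by ring.
pose X i j := elsym [set~ i] r * (s.+1%:R * elsym [set~ j] s.+1) -
  r.+1%:R * elsym [set~ i] r.+1 * elsym [set~ j] s.
have XE : s.+1%:R * (usym r * usym s.+1) - r.+1%:R * (usym r.+1 * usym s) =
    \sum_i \sum_j t i * t j * X i j.
  rewrite /usym !big_distrlr /= [s.+1%:R * _]mulr_sumr [r.+1%:R * _]mulr_sumr -sumrB; apply: eq_bigr => i _.
  by rewrite [s.+1%:R * _]mulr_sumr [r.+1%:R * _]mulr_sumr -sumrB; apply: eq_bigr => j _; rewrite /X; ring.
rewrite -addrA XE !usym_gradprodE -big_split /=.
(* Antisymmetric in [i] and [j], so its quadratic form vanishes. Subtracting it makes the identity
   hold for each ordered pair, not only after symmetrization. *)
pose Y i j := (x i - x j) * (dd i j r.+1 * dd i j s.+1).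
have ddC i j a : dd i j a = dd j i a by rewrite /dd eq_sym elsymDC.
have Y0 : \sum_i \sum_j t i * t j * Y i j = 0.
  pose Z i j := t i * t j * (x i * (dd i j r.+1 * dd i j s.+1)).
  transitivity (\sum_i \sum_j (Z i j - Z j i)).
    by apply: eq_bigr => i _; apply: eq_bigr => j _; rewrite /Z /Y !(ddC j i); ring.
  under eq_bigr do rewrite sumrB.
  by rewrite sumrB [X in _ - X]exchange_big subrr.
rewrite -[RHS]subr0 -[X in _ = _ - X]Y0 -sumrB; apply: eq_bigr => i _.
rewrite -big_split -sumrB /=; apply: eq_bigr => j _.
rewrite -!mulrDr -mulrBr; congr (_ * _).
have -> : X i j = elsym [set~ i] r * (\sum_(k | k != j) x k * dd k j s.+1) -
    (\sum_(k | k != i) x k * dd k i r.+1) * elsym [set~ j] s.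
  rewrite /X -!elsym_sum_in; congr (_ * _ - _ * _); apply: eq_big => [k|k] //;
    rewrite !inE // => /negbTE kj; rewrite ddC /dd eq_sym kj //.
(* On the diagonal this is [elsym_gradprod_rec] for the variables other than [x i]. *)
have [<-{j}|ij] := eqVneq i j.
  have := @elsym_gradprod_rec [set~ i] r s; rewrite /elsym_gradprod /Y subrr mul0r subr0.
  rewrite (_ : dd i i r = 0) /dd ?eqxx// !mul0r !mulr0 !addr0.
  have E a b : \sum_(k in [set~ i]) x k ^+ 2 * (elsymD [set~ i] k a * elsymD [set~ i] k b) =
      \sum_k x k ^+ 2 * (dd i k a * dd i k b).
    rewrite big_mkcond; apply: eq_bigr => k _; rewrite !inE /dd eq_sym.
    by case: eqP; rewrite //= mul0r mulr0.
  rewrite !E /dd => ->; rewrite -addrA; congr (_ + _).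
  rewrite mulrCA -elsym_sum_in [in X in _ - X]mulrA -elsym_sum_in.
  by congr (_ * _ - _ * _); apply: eq_big => [k|k]; rewrite !inE// => /negbTE ki;
    rewrite ki (elsymDC k i).
have sumE a b : \sum_k x k ^+ 2 * (dd i k a * dd j k b) =
    \sum_(k | (k != j) && (k != i)) x k ^+ 2 * (dd i k a * dd j k b).
  have ji : i != j by [].
  by rewrite [LHS](bigD1 j) //= (bigD1 i) //= /dd !eqxx /=; ring.
(* Off the diagonal the terms with [k] equal to [i] or [j] are split off; the others match one by
   one through this removal of [x k]. *)
have elE k a b : k != a -> elsym [set~ a] b = dd a k b.+1 + x k * dd a k b.
  by move=> ka; rewrite /dd eq_sym (negbTE ka) /= (@elsym_rem _ k) ?inE.
have -> : \sum_(k | k != j) x k * dd k j s.+1 =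
    x i * dd i j s.+1 + \sum_(k | (k != j) && (k != i)) x k * dd j k s.+1.
  by rewrite (bigD1 i)//=; congr (_ + _); apply: eq_bigr => k _; rewrite ddC.
have -> : \sum_(k | k != i) x k * dd k i r.+1 =
    x j * dd i j r.+1 + \sum_(k | (k != j) && (k != i)) x k * dd i k r.+1.
  rewrite (bigD1 j) 1?eq_sym//= ddC; congr (_ + _).
  by apply: eq_big => [k|k _]; rewrite ?(ddC k)// andbC.
rewrite !sumE.
have -> : \sum_(k | (k != j) && (k != i)) x k ^+ 2 * (dd i k r * dd j k s.+1) =
    \sum_(k | (k != j) && (k != i)) x k ^+ 2 * (dd i k r.+1 * dd j k s) +
    (elsym [set~ i] r * (\sum_(k | (k != j) && (k != i)) x k * dd j k s.+1) -
     (\sum_(k | (k != j) && (k != i)) x k * dd i k r.+1) * elsym [set~ j] s).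
  rewrite big_distrr big_distrl /= -sumrB -big_split /=.
  by apply: eq_bigr => k /andP[kj ki]; rewrite (elE _ _ r ki) (elE _ _ s kj); ring.
have ei : elsym [set~ i] r = dd i j r.+1 + x j * dd i j r by rewrite (elE j)// eq_sym.
have ej : elsym [set~ j] s = dd i j s.+1 + x i * dd i j s by rewrite (elE i)// !(ddC j).
rewrite /Y {}ei {}ej.
move: (\sum_(k | (k != j) && (k != i)) x k ^+ 2 * (dd i k r.+1 * dd j k s)) => A.
move: (\sum_(k | (k != j) && (k != i)) x k * dd j k s.+1) => B.
by move: (\sum_(k | (k != j) && (k != i)) x k * dd i k r.+1) => C; ring.
Qed.
End Elsym.

Notation elsymT x r := (elsym x setT r).

(** * First-order part of the operators on the generators *)

Section ElsymEigen.
Variables (F : numFieldType) (n : nat) (x : 'I_n -> F).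
Implicit Types (S : {set 'I_n}) (i j k : 'I_n) (r s : nat).

Lemma sum_pairC (G : 'I_n -> 'I_n -> F) S :
  \sum_(k in S) \sum_(j in S :\ k) G k j = \sum_(k in S) \sum_(j in S :\ k) G j k.
Proof.
rewrite (exchange_big_dep (mem S)) /=; last by move=> k j _ /setD1P[].
apply: eq_bigr => k kS; apply: eq_bigl => j.
by rewrite !inE kS andbT eq_sym andbC.
Qed.

(** Adding the terms for (k, j) and (j, k) cancels the denominator; the resulting polynomial sums
    are evaluated by the counting identities [elsym_sum_in] and [elsym_sum_out]. *)
Lemma elsym_eigen S r : {in S &, injective x} ->
  \sum_(k in S) \sum_(j in S :\ k) x k ^+ 2 / (x k - x j) * elsymD x S k r =
  ((#|S|%:R - 1) * r%:R - r%:R * (r%:R - 1) / 2) * elsym x S r.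
Proof.
move=> xI; case: r => [|r].
  rewrite !(mulr0, mul0r) subr0 mul0r big1// => k _; rewrite big1// => j _.
  by rewrite mulr0.
have two0 : 2 != 0 :> F by rewrite pnatr_eq0.
apply: (mulfI two0); rewrite -[LHS]/(2 * _) mulr_natl mulr2n {1}sum_pairC -big_split /=.
pose d k j := elsymD x (S :\ k) j r.
transitivity (\sum_(k in S) \sum_(j in S :\ k) (x k * elsym x (S :\ k :\ j) r +
    x j * elsym x (S :\ k :\ j) r + x k * (x j * d k j))).
  apply: eq_bigr => k kS; rewrite -big_split; apply: eq_bigr => j /[dup] jSk /setD1P[jk jS].
  have kSj : k \in S :\ j by rewrite !inE eq_sym jk.
  have xkj : x k - x j != 0 by rewrite subr_eq0; apply: contra jk => /eqP /xI ->.
  have xjk : x j - x k != 0 by rewrite -opprB oppr_eq0.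
  rewrite /= (elsym_rem x _ jSk) (elsym_rem x _ kSj) (setD1C S j k) /d.
  rewrite (_ : elsymD x (S :\ j) k r = elsymD x (S :\ k) j r); last first.
    by case: (r) => //= r'; rewrite setD1C.
  by field; rewrite xkj xjk.
have cS k : k \in S -> #|S :\ k|%:R = #|S|%:R - 1 :> F.
  by move=> kS; rewrite (cardsD1 k S) kS natrD addrC addKr.
under eq_bigr => k kS.
  rewrite !big_split /= -!mulr_sumr elsym_sum_out cS// elsym_sum_in /d elsymD_sum.
  over.
rewrite !big_split /=.
under eq_bigr => k kS do rewrite mulrCA.
rewrite -mulr_sumr elsym_sum_in -mulr_sumr elsym_sum_out.
under eq_bigr => k kS do rewrite mulrCA.
rewrite -mulr_sumr elsym_sum_in -[r.+1]addn1 natrD.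
by field.
Qed.

Variable t : 'I_n -> F.

(** Symmetrizing the sum with squared denominators produces terms that combine with the terms
    [j = i] of the first sum: [x k ^+ 2 / (x k - x i) - x i * x k / (x k - x i) = x k]. For each [i]
    there remain [elsym_eigen] on the complement of [i] and an Euler sum. *)
Lemma usym_eigen r : injective x ->
  2 * (\sum_k \sum_(j | k != j) x k ^+ 2 / (x k - x j) * usymD x t k r) -
  \sum_i \sum_(k | k != i) x i * x k / (x k - x i) ^+ 2 *
    ((t i - t k) * (elsym x [set~ i] r - elsym x [set~ k] r)) =
  2 * ((n%:R - 1) * r%:R - r%:R * (r%:R - 1) / 2) * usym x t r.
Proof.
move=> xI.
pose d i k := elsymD x [set~ i] k r.
pose c k j := x k ^+ 2 / (x k - x j).
have -> : \sum_i \sum_(k | k != i) x i * x k / (x k - x i) ^+ 2 *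
    ((t i - t k) * (elsym x [set~ i] r - elsym x [set~ k] r)) =
  2 * \sum_i \sum_(k | k != i) t i * (x i * x k / (x k - x i) * d i k).
  pose Z i k := t i * (x i * x k / (x k - x i) * d i k).
  transitivity (\sum_i \sum_(k | k != i) (Z i k + Z k i)).
    apply: eq_bigr => i _; apply: eq_bigr => k ki.
    have h : x k - x i != 0 by rewrite subr_eq0; apply: contra ki => /eqP /xI ->.
    have h' : x i - x k != 0 by rewrite -opprB oppr_eq0.
    rewrite elsymB 1?eq_sym// /Z /d (elsymDC x k i).
    by field; rewrite h h'.
  rewrite mulr_natl mulr2n [in RHS]/= -[X in _ = X + _]/(\sum_i \sum_(k | k != i) Z i k).
  under [LHS]eq_bigr do rewrite big_split /=.
  rewrite big_split /=; congr (_ + _).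
  rewrite (exchange_big_dep xpredT) //=.
  by apply: eq_bigr => i _; apply: eq_bigl => k; rewrite eq_sym.
rewrite -mulrBr -mulrA; congr (2 * _).
have -> : \sum_k \sum_(j | k != j) x k ^+ 2 / (x k - x j) * usymD x t k r =
   \sum_i t i * \sum_(k | k != i) \sum_(j | k != j) c k j * d i k.
  under eq_bigr => k _ do
    (rewrite -mulr_suml /usymD mulr_sumr).
  rewrite (exchange_big_dep xpredT) //=; apply: eq_bigr => i _.
  rewrite mulr_sumr; apply: eq_big => [k|k _]; first by rewrite eq_sym.
  by rewrite -mulr_suml -/(d i k); ring.
under [X in _ - X]eq_bigr do rewrite -mulr_sumr.
rewrite -sumrB /usym mulr_sumr; apply: eq_bigr => i _.
rewrite -mulrBr [RHS]mulrCA; congr (_ * _).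
rewrite -sumrB.
transitivity (\sum_(k in [set~ i]) x k * d i k +
   \sum_(k in [set~ i]) \sum_(j in [set~ i] :\ k) c k j * d i k).
  rewrite -big_split; apply: eq_big => [k|k ki]; first by rewrite !inE.
  rewrite (bigD1 i)//= addrAC; congr (_ + _).
    rewrite /c; field; rewrite subr_eq0; apply: contra ki => /eqP /xI ->//.
  by apply: eq_bigl => j; rewrite !inE eq_sym.
rewrite elsymD_sum elsym_eigen; last by move=> ? ? _ _; exact: xI.
have nE : n%:R = n.-1%:R + 1 :> F.
  by rewrite natr1 prednK// (leq_ltn_trans _ (ltn_ord i)).
by rewrite cardsC1 card_ord nE; field.
Qed.
End ElsymEigen.

Lemma addr_idem0 (V : zmodType) (x : V) : x = x + x -> x = 0.
Proof. by move=> e; apply: (addrI x); rewrite addr0 -e. Qed.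

(** * Second order operators and the change of variables *)

Section Diffop.
Variables (A K : comNzRingType) (ev : {rmorphism A -> K}).
Implicit Types (d : A -> A) (D : A -> K) (G : A -> A -> K).

Definition derivation d := forall p q, d (p * q) = d p * q + p * d q.

(* [D] acts on products like an operator of order 2 whose carre du champ is [G],
   so it is determined on an algebra by its values and those of [G] on generators. *)
Definition diffop2 D G :=
  (forall p q, D (p * q) = D p * ev q + ev p * D q + 2 * G p q) /\
  (forall p q r, G (p * q) r = ev p * G q r + ev q * G p r) /\
  (forall p q, G p q = G q p).

Lemma diffop2_derivation c d : derivation d -> 
  diffop2 (fun p => c * ev (d p)) (fun _ _ => 0).
Proof.
move=> dM; split=> [p q|]; last by split=> // *; rewrite !mulr0 addr0.
by rewrite dM rmorphD !rmorphM mulr0 addr0 /=; ring.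
Qed.

Lemma diffop2_derivation2 c d : derivation d -> {morph d : p q / p + q} ->
  diffop2 (fun p => c * ev (d (d p))) (fun p q => c * (ev (d p) * ev (d q))).
Proof.
move=> dM dD; split=> [p q|]; last split=> [p q r|p q].
- by rewrite dM dD !dM !rmorphD !rmorphM /=; ring.
- by rewrite dM rmorphD !rmorphM /=; ring.
- by rewrite [ev _ * _]mulrC.
Qed.

Lemma eq_diffop2 D D' G G' : D =1 D' -> G =2 G' -> diffop2 D G -> diffop2 D' G'.
Proof.
move=> DD GG [DM [GM GC]]; split=> [p q|]; last split=> [p q r|p q].
- by rewrite -!DD -GG.
- by rewrite -!GG.
- by rewrite -!GG.
Qed.

Lemma diffop2D mu_op mu_gradprod xt_op xt_gradprod : diffop2 mu_op mu_gradprod -> diffop2 xt_op xt_gradprod ->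
  diffop2 (fun p => mu_op p + xt_op p) (fun p q => mu_gradprod p q + xt_gradprod p q).
Proof.
move=> [D1M [G1M G1C]] [D2M [G2M G2C]]; split=> [p q|]; last split=> [p q r|p q].
- by rewrite D1M D2M; ring.
- by rewrite G1M G2M; ring.
- by rewrite G1C G2C.
Qed.

Lemma diffop2_sum (I : finType) (P : pred I) (D : I -> A -> K) (G : I -> A -> A -> K) :
  (forall i, P i -> diffop2 (D i) (G i)) ->
  diffop2 (fun p => \sum_(i | P i) D i p) (fun p q => \sum_(i | P i) G i p q).
Proof.
move=> h; split=> [p q|]; last split=> [p q r|p q].
- rewrite mulr_suml !mulr_sumr -!big_split; apply: eq_bigr => i /h[-> _] //.
- by rewrite !mulr_sumr -big_split; apply: eq_bigr => i /h[_ [-> _]].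
- by apply: eq_bigr => i /h[_ [_ ->]].
Qed.

Lemma diffop2_1 D G : diffop2 D G -> D 1 = 0 /\ forall r, G 1 r = 0.
Proof.
move=> [DM [GM _]]; have mu_gradprod r : G 1 r = 0.
  by apply: addr_idem0; have := GM 1 1 r; rewrite mulr1 rmorph1 !mul1r.
split=> //; apply: addr_idem0.
by have := DM 1 1; rewrite mu_gradprod mulr0 mulr1 rmorph1 !mul1r addr0 mulr1.
Qed.

Lemma derivation_prod d (I : finType) (P : pred I) (F : I -> A) :
  derivation d -> (forall i, P i -> d (F i) = 0) -> d (\prod_(i | P i) F i) = 0.
Proof.
move=> dM dF; have d1 : d 1 = 0.
  by apply: addr_idem0; have := dM 1 1; rewrite !mulr1 mul1r.
apply: (big_ind (fun p => d p = 0)) => // p q dp dq.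
by rewrite dM dp dq mul0r mulr0 addr0.
Qed.
End Diffop.

Section DiffopMatch.
Variables (A1 A2 K : comNzRingType).
Variables (ev1 : {rmorphism A1 -> K}) (ev2 : {rmorphism A2 -> K}).
Variables (mu_op : A1 -> K) (mu_gradprod : A1 -> A1 -> K) (xt_op : A2 -> K) (xt_gradprod : A2 -> A2 -> K).
Variables (u1 : nat -> A1) (u2 : nat -> A2).

(** Everything takes place at one evaluation point: the product rules reduce words to generators, so
    equal values on generators suffice to link the two algebras. *)
Lemma diffop2_match :
  diffop2 ev1 mu_op mu_gradprod -> diffop2 ev2 xt_op xt_gradprod ->
  (forall r, ev1 (u1 r) = ev2 (u2 r)) ->
  (forall r, mu_op (u1 r) = xt_op (u2 r)) ->
  (forall r s, mu_gradprod (u1 r) (u1 s) = xt_gradprod (u2 r) (u2 s)) ->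
  forall s : seq nat, ev1 (\prod_(r <- s) u1 r) = ev2 (\prod_(r <- s) u2 r) /\
    mu_op (\prod_(r <- s) u1 r) = xt_op (\prod_(r <- s) u2 r).
Proof.
move=> h1 h2 evE DE GE s.
(* The value on a longer word involves the carre du champ of the word with the next generator, so
   this agreement is carried along the induction. *)
suff [-> [-> _]] : ev1 (\prod_(r <- s) u1 r) = ev2 (\prod_(r <- s) u2 r) /\
    mu_op (\prod_(r <- s) u1 r) = xt_op (\prod_(r <- s) u2 r) /\
    forall r, mu_gradprod (\prod_(r <- s) u1 r) (u1 r) = xt_gradprod (\prod_(r <- s) u2 r) (u2 r) by [].
elim: s => [|a s [IHe [IHD IHG]]].
  have [D11 G11] := diffop2_1 h1; have [D21 G21] := diffop2_1 h2.
  by rewrite !big_nil !rmorph1 D11 D21; split=> //; split => // r; rewrite G11 G21.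
case: h1 h2 => [D1M [G1M G1C]] [D2M [G2M G2C]].
rewrite !big_cons !rmorphM IHe evE; split=> //; split.
  by rewrite D1M D2M DE IHe evE IHD G1C G2C IHG.
by move=> r; rewrite G1M G2M IHG GE IHe evE.
Qed.
End DiffopMatch.

Section ElsymDeriv.
Variables (A : comNzRingType) (n : nat) (x : 'I_n -> A) (d : {additive A -> A}).
Hypothesis dM : derivation d.

Lemma elsym_deriv0 (S : {set 'I_n}) r : {in S, forall j, d (x j) = 0} -> d (elsym x S r) = 0.
Proof.
move=> dx; rewrite raddf_sum big1// => T /andP[TS _].
by apply: derivation_prod => // j jT; rewrite dx// (subsetP TS).
Qed.

Lemma elsym_deriv k (S : {set 'I_n}) r : (forall j, d (x j) = (j == k)%:R) -> k \in S ->
  d (elsym x S r) = elsymD x S k r.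
Proof.
move=> dx kS; rewrite (elsym_rem _ _ kS) raddfD /= dM dx eqxx mul1r.
rewrite elsym_deriv0 ?add0r; last by move=> j /setD1P[/negbTE jk _]; rewrite dx jk.
case: r => [|r] /=; first by rewrite raddf0 mulr0 addr0.
rewrite elsym_deriv0 ?mulr0 ?addr0// => j /setD1P[/negbTE jk _].
by rewrite dx jk.
Qed.
End ElsymDeriv.

Section ElsymMorph.
Variables (A K : comNzRingType) (f : {rmorphism A -> K}) (n : nat) (x t : 'I_n -> A).

Lemma elsym_morph (S : {set 'I_n}) r : f (elsym x S r) = elsym (f \o x) S r.
Proof. by rewrite rmorph_sum; apply: eq_bigr => T _; rewrite rmorph_prod. Qed.

Lemma elsymD_morph (S : {set 'I_n}) k r : f (elsymD x S k r) = elsymD (f \o x) S k r.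
Proof. by case: r => [|r]; rewrite ?rmorph0//= elsym_morph. Qed.

Lemma usym_morph r : f (usym x t r) = usym (f \o x) (f \o t) r.
Proof.
by rewrite rmorph_sum; apply: eq_bigr => i _; rewrite rmorphM elsym_morph.
Qed.

Lemma usymD_morph k r : f (usymD x t k r) = usymD (f \o x) (f \o t) k r.
Proof.
by rewrite rmorph_sum; apply: eq_bigr => i _; rewrite rmorphM elsymD_morph.
Qed.
End ElsymMorph.

Lemma eq_elsym (K : comNzRingType) n (x y : 'I_n -> K) (S : {set 'I_n}) r :
  x =1 y -> elsym x S r = elsym y S r.
Proof. by move=> xy; apply: eq_bigr => T _; apply: eq_bigr => i _; rewrite xy. Qed.

Section JackOp.
Variables (F : numFieldType) (beta : F).

Definition jack_op n (p : mpoly n F) (x : 'I_n -> F) : F :=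
  \sum_i x i ^+ 2 * meval x (mderiv i (mderiv i p)) +
  beta * \sum_i \sum_(j | i != j) x i ^+ 2 / (x i - x j) * meval x (mderiv i p).

Definition euler_op n (p : mpoly n F) (x : 'I_n -> F) : F := \sum_i x i * meval x (mderiv i p).

Lemma mderiv_derivation n (i : 'I_n) : derivation (mderiv i : mpoly n F -> mpoly n F).
Proof. by move=> p q; rewrite mderivM. Qed.

Definition mvar n (i : 'I_n) : mpoly n F := mpolyX F (mnm1 i).

Lemma mderivXU n (i j : 'I_n) : mderiv i (mvar j) = (j == i)%:R.
Proof.
rewrite mderivX mnm1E; case: eqP => [->|_]; last by rewrite scale0r.
by rewrite scale1r (_ : mnm_sub _ _ = mnm0) ?mpolyX0//; apply/mnmP => k;
  rewrite mnmBE mnm0E subnn.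
Qed.

Section OneSet.
Variables (m : nat) (mu : 'I_m -> F).

Definition elsym_poly r : mpoly m F := elsym (@mvar m) setT r.

Lemma meval_elsym_poly r : meval mu (elsym_poly r) = elsym mu setT r.
Proof. by rewrite elsym_morph; apply: eq_elsym => i; rewrite /= mevalXU. Qed.

Lemma mderiv_elsym_poly k r : mderiv k (elsym_poly r) = elsymD (@mvar m) setT k r.
Proof.
apply: (@elsym_deriv _ _ _ (mderiv k)); last by rewrite inE.
  exact: mderiv_derivation.
by move=> j; exact: mderivXU.
Qed.

Lemma mderiv2_elsym_poly k r : mderiv k (mderiv k (elsym_poly r)) = 0.
Proof.
rewrite mderiv_elsym_poly; case: r => [|r]; first by rewrite /= raddf0.
apply: (@elsym_deriv0 _ _ _ (mderiv k)); first exact: mderiv_derivation.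
by move=> j /setD1P[/negbTE jk _]; rewrite [LHS]mderivXU jk.
Qed.

(** The Euler term makes up for the variable missing from [mu]: on homogeneous polynomials it raises
    the eigenvalue by [beta] times the degree, the difference between n - 1 and n variables. *)
Definition mu_op (p : mpoly m F) : F := jack_op p mu + beta * euler_op p mu.

Definition mu_gradprod (p q : mpoly m F) : F :=
  \sum_i mu i ^+ 2 * (meval mu (mderiv i p) * meval mu (mderiv i q)).

Lemma mu_op_diffop2 : diffop2 (meval mu) mu_op mu_gradprod.
Proof.
apply: (@eq_diffop2 _ _ _ (fun p =>
    \sum_i mu i ^+ 2 * meval mu (mderiv i (mderiv i p)) +
    \sum_i (\sum_(j | i != j) beta * (mu i ^+ 2 / (mu i - mu j)) * meval mu (mderiv i p) +
     beta * mu i * meval mu (mderiv i p))) _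
   (fun p q => mu_gradprod p q + \sum_(i < m) (\sum_(j | i != j) 0 + 0))).
- move=> p; rewrite /mu_op /jack_op /euler_op -addrA big_split /=; congr (_ + (_ + _)).
    rewrite mulr_sumr; apply: eq_bigr => i _; rewrite mulr_sumr.
    by apply: eq_bigr => j _; rewrite [RHS]mulrA.
  by rewrite mulr_sumr; apply: eq_bigr => i _; rewrite [RHS]mulrA.
- by move=> p q; rewrite [X in _ + X]big1 ?addr0// => i _; rewrite big1// addr0.
have dM i := @mderiv_derivation m i.
apply: diffop2D; first apply: diffop2_sum => i _.
  by apply: diffop2_derivation2 => //; exact: raddfD.
apply: diffop2_sum => i _; apply: diffop2D; last exact: diffop2_derivation.
by apply: diffop2_sum => j _; exact: diffop2_derivation.
Qed.

Lemma mu_op_elsym_poly r : injective mu ->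
  mu_op (elsym_poly r) = beta * (m%:R * r%:R - r%:R * (r%:R - 1) / 2) * elsym mu setT r.
Proof.
move=> muI; rewrite /mu_op /jack_op /euler_op big1 ?add0r => [|i _]; last first.
  by rewrite mderiv2_elsym_poly raddf0 mulr0.
have eD i : meval mu (mderiv i (elsym_poly r)) = elsymD mu setT i r.
  rewrite mderiv_elsym_poly elsymD_morph; case: r => //= r; apply: eq_elsym => j.
  by rewrite /= mevalXU.
under eq_bigr do under eq_bigr do rewrite eD.
under [X in _ + _ * X]eq_bigr do rewrite eD.
have := @elsym_eigen _ _ mu setT r (in2W muI).
rewrite (eq_bigr (fun i => \sum_(j | i != j) mu i ^+ 2 / (mu i - mu j) * elsymD mu setT i r)).
  rewrite (eq_bigl xpredT) => [->|i]; last by rewrite inE.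
  rewrite (eq_bigl (mem [set: 'I_m])) => [|i]; last by rewrite !inE.
  rewrite elsymD_sum cardsT card_ord; ring.
move=> i _; apply: eq_bigl => j; by rewrite !inE andbT eq_sym.
Qed.

Lemma mu_gradprod_elsym_poly r s : mu_gradprod (elsym_poly r) (elsym_poly s) = elsym_gradprod mu setT r s.
Proof.
have eD i a : meval mu (mderiv i (elsym_poly a)) = elsymD mu setT i a.
  rewrite mderiv_elsym_poly elsymD_morph; case: a => //= a; apply: eq_elsym => j.
  by rewrite /= mevalXU.
by apply: eq_big => [i|i _]; rewrite ?inE// !eD.
Qed.

End OneSet.

Section TwoSets.
Variables (n : nat) (x t : 'I_n -> F).

(* Polynomials in [n + n] variables are polynomials in x (left) and t (right). *)
Definition join_pt (i : 'I_(n + n)) : F :=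
  match fintype.split i with inl k => x k | inr k => t k end.

Lemma join_ptl k : join_pt (lshift n k) = x k.
Proof. by rewrite /join_pt -[lshift n k]/(unsplit (inl k)) unsplitK. Qed.

Lemma join_ptr k : join_pt (rshift n k) = t k.
Proof. by rewrite /join_pt -[rshift n k]/(unsplit (inr k)) unsplitK. Qed.

Let X k : mpoly (n + n) F := mvar (lshift n k).
Let T k : mpoly (n + n) F := mvar (rshift n k).

Definition usym_poly r : mpoly (n + n) F := usym X T r.

Lemma meval_usym_poly r : meval join_pt (usym_poly r) = usym x t r.
Proof.
rewrite usym_morph; apply: eq_bigr => i _.
by rewrite /= mevalXU join_ptr; congr (_ * _); apply: eq_elsym => j; rewrite /= mevalXU join_ptl.
Qed.

Lemma mderivl_usym_poly k r : mderiv (lshift n k) (usym_poly r) = usymD X T k r.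
Proof.
have dX j : mderiv (lshift n k) (X j) = (j == k)%:R.
  by rewrite mderivXU eq_lshift.
have dT j : mderiv (lshift n k) (T j) = 0 by rewrite mderivXU eq_rlshift.
rewrite raddf_sum /= [RHS]big_mkcond; apply: eq_bigr => i _.
rewrite mderiv_derivation dT mul0r add0r; case: eqP => [->|/eqP ik] /=.
  rewrite (@elsym_deriv0 _ _ _ (mderiv _)) ?mulr0//; first exact: mderiv_derivation.
  by move=> j; rewrite !inE => /negbTE jk; rewrite [LHS]dX jk.
rewrite (@elsym_deriv _ _ _ (mderiv _) _ k) ?inE 1?eq_sym//.
exact: mderiv_derivation.
Qed.

Lemma mderivl2_usym_poly k r : mderiv (lshift n k) (mderiv (lshift n k) (usym_poly r)) = 0.
Proof.
have dX j : mderiv (lshift n k) (X j) = (j == k)%:R.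
  by rewrite mderivXU eq_lshift.
have dT j : mderiv (lshift n k) (T j) = 0 by rewrite mderivXU eq_rlshift.
rewrite mderivl_usym_poly raddf_sum /= big1// => i _.
rewrite mderiv_derivation dT mul0r add0r; case: r => [|r] /=; first by rewrite raddf0 mulr0.
rewrite (@elsym_deriv0 _ _ _ (mderiv _)) ?mulr0//; first exact: mderiv_derivation.
by move=> j; rewrite !inE => /andP[/negbTE jk _]; rewrite [LHS]dX jk.
Qed.

Lemma mderivr_usym_poly i r : mderiv (rshift n i) (usym_poly r) = elsym X [set~ i] r.
Proof.
have dX j : mderiv (rshift n i) (X j) = 0 by rewrite mderivXU eq_lrshift.
have dT j : mderiv (rshift n i) (T j) = (j == i)%:R by rewrite mderivXU eq_rshift.
have dE j : mderiv (rshift n i) (elsym X [set~ j] r) = 0.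
  rewrite (@elsym_deriv0 _ _ _ (mderiv _)) //; first exact: mderiv_derivation.
  by move=> l _; exact: dX.
rewrite raddf_sum /= (bigD1 i)//= big1 ?addr0 => [|j /negbTE ji].
  by rewrite mderiv_derivation dT dE eqxx mulr0 addr0 mul1r.
by rewrite mderiv_derivation dT dE ji mul0r mulr0 addr0.
Qed.

Lemma mderivr2_usym_poly i k r : mderiv (rshift n k) (mderiv (rshift n i) (usym_poly r)) = 0.
Proof.
rewrite mderivr_usym_poly (@elsym_deriv0 _ _ _ (mderiv _)) //; first exact: mderiv_derivation.
by move=> j _; rewrite [LHS]mderivXU eq_lrshift.
Qed.

(** A derivative in a direction tangent to the simplex. *)
Definition deriv_diff i k (p : mpoly (n + n) F) :=
  mderiv (rshift n i) p - mderiv (rshift n k) p.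

Lemma deriv_diff_derivation i k : derivation (deriv_diff i k).
Proof. by move=> p q; rewrite /deriv_diff !mderiv_derivation; ring. Qed.

Lemma deriv_diffD i k : {morph deriv_diff i k : p q / p + q}.
Proof. by move=> p q; rewrite /deriv_diff !raddfD /=; ring. Qed.

Definition pair_coef i k : F := x i * x k / (x k - x i) ^+ 2.

(* The operator in (x, t) that reproduces [mu_op] when e_r(mu) is replaced by
   [usym x t r]; the last sum is the part killed by integration over t. *)
Definition xt_op (p : mpoly (n + n) F) : F :=
  \sum_k x k ^+ 2 * meval join_pt (mderiv (lshift n k) (mderiv (lshift n k) p)) +
  \sum_k \sum_(j | k != j) beta * (x k ^+ 2 / (x k - x j)) *
      meval join_pt (mderiv (lshift n k) p) +
  \sum_i \sum_(k | k != i) (- (beta / 2 * pair_coef i k * (t i - t k)) * meval join_pt (deriv_diff i k p) +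
     pair_coef i k * (t i * t k) * meval join_pt (deriv_diff i k (deriv_diff i k p))).

Definition xt_gradprod (p q : mpoly (n + n) F) : F :=
  \sum_k x k ^+ 2 * (meval join_pt (mderiv (lshift n k) p) * meval join_pt (mderiv (lshift n k) q)) +
  \sum_i \sum_(k | k != i)
     pair_coef i k * (t i * t k) * (meval join_pt (deriv_diff i k p) * meval join_pt (deriv_diff i k q)).

Lemma xt_op_diffop2 : diffop2 (meval join_pt) xt_op xt_gradprod.
Proof.
apply: (@eq_diffop2 _ _ _ xt_op _ (fun p q =>
  \sum_k x k ^+ 2 * (meval join_pt (mderiv (lshift n k) p) * meval join_pt (mderiv (lshift n k) q)) +
  \sum_(k < n) \sum_(j < n | k != j) 0 +
  \sum_i \sum_(k | k != i)
     (0 + pair_coef i k * (t i * t k) * (meval join_pt (deriv_diff i k p) * meval join_pt (deriv_diff i k q))))) => //.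
  move=> p q; rewrite [X in _ + X + _]big1 ?addr0 => [|i _]; last by rewrite big1.
  by congr (_ + _); apply: eq_bigr => i _; apply: eq_bigr => k _; rewrite add0r.
have dM i := @mderiv_derivation (n + n) i.
apply: diffop2D; first apply: diffop2D; apply: diffop2_sum => i _.
- by apply: diffop2_derivation2 => //; exact: raddfD.
- by apply: diffop2_sum => j _; exact: diffop2_derivation.
- apply: diffop2_sum => j _; apply: diffop2D; first exact/diffop2_derivation/deriv_diff_derivation.
  by apply: diffop2_derivation2; [exact: deriv_diff_derivation|exact: deriv_diffD].
Qed.

Let evl k r : meval join_pt (mderiv (lshift n k) (usym_poly r)) = usymD x t k r.
Proof.
rewrite mderivl_usym_poly usymD_morph; apply: eq_bigr => i _.
rewrite /= mevalXU join_ptr; congr (_ * _); case: r => //= r.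
by apply: eq_elsym => j; rewrite /= mevalXU join_ptl.
Qed.

Let evr i k r : meval join_pt (deriv_diff i k (usym_poly r)) = elsym x [set~ i] r - elsym x [set~ k] r.
Proof.
rewrite /deriv_diff raddfB /= !mderivr_usym_poly !elsym_morph.
by congr (_ - _); apply: eq_elsym => j; rewrite /= mevalXU join_ptl.
Qed.

Lemma xt_op_usym_poly r : injective x ->
  xt_op (usym_poly r) = beta * ((n%:R - 1) * r%:R - r%:R * (r%:R - 1) / 2) * usym x t r.
Proof.
move=> xI; rewrite /xt_op big1 ?add0r => [|k _]; last first.
  by rewrite mderivl2_usym_poly raddf0 mulr0.
rewrite -[RHS]mulrA.
have b0 : beta = (beta / 2) * 2 by field.
rewrite {3}b0 -[RHS]mulrA [2 * _]mulrA -usym_eigen// mulrBr; congr (_ + _).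
  rewrite mulrA -b0 mulr_sumr; apply: eq_bigr => k _.
  by rewrite mulr_sumr; apply: eq_bigr => j _; rewrite evl [RHS]mulrA.
rewrite -mulNr mulr_sumr; apply: eq_bigr => i _.
rewrite mulr_sumr; apply: eq_bigr => k _.
rewrite evr.
have -> : deriv_diff i k (deriv_diff i k (usym_poly r)) = 0.
  by rewrite /deriv_diff !raddfB /= !mderivr2_usym_poly !oppr0 !addr0.
by rewrite raddf0 mulr0 addr0 /pair_coef; ring.
Qed.

Lemma xt_gradprod_usym_poly r s : injective x -> xt_gradprod (usym_poly r) (usym_poly s) = usym_gradprod x t r s.
Proof.
move=> xI; rewrite /xt_gradprod /usym_gradprod; apply: (congr2 +%R).
  apply: eq_bigr => k _.
  exact: (congr2 (fun a b => x k ^+ 2 * (a * b)) (evl k r) (evl k s)).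
apply: eq_bigr => i _; apply: eq_bigr => k ki.
have h : x k - x i != 0 by rewrite subr_eq0; apply: contra ki => /eqP /xI ->.
have ik : i != k by rewrite eq_sym.
have e a := etrans (evr i k a) (elsymB x a ik).
rewrite /pair_coef; apply: (etrans (congr2 (fun a b => _ * (a * b)) (e r) (e s))).
by field.
Qed.

End TwoSets.

Lemma mu_op_xt_op m n (mu : 'I_m -> F) (x t : 'I_n -> F) (s : seq nat) :
  n = m.+1 -> injective mu -> injective x ->
  (forall r, elsym mu setT r = usym x t r) ->
  meval mu (\prod_(r <- s) elsym_poly m r) = meval (join_pt x t) (\prod_(r <- s) usym_poly n r) /\
  mu_op mu (\prod_(r <- s) elsym_poly m r) = xt_op x t (\prod_(r <- s) usym_poly n r).
Proof.
move=> nm muI xI eu.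
apply: (diffop2_match (mu_op_diffop2 mu) (xt_op_diffop2 x t)) => [r|r|r {}s].
- exact: etrans (meval_elsym_poly _ _) (etrans (eu r) (esym (meval_usym_poly _ _ _))).
- apply: etrans (mu_op_elsym_poly r muI) (etrans _ (esym (xt_op_usym_poly t r xI))).
  have nE : n%:R = m%:R + 1 :> F by rewrite nm -[m.+1]addn1 natrD.
  by rewrite eu nE addrK.
apply: etrans (mu_gradprod_elsym_poly mu r s) (etrans _ (esym (xt_gradprod_usym_poly t r s xI))).
(* Both carres du champ obey the same recurrence in [s] and vanish at [s = 0]. *)
elim: s r => [|s IH] r; last by rewrite elsym_gradprod_rec usym_gradprod_rec IH !eu.
rewrite /elsym_gradprod /usym_gradprod !big1 ?addr0// => i _.
- by rewrite big1// => k _; rewrite /= !mulr0.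
- by rewrite [usymD x t i 0]big1 ?mulr0// => k _; rewrite mulr0.
- by rewrite /= !mulr0.
Qed.
End JackOp.

(** * Integration of monomials in t *)

Section LinExt.
Variables (F : fieldType) (V : lmodType F) (n : nat) (j : multinom n -> V).

Definition linext (p : mpoly n F) : V := \sum_(c <- msupp p) mcoeff c p *: j c.

Lemma linextE (s : seq (multinom n)) p : uniq s -> {subset msupp p <= s} ->
  linext p = \sum_(c <- s) mcoeff c p *: j c.
Proof.
move=> us sub; rewrite [RHS](bigID (mem (msupp p))) /= [X in _ + X]big1 ?addr0; last first.
  by move=> c cp; rewrite memN_msupp_eq0// scale0r.
rewrite -big_filter; apply: perm_big; apply: uniq_perm.
- exact: msupp_uniq.
- exact: filter_uniq.
- by move=> c; rewrite mem_filter; case: (boolP (c \in _)) => //= /sub ->.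
Qed.

Lemma linext_is_linear : linear linext.
Proof.
move=> a p q; pose s := undup (msupp (a *: p + q) ++ (msupp p ++ msupp q)).
have us : uniq s by exact: undup_uniq.
rewrite !(@linextE s)//; try by move=> c cp; rewrite mem_undup !mem_cat cp ?orbT.
rewrite scaler_sumr -big_split /=; apply: eq_bigr => c _.
by rewrite mcoeffD mcoeffZ scalerDl scalerA.
Qed.

HB.instance Definition _ := GRing.isLinear.Build F (mpoly n F) V *:%R linext linext_is_linear.

Lemma linextX c : linext (mpolyX F c) = j c.
Proof. by rewrite /linext msuppX big_seq1 mcoeffX eqxx scale1r. Qed.

End LinExt.

Lemma eq_linear_mpoly (F : fieldType) (V : lmodType F) n (f g : mpoly n F -> V) :
  linear f -> linear g -> (forall c, f (mpolyX F c) = g (mpolyX F c)) -> f =1 g.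
Proof.
move=> fl gl e; have f0 : f 0 = 0.
  by have := fl (-1) 0 0; rewrite scaler0 addr0 scaleN1r addNr.
have g0 : g 0 = 0 by have := gl (-1) 0 0; rewrite scaler0 addr0 scaleN1r addNr.
elim/mpolyind => [|a c p _ _ IH]; first by rewrite f0 g0.
by rewrite fl gl e IH.
Qed.

Section Moment.
Variables (F : numFieldType) (beta : F) (n : nat) (M : multinom n -> F).

Definition lpart (c : multinom (n + n)) : multinom n := Multinom [tuple c (lshift n i) | i < n].
Definition rpart (c : multinom (n + n)) : multinom n := Multinom [tuple c (rshift n i) | i < n].

Lemma lpartD c d : lpart (mnm_add c d) = mnm_add (lpart c) (lpart d).
Proof. by apply/mnmP => i; rewrite !(mnmDE, mnmE). Qed.
Lemma rpartD c d : rpart (mnm_add c d) = mnm_add (rpart c) (rpart d).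
Proof. by apply/mnmP => i; rewrite !(mnmDE, mnmE). Qed.
Lemma lpart1r k : lpart (mnm1 (rshift n k)) = mnm0.
Proof. by apply/mnmP => i; rewrite mnmE mnm1E mnm0E eq_rlshift. Qed.
Lemma rpart1r k : rpart (mnm1 (rshift n k)) = mnm1 k.
Proof. by apply/mnmP => i; rewrite mnmE !mnm1E eq_rshift. Qed.

(* Integrates t out of a polynomial in (x, t), given the moments [M] of t. *)
Definition moment_map : mpoly (n + n) F -> mpoly n F :=
  linext (fun c => M (rpart c) *: mpolyX F (lpart c)).
HB.instance Definition _ := GRing.Linear.on moment_map.

Lemma moment_mapX c : moment_map (mpolyX F c) = M (rpart c) *: mpolyX F (lpart c).
Proof. exact: linextX. Qed.

Lemma mderiv_moment_map k p : mderiv k (moment_map p) = moment_map (mderiv (lshift n k) p).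
Proof.
apply: (@eq_linear_mpoly _ _ _ (mderiv k \o moment_map) (moment_map \o mderiv (lshift n k))).
- by move=> a u v; rewrite linearP.
- by move=> a u v; rewrite linearP.
move=> c; rewrite /= moment_mapX mderivX !linearZ /= mderivX moment_mapX !scalerA mnmE.
rewrite mulrC (_ : rpart (mnm_sub _ _) = rpart c); last first.
  by apply/mnmP => i; rewrite !mnmE eq_lrshift subn0.
rewrite (_ : lpart (mnm_sub _ _) = mnm_sub (lpart c) (mnm1 k))//.
by apply/mnmP => i; rewrite !mnmE eq_lshift.
Qed.

(** For the Dirichlet law with all parameters beta/2, M(b + e_i) is (beta/2 + b_i) M(b) divided by a
    quantity independent of i; comparing two indices eliminates the divisor. *)
Hypothesis M_rec : forall (b : multinom n) i k, i != k ->
  (beta / 2 + (b k)%:R) * M (mnm_add b (mnm1 i)) =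
  (beta / 2 + (b i)%:R) * M (mnm_add b (mnm1 k)).

Let T k : mpoly (n + n) F := mvar F (rshift n k).

(* Integration by parts on the simplex, read off the recurrence of the moments. *)
Lemma moment_map_null i k p : i != k ->
  moment_map ((beta / 2) *: ((T i - T k) * p)) = moment_map (T i * T k * deriv_diff i k p).
Proof.
move=> ik.
pose f (p : mpoly (n + n) F) := moment_map ((beta / 2) *: ((T i - T k) * p)).
pose g p := moment_map (T i * T k * deriv_diff i k p).
apply: (@eq_linear_mpoly _ _ _ f g).
- by move=> a u v; rewrite /f mulrDr -scalerAr scalerDr scalerA [_ * a]mulrC -[(a * _) *: _]scalerA linearP.
- move=> a u v; rewrite /g (_ : deriv_diff i k (a *: u + v) = a *: deriv_diff i k u + deriv_diff i k v).
    by rewrite mulrDr -scalerAr linearP.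
  by rewrite /deriv_diff !linearP /= scalerDr addrACA.
move=> c; rewrite /f /g /deriv_diff !mderivX mulrBr -!scalerAr.
(* If the exponent is 0, the truncated subtraction does not undo the multiplication, but then the
   coefficient is 0 as well. *)
have E a b : a != b -> moment_map ((c (rshift n a))%:R *: (T a * T b * mpolyX F (mnm_sub c (mnm1 (rshift n a))))) =
    ((rpart c a)%:R * M (mnm_add (rpart c) (mnm1 b))) *: mpolyX F (lpart c).
  move=> ab; rewrite linearZ /= mnmE; case: (posnP (c (rshift n a))) => [->|ca].
    by rewrite mul0r !scale0r.
  rewrite -!mpolyXD moment_mapX scalerA.
  have -> : mnm_add (mnm_add (mnm1 (rshift n a)) (mnm1 (rshift n b)))
      (mnm_sub c (mnm1 (rshift n a))) = mnm_add c (mnm1 (rshift n b)).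
    apply/mnmP => l; rewrite !mnmE.
    by case: eqP => [<-|_] /=; [lia|lia].
  by rewrite rpartD lpartD rpart1r lpart1r addm0.
rewrite linearB /= E// [T i * T k]mulrC E 1?eq_sym//.
rewrite mulrBl -!mpolyXD linearZ /= linearB /= !moment_mapX !rpartD !lpartD !rpart1r !lpart1r !add0m.
rewrite -scalerBl -[RHS]scalerBl scalerA; congr (_ *: _).
have := M_rec (rpart c) ik; rewrite !(addmC (mnm1 _)).
move: (M (mnm_add _ (mnm1 i))) (M (mnm_add _ (mnm1 k))) ((rpart c k)%:R) ((rpart c i)%:R) => u v ck ci h.
apply/eqP; rewrite -subr_eq0; apply/eqP.
transitivity ((beta / 2 + ck) * u - (beta / 2 + ci) * v); first by ring.
by rewrite h subrr.
Qed.

Variable x : 'I_n -> F.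

(** [moment_map] takes polynomials, whereas the coefficients of [xt_op] are rational in [x]. These
    are frozen at the point [x]; the argument remains a polynomial in both sets of variables. *)
Definition xt_op_poly (p : mpoly (n + n) F) : mpoly (n + n) F :=
  \sum_k x k ^+ 2 *: mderiv (lshift n k) (mderiv (lshift n k) p) +
  \sum_k \sum_(j | k != j) (beta * (x k ^+ 2 / (x k - x j))) *: mderiv (lshift n k) p +
  \sum_i \sum_(k | k != i) pair_coef x i k *:
     (T i * T k * deriv_diff i k (deriv_diff i k p) - (beta / 2) *: ((T i - T k) * deriv_diff i k p)).

Lemma meval_xt_op_poly t p : meval (join_pt x t) (xt_op_poly p) = xt_op beta x t p.
Proof.
rewrite /xt_op_poly !raddfD !raddf_sum /=; congr (_ + _ + _).
- by apply: eq_bigr => k _; rewrite mevalZ.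
- apply: eq_bigr => k _; rewrite raddf_sum; apply: eq_bigr => j _.
  by rewrite [LHS]mevalZ.
apply: eq_bigr => i _; rewrite raddf_sum; apply: eq_bigr => k _.
apply: etrans (mevalZ _ _ _) _.
rewrite mevalB mevalZ !mevalM (mevalB _ (T i) (T k)) !mevalXU !join_ptr.
by ring.
Qed.

Lemma jack_op_moment_map p : jack_op beta (moment_map p) x = meval x (moment_map (xt_op_poly p)).
Proof.
rewrite /xt_op_poly; set N := (X in _ + X).
have Js (P : pred 'I_n) E : moment_map (\sum_(i | P i) E i) = \sum_(i | P i) moment_map (E i).
  exact: raddf_sum.
have Es (P : pred 'I_n) E : meval x (\sum_(i | P i) E i) = \sum_(i | P i) meval x (E i).
  exact: raddf_sum.
(* [moment_map_null] is applied to d_ik p in place of p. *)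
have N0 : moment_map N = 0.
  rewrite /N Js /= big1// => i _; rewrite Js /= big1// => k ki.
  rewrite linearZ /= [moment_map (_ - _)]raddfB /= moment_map_null 1?eq_sym//.
  by rewrite subrr scaler0.
rewrite [moment_map (_ + _)]raddfD /= N0 addr0 [moment_map (_ + _)]raddfD [meval x (_ + _)]raddfD /=; congr (_ + _).
  rewrite Js Es; apply: eq_bigr => k _.
  rewrite !mderiv_moment_map [moment_map (_ *: _)]linearZ /=.
  by apply/esym; exact: mevalZ.
rewrite mulr_sumr Js Es; apply: eq_bigr => k _.
rewrite mulr_sumr Js Es; apply: eq_bigr => j _.
rewrite [moment_map (_ *: _)]linearZ /= mderiv_moment_map [LHS]mulrA.
by apply/esym; exact: mevalZ.
Qed.
End Moment.

(** * Dominance and leading monomials *)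

Section Layers.
Variable n : nat.
Implicit Types (S T : {set 'I_n}) (i j : 'I_n).
Local Open Scope nat_scope.

Definition prefix_set S := forall i j, j \in S -> i <= j -> i \in S.

Lemma card_ltn_ord s : #|[set i : 'I_n | i < s]| = minn s n.
Proof.
rewrite -sum1dep_card big_mkcond /=; elim: n => [|k IH]; first by rewrite big_ord0 minn0.
by rewrite big_ord_recr /= IH; case: ltnP; lia.
Qed.

Lemma count_gt_ord (i : 'I_n) : (\sum_(j | i != j) (i < j) = n - i.+1)%N.
Proof.
have := card_ltn_ord i.+1; rewrite (minn_idPl (ltn_ord i)) => c.
transitivity #|~: [set j : 'I_n | (j < i.+1)%N]|; last first.
  by have := cardsC [set j : 'I_n | (j < i.+1)%N]; rewrite c card_ord; lia.
rewrite -sum1_card big_mkcond [RHS]big_mkcond /=; apply: eq_bigr => j _.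
by rewrite !inE -leqNgt -val_eqE /=; case: ltngtP.
Qed.

Lemma prefix_set_ltn s : prefix_set [set i : 'I_n | i < s].
Proof. by move=> i j; rewrite !inE => js ij; apply: leq_ltn_trans js. Qed.

Lemma prefix_setE S : prefix_set S -> forall i, (i \in S) = (i < #|S|).
Proof.
move=> pS i; apply/idP/idP => [iS|].
  have /subset_leq_card : [set j : 'I_n | j < i.+1] \subset S.
    by apply/subsetP => j; rewrite inE ltnS => /(pS _ _ iS).
  by rewrite card_ltn_ord (minn_idPl (ltn_ord i)).
apply: contraTT => iS; rewrite -leqNgt.
have /subset_leq_card : S \subset [set j : 'I_n | j < i].
  apply/subsetP => j jS; rewrite inE ltnNge; apply: contra iS => ij.
  exact: pS jS ij.
by rewrite card_ltn_ord (minn_idPl (ltnW (ltn_ord i))).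
Qed.

Lemma card_prefixI S T : prefix_set S -> prefix_set T -> #|S :&: T| = minn #|S| #|T|.
Proof.
move=> pS pT; have -> : S :&: T = [set i : 'I_n | i < minn #|S| #|T|].
  by apply/setP => i; rewrite !inE (prefix_setE pS) (prefix_setE pT) leq_min.
by rewrite card_ltn_ord; rewrite (minn_idPl _)// geq_min -[X in _ <= X]card_ord max_card.
Qed.

(** Layer cake formula: [w i] counts the heights [h] below it. *)
Lemma sum_layers (H : nat) (w : 'I_n -> nat) (a : 'I_n -> nat) (P : pred 'I_n) :
  (forall i, w i <= H) ->
  \sum_(i | P i) a i * w i = \sum_(h < H) \sum_(i | P i && (h < w i)) a i.
Proof.
move=> wH; rewrite [RHS](exchange_big_dep P) /=; last by move=> h i _ /andP[].
apply: eq_bigr => i Pi; rewrite sum_nat_cond_const mulnC; congr (_ * _).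
rewrite (eq_card (B := [set h : 'I_H | h < w i])).
  have -> : #|[set h : 'I_H | h < w i]| = minn (w i) H.
    rewrite -sum1dep_card big_mkcond /=; elim: (H) => [|k IH]; first by rewrite big_ord0 minn0.
    by rewrite big_ord_recr /= IH; case: ltnP; lia.
  by have := wH i; lia.
by move=> h; rewrite !inE Pi.
Qed.

(** By layers, as the superlevel sets of a non-increasing weight are initial segments. *)
Lemma leq_sum_weight (w a b : 'I_n -> nat) :
  (forall i j, i <= j -> w j <= w i) ->
  (forall S, prefix_set S -> \sum_(i in S) a i <= \sum_(i in S) b i) ->
  \sum_i a i * w i <= \sum_i b i * w i.
Proof.
move=> wn ab; pose H := \sum_i w i.
have wH i : w i <= H by rewrite /H (bigD1 i)//= leq_addr.
have sE c : \sum_i c i * w i = \sum_(h < H) \sum_(i in [set i | h < w i]) c i.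
  rewrite (@sum_layers H)//; apply: eq_bigr => h _; apply: eq_bigl => i.
  by rewrite !inE.
rewrite !sE; apply: leq_sum => h _; apply: ab => i j.
by rewrite !inE => hj ij; apply: leq_trans (wn _ _ ij).
Qed.
End Layers.

Section Weight.
Variables (B : nat).
Local Open Scope nat_scope.

(* Comparing weights is comparing lexicographically, as digits in base [B]. *)
Definition weight n (a : 'I_n -> nat) : nat := \sum_i a i * B ^ (n - i.+1).

Lemma weight_inj n (a b : 'I_n -> nat) : (forall i, a i < B) -> (forall i, b i < B) ->
  weight a = weight b -> a =1 b.
Proof.
elim: n a b => [|n IH] a b aB bB; first by move=> _ [].
have wS (c : 'I_n.+1 -> nat) :
    weight c = weight (fun i : 'I_n => c (widen_ord (leqnSn n) i)) * B + c ord_max.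
  rewrite /weight big_ord_recr /= subnn expn0 muln1; congr (_ + _).
  rewrite big_distrl /=; apply: eq_bigr => i _.
  by rewrite -mulnA -expnSr subSn.
rewrite !wS => e.
have el : a ord_max = b ord_max.
  by have := congr1 (modn^~ B) e; rewrite /= !modnMDl !modn_small.
have B0 : 0 < B by apply: leq_ltn_trans (aB ord_max).
have /IH ew : weight (fun i : 'I_n => a (widen_ord (leqnSn n) i)) =
    weight (fun i : 'I_n => b (widen_ord (leqnSn n) i)).
  by apply/eqP; rewrite -(eqn_pmul2r B0); apply/eqP; move: e; rewrite el => /addIn.
move=> i; have [ni|ni] := ltnP i n.
  by have := ew (fun=> aB _) (fun=> bB _) (Ordinal ni);
    rewrite (_ : widen_ord _ _ = i)//; exact: val_inj.
by rewrite (_ : i = ord_max)//; apply: val_inj => /=; have := ltn_ord i; lia.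
Qed.

(** Consequently the heaviest exponent of a symmetric polynomial is non-increasing. *)
Lemma weight_tperm n (a : 'I_n -> nat) (i j : 'I_n) : 1 < B -> i < j -> a i < a j ->
  weight a < weight (a \o tperm i j).
Proof.
move=> B1 ij aij; have ji : j != i by rewrite neq_ltn ij orbT.
rewrite /weight !(bigD1 i (P := xpredT))//= !(bigD1 j (P := fun k => k != i))//=.
rewrite tpermL tpermR [X in _ < _ + (_ + X)](eq_bigr (fun k => a k * B ^ (n - k.+1))).
  have : B ^ (n - j.+1) < B ^ (n - i.+1) by rewrite ltn_exp2l//; have := ltn_ord j; lia.
  move: (B ^ _) (B ^ _) aij => x y; nia.
by move=> k /andP[ki kj]; rewrite tpermD// eq_sym.
Qed.

End Weight.

Section SuppDeg.
Variables (F : numFieldType) (N : nat) (Q : rel nat).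
Hypothesis Q00 : Q 0%N 0%N.
Hypothesis QD : forall a b c d, Q a b -> Q c d -> Q (a + c)%N (b + d)%N.
Variables (S : {set 'I_N}).

(* The S-degree of every monomial of p is related by Q to d; Q is <= or =. *)
Definition suppdeg d (p : mpoly N F) :=
  forall c : multinom N, c \in msupp p -> Q (\sum_(i in S) c i)%N d.

Lemma suppdegM d e p q : suppdeg d p -> suppdeg e q -> suppdeg (d + e) (p * q).
Proof.
move=> pd qe c /msuppM_le /allpairsP[[a b] /= [ap bq ->]].
under eq_bigr do rewrite mnmDE.
by rewrite big_split; apply: QD; [exact: pd|exact: qe].
Qed.

Lemma suppdeg_sum d (I : Type) (r : seq I) (P : pred I) (f : I -> mpoly N F) :
  (forall i, P i -> suppdeg d (f i)) -> suppdeg d (\sum_(i <- r | P i) f i).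
Proof.
move=> h; apply: (big_ind (suppdeg d)) => // [c|p q pd qd c /msuppD_le].
  by rewrite msupp0.
by rewrite mem_cat => /orP[/pd|/qd].
Qed.

Lemma suppdeg_prod (I : Type) (r : seq I) (P : pred I) (d : I -> nat) (f : I -> mpoly N F) :
  (forall i, P i -> suppdeg (d i) (f i)) ->
  suppdeg (\sum_(i <- r | P i) d i) (\prod_(i <- r | P i) f i).
Proof.
move=> h; apply: (big_ind2 suppdeg) => // [c|]; last by move=> ? ? ? ? ; exact: suppdegM.
by rewrite msupp1 inE => /eqP ->; rewrite big1// => i _; rewrite mnm0E.
Qed.

Lemma suppdegX k : Q (k \in S) (k \in S) -> suppdeg (k \in S) (mvar F k).
Proof.
move=> Qk c; rewrite msuppX inE => /eqP ->.
rewrite (_ : \sum_(i in S) _ = (k \in S))%N//.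
case: (boolP (k \in S)) => kS; last first.
  by rewrite big1// => i iS; rewrite mnm1E; case: eqP kS => // ->; rewrite iS.
by rewrite (bigD1 k)//= mnm1E eqxx big1// => i /andP[_ ik]; rewrite mnm1E eq_sym (negbTE ik).
Qed.
End SuppDeg.

Section NonnegCoef.
Variables (F : realFieldType) (N : nat).
Implicit Types (p q : mpoly N F).

Definition nonneg_coef p := forall c, 0 <= mcoeff c p.

Lemma nonneg_coefX a : nonneg_coef (mpolyX F a).
Proof. by move=> c; rewrite mcoeffX ler0n. Qed.

Lemma nonneg_coefM p q : nonneg_coef p -> nonneg_coef q -> nonneg_coef (p * q).
Proof.
move=> p0 q0 c; rewrite mcoeffM; apply: sumr_ge0 => i _; exact: mulr_ge0.
Qed.

Lemma nonneg_coef_sum (I : Type) (r : seq I) (P : pred I) (f : I -> mpoly N F) :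
  (forall i, P i -> nonneg_coef (f i)) -> nonneg_coef (\sum_(i <- r | P i) f i).
Proof.
move=> h; apply: (big_ind nonneg_coef) => // [c|p q p0 q0 c]; first by rewrite mcoeff0.
by rewrite mcoeffD addr_ge0.
Qed.

Lemma nonneg_coef_prod (I : Type) (r : seq I) (P : pred I) (f : I -> mpoly N F) :
  (forall i, P i -> nonneg_coef (f i)) -> nonneg_coef (\prod_(i <- r | P i) f i).
Proof.
move=> h; apply: (big_ind nonneg_coef) => //; last exact: nonneg_coefM.
by move=> c; rewrite mcoeff1 ler0n.
Qed.

(** Nonnegative coefficients exclude cancellation: [p] is its term at [a] plus a rest that still has
    nonnegative coefficients. *)
Lemma mcoeffM_gt0 p q a b : nonneg_coef p -> nonneg_coef q ->
  0 < mcoeff a p -> 0 < mcoeff b q -> 0 < mcoeff (mnm_add a b) (p * q).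
Proof.
move=> p0 q0 pa qb.
have sub r c : nonneg_coef r -> nonneg_coef (r - mcoeff c r *: mpolyX F c).
  move=> r0 d; rewrite mcoeffB mcoeffZ mcoeffX; case: eqP => [->|_].
    by rewrite mulr1 subrr.
  by rewrite mulr0 subr0.
rewrite -{1}(subrK (mcoeff a p *: mpolyX F a) p) mulrDl mcoeffD.
apply: ltr_wpDl; first exact: nonneg_coefM (sub _ _ p0) q0 _.
by rewrite -scalerAl mcoeffZ [mpolyX _ _ * q]mulrC mcoeffMX mulr_gt0.
Qed.

End NonnegCoef.

Section Supports.
Variable F : realFieldType.

Section ElsymX.
Variables (n N : nat) (f : 'I_n -> 'I_N).
Let X j : mpoly N F := mvar F (f j).

Lemma suppdeg_elsym (Q : rel nat) (S : {set 'I_N}) (A : {set 'I_n}) r d :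
  (forall T : {set 'I_n}, T \subset A -> #|T| = r -> Q (\sum_(j in T) (f j \in S))%N d) ->
  suppdeg Q S d (elsym X A r).
Proof.
move=> h; apply: suppdeg_sum => T /andP[TA /eqP Tr] c cT.
suff /eqP -> : eqn (\sum_(i in S) c i)%N (\sum_(j in T) (f j \in S))%N by exact: h.
move: c cT; apply: (@suppdeg_prod F N eqn) => //.
  by move=> a b c' d' /eqP -> /eqP ->; exact: eqxx.
move=> j _; exact: (@suppdegX F N eqn S (f j) (eqxx _)).
Qed.

Lemma nonneg_coef_elsym A r : nonneg_coef (elsym X A r).
Proof.
apply: nonneg_coef_sum => T _; apply: nonneg_coef_prod => j _; exact: nonneg_coefX.
Qed.

(** The injection [f] allows a larger set of variables, so that the lemma also serves for the x-half
    of (x, t). *)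
Lemma elsym_lead (A : {set 'I_n}) r : injective f -> [set i : 'I_n | (i < r)%N] \subset A -> (r <= n)%N ->
  exists e : multinom N, (forall i, e (f i) = (i < r)%N :> nat) /\ 0 < mcoeff e (elsym X A r).
Proof.
move=> fI sA rn; pose T := [set i : 'I_n | (i < r)%N].
exists (\big[@mnm_add N/mnm0]_(j in T) mnm1 (f j)); split.
  move=> i; rewrite mnm_sumE.
  under eq_bigr do rewrite mnm1E (inj_eq fI).
  case: (boolP (i \in T)); rewrite inE => ir.
    rewrite (bigD1 i)/= ?inE// eqxx big1 ?ir// => j /andP[_ /negbTE ->//].
  rewrite (negbTE ir) big1// => j; rewrite inE => jr.
  by case: eqP jr ir => // -> ->.
have cT : #|T| = r by rewrite card_ltn_ord; apply/minn_idPl.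
rewrite /elsym (bigD1 T) ?sA ?cT ?eqxx//= mcoeffD ltr_pwDl//.
  rewrite /X /mvar mprodXE mcoeffX eqxx //.
apply: nonneg_coef_sum => T' _; apply: nonneg_coef_prod => j _; exact: nonneg_coefX.
Qed.
End ElsymX.

Section Esp.
Variable n : nat.

Lemma sum_in_le (T S : {set 'I_n}) : (\sum_(j in T) (j \in S) <= minn #|T| #|S|)%N.
Proof.
rewrite (_ : \sum_(j in T) _ = #|T :&: S|)%N.
  by rewrite leq_min !subset_leq_card ?subsetIl ?subsetIr.
rewrite -sum1_card big_mkcond [RHS]big_mkcond /=; apply: eq_bigr => j _.
by rewrite inE; case: (j \in T); case: (j \in S).
Qed.

Lemma sum_in_setT (T : {set 'I_n}) : (\sum_(j in T) (j \in setT) = #|T|)%N.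
Proof. by rewrite -sum1_card; apply: eq_bigr => j _; rewrite inE. Qed.

Lemma elsym_poly_prod_le (c : seq nat) S :
  suppdeg leq S (\sum_(r <- c) minn r #|S|) (\prod_(r <- c) elsym_poly F n r).
Proof.
apply: suppdeg_prod => // [|r _]; first by move=> *; exact: leq_add.
by apply: suppdeg_elsym => T _ <-; exact: sum_in_le.
Qed.

Lemma elsym_poly_prod_eq (c : seq nat) :
  suppdeg eqn setT (\sum_(r <- c) r) (\prod_(r <- c) elsym_poly F n r).
Proof.
apply: suppdeg_prod => // [|r _]; first by move=> a b c' d /eqP -> /eqP ->; exact: eqxx.
by apply: suppdeg_elsym => T _ <-; rewrite sum_in_setT; exact: eqxx.
Qed.

Lemma nonneg_coef_elsym_poly_prod (c : seq nat) : nonneg_coef (\prod_(r <- c) elsym_poly F n r).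
Proof. by apply: nonneg_coef_prod => r _; exact: nonneg_coef_elsym. Qed.

Lemma elsym_poly_prod_lead (c : seq nat) : all (fun r => r <= n)%N c ->
  exists e : multinom n, (forall i, e i = \sum_(r <- c) (i < r)%N)%N /\
    0 < mcoeff e (\prod_(r <- c) elsym_poly F n r).
Proof.
elim: c => [|r c IH] /=.
  move=> _; exists mnm0; split=> [i|]; first by rewrite mnm0E big_nil.
  by rewrite big_nil mcoeff1 eqxx.
move=> /andP[rn /IH[e [eE e0]]].
have [d [dE d0]] := @elsym_lead n n id setT r (@inj_id _) (subsetT _) rn.
exists (mnm_add d e); split=> [i|]; first by rewrite mnmDE big_cons dE eE.
by rewrite big_cons; apply: mcoeffM_gt0 => //; [exact: nonneg_coef_elsym|exact: nonneg_coef_elsym_poly_prod].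
Qed.
End Esp.

Section Usp.
Variable n : nat.

Definition lshift_set (S : {set 'I_n}) : {set 'I_(n + n)} := [set lshift n i | i in S].

Lemma in_lsh (S : {set 'I_n}) i : (lshift n i \in lshift_set S) = (i \in S).
Proof. exact/mem_imset/lshift_inj. Qed.

Lemma rshift_lsh (S : {set 'I_n}) i : (rshift n i \in lshift_set S) = false.
Proof. by apply/imsetP => -[j _ /eqP]; rewrite eq_rlshift. Qed.

Lemma sum_lsh (S : {set 'I_n}) (c : multinom (n + n)) :
  (\sum_(i in lshift_set S) c i = \sum_(i in S) lpart c i)%N.
Proof.
rewrite big_imset /=; last by move=> ? ? _ _; exact: lshift_inj.
by apply: eq_bigr => i _; rewrite mnmE.
Qed.

Lemma suppdeg_usym_poly (Q : rel nat) (S : {set 'I_n}) r d : Q 0%N 0%N -> 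
  (forall a b c d, Q a b -> Q c d -> Q (a + c)%N (b + d)%N) ->
  (forall T : {set 'I_n}, #|T| = r -> Q (\sum_(j in T) (j \in S))%N d) ->
  suppdeg Q (lshift_set S) d (usym_poly F n r).
Proof.
move=> Q0 QD h; apply: suppdeg_sum => i _.
rewrite -[d]add0n; apply: suppdegM => //.
  have := @suppdegX F _ Q (lshift_set S) (rshift n i).
  by rewrite rshift_lsh; exact.
apply: suppdeg_elsym => T _ Tr.
by rewrite (eq_bigr (fun j => (j \in S) : nat)) ?h// => j _; rewrite in_lsh.
Qed.

Lemma usym_poly_prod_le (c : seq nat) (S : {set 'I_n}) :
  suppdeg leq (lshift_set S) (\sum_(r <- c) minn r #|S|) (\prod_(r <- c) usym_poly F n r).
Proof.
apply: suppdeg_prod => // [|r _]; first by move=> *; exact: leq_add.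
apply: suppdeg_usym_poly => // [|T <-]; first by move=> *; exact: leq_add.
exact: sum_in_le.
Qed.

Lemma usym_poly_prod_eq (c : seq nat) :
  suppdeg eqn (lshift_set setT) (\sum_(r <- c) r) (\prod_(r <- c) usym_poly F n r).
Proof.
have eD a b c' d : eqn a b -> eqn c' d -> eqn (a + c') (b + d).
  by move=> /eqP -> /eqP ->; exact: eqxx.
apply: suppdeg_prod => // r _.
by apply: suppdeg_usym_poly => // T <-; rewrite sum_in_setT; exact: eqxx.
Qed.

Lemma nonneg_coef_usym_poly_prod (c : seq nat) : nonneg_coef (\prod_(r <- c) usym_poly F n r).
Proof.
apply: nonneg_coef_prod => r _; apply: nonneg_coef_sum => i _.
by apply: nonneg_coefM; [exact: nonneg_coefX|exact: nonneg_coef_elsym].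
Qed.

Lemma usym_poly_prod_lead (c : seq nat) : all (fun r => r < n)%N c ->
  exists e : multinom (n + n), (forall i, lpart e i = \sum_(r <- c) (i < r)%N)%N /\
    0 < mcoeff e (\prod_(r <- c) usym_poly F n r).
Proof.
elim: c => [|r c IH] /=.
  move=> _; exists mnm0; split=> [i|]; first by rewrite mnmE mnm0E big_nil.
  by rewrite big_nil mcoeff1 eqxx.
move=> /andP[rn /IH[e [eE e0]]].
(* The first index outside the leading [r]: omitting this variable keeps the leading monomial of
   e_r. It exists because [r < n]. *)
pose i0 := Ordinal rn.
have sA : [set i : 'I_n | (i < r)%N] \subset [set~ i0].
  by apply/subsetP => i; rewrite !inE => ir; rewrite -val_eqE /= neq_ltn ir.
have [d [dE d0]] := elsym_lead (@lshift_inj n n) sA (ltnW rn).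
exists (mnm_add (mnm_add (mnm1 (rshift n i0)) d) e); split=> [i|].
  by rewrite mnmE !mnmDE mnm1E eq_rlshift big_cons dE -eE mnmE.
rewrite big_cons; apply: mcoeffM_gt0 => //; last 1 first.
- rewrite /usym_poly /usym (bigD1 i0)//= mcoeffD ltr_pwDl//; last first.
    apply: nonneg_coef_sum => i _.
    by apply: nonneg_coefM; [exact: nonneg_coefX|exact: nonneg_coef_elsym].
  apply: mcoeffM_gt0 => //; [exact: nonneg_coefX|exact: nonneg_coef_elsym|].
  by rewrite mcoeffX eqxx.
- apply: nonneg_coef_sum => i _.
  by apply: nonneg_coefM; [exact: nonneg_coefX|exact: nonneg_coef_elsym].
- exact: nonneg_coef_usym_poly_prod.
Qed.

Variable M : multinom n -> F.

Lemma mcoeff_moment_map a p : mcoeff a (moment_map M p) =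
  \sum_(c <- msupp p) mcoeff c p * (M (rpart c) * (lpart c == a)%:R).
Proof.
rewrite /moment_map /linext raddf_sum; apply: eq_bigr => c _ /=.
by rewrite !mcoeffZ mcoeffX.
Qed.

Lemma msupp_moment_map a p : a \in msupp (moment_map M p) -> exists2 c, c \in msupp p & lpart c = a.
Proof.
rewrite mcoeff_msupp mcoeff_moment_map.
have [/hasP[c cp /eqP <-] _|/hasPn h] := boolP (has (fun c => lpart c == a) (msupp p)).
  by exists c.
rewrite big1_seq ?eqxx// => c /andP[_ /h /negbTE ->].
by rewrite !mulr0.
Qed.

(** Several monomials in (x, t) may fall on the same exponent of x; positive moments prevent their
    cancellation. *)
Lemma moment_map_gt0 p e : (forall b, 0 < M b) -> nonneg_coef p -> 0 < mcoeff e p ->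
  0 < mcoeff (lpart e) (moment_map M p).
Proof.
move=> M0 p0 pe; rewrite mcoeff_moment_map (bigD1_seq e) ?msupp_uniq//=; last first.
  by rewrite mcoeff_msupp gt_eqF.
apply: ltr_pwDl; first by rewrite eqxx mulr1 mulr_gt0.
by apply: sumr_ge0 => c _; rewrite mulr_ge0// mulr_ge0// ltW.
Qed.
End Usp.
End Supports.

Section Cols.
Variables (n k : nat).
Implicit Types (nu a b : multinom n).

(* the conjugate partition of [nu], padded with zeros to length [k] *)
Definition cols nu : seq nat :=
  [seq #|[set i : 'I_n | (j < nu i)%N]| | j <- iota 0 k].

Definition nonincr nu := forall i j : 'I_n, (i <= j -> nu j <= nu i)%N.

Lemma big_cols nu (f : nat -> nat) :
  (\sum_(r <- cols nu) f r = \sum_(j < k) f #|[set i : 'I_n | j < nu i]|)%N.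
Proof. by rewrite big_map -[iota 0 k](_ : index_iota 0 k = _) ?big_mkord// /index_iota subn0. Qed.

Lemma cols_le nu : all (fun r => r <= n)%N (cols nu).
Proof. by apply/allP => r /mapP[j _ ->]; rewrite -[X in (_ <= X)%N]card_ord max_card. Qed.

Lemma prefix_nonincr nu j : nonincr nu -> prefix_set [set i : 'I_n | (j < nu i)%N].
Proof. by move=> nuS i l; rewrite !inE => jl il; apply: leq_trans (nuS _ _ il). Qed.

Lemma sum_ltn_ord m : (m <= k -> \sum_(j < k) (j < m) = m)%N.
Proof.
move=> mk; rewrite -[RHS](minn_idPl mk) -card_ltn_ord -sum1dep_card.
by rewrite [RHS]big_mkcond; apply: eq_bigr => j _ /=; case: ltnP.
Qed.

Lemma cols_lead nu : nonincr nu -> (forall i, nu i <= k)%N ->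
  forall i : 'I_n, (\sum_(r <- cols nu) (i < r)%N = nu i)%N.
Proof.
move=> nuS nuk' i; rewrite big_cols -[RHS](sum_ltn_ord (nuk' i)).
by apply: eq_bigr => j _; rewrite -(prefix_setE (@prefix_nonincr nu _ nuS)) inE.
Qed.

(** On initial segments [nu] attains the degree bound of [elsym_poly_prod_le], so there all
    exponents of the product are bounded by [nu]. *)
Lemma cols_top nu (S : {set 'I_n}) : nonincr nu -> (forall i, nu i <= k)%N -> prefix_set S ->
  (\sum_(r <- cols nu) minn r #|S| = \sum_(i in S) nu i)%N.
Proof.
move=> nuS nuk' pS; rewrite big_cols.
have := @sum_layers n k nu (fun=> 1%N) (mem S) nuk'.
under eq_bigr do rewrite mul1n; move=> ->.
apply: eq_bigr => h _.
rewrite -(card_prefixI (prefix_nonincr (j := h) nuS) pS).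
by rewrite -sum1_card; apply: eq_bigl => i; rewrite !inE andbC.
Qed.

Lemma cols_sum nu : nonincr nu -> (forall i, nu i <= k)%N ->
  (\sum_(r <- cols nu) r = \sum_i nu i)%N.
Proof.
move=> nuS nuk'; have pT : prefix_set [set: 'I_n] by move=> i j _ _; rewrite inE.
transitivity (\sum_(r <- cols nu) minn r #|[set: 'I_n]|)%N; last first.
  by rewrite cols_top//; apply: eq_bigl => i; rewrite inE.
rewrite cardsT card_ord; apply: eq_big_seq => r /(allP (cols_le nu)) rn.
by rewrite (minn_idPl rn).
Qed.
End Cols.

Lemma leq_sum_entry n k (a : 'I_n -> nat) : (\sum_i a i = k)%N -> forall i, (a i <= k)%N.
Proof. by move=> <- i; rewrite (bigD1 i)//= leq_addr. Qed.

(** * Expansion of symmetric polynomials in elementary ones *)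

Section Expansion.
Variables (F : realFieldType) (n k : nat) (tau : nat -> nat).
Implicit Types (nu a b : multinom n) (p : mpoly n F).

(* Dominance by the partition with partial sums [tau], for an exponent in any order. *)
Definition subset_bounded a := forall S : {set 'I_n}, (\sum_(i in S) a i <= tau #|S|)%N.

Lemma elsym_poly_sym r : elsym_poly F n r \is symmetric.
Proof.
rewrite (_ : elsym_poly F n r = mesym n F r) ?mesym_sym//.
by apply: eq_bigl => T; rewrite subsetT.
Qed.

Lemma elsym_poly_prod_sym (c : seq nat) : \prod_(r <- c) elsym_poly F n r \is symmetric.
Proof. by apply: rpred_prod => r _; exact: elsym_poly_sym. Qed.

Lemma cols_subset_bounded nu s : nonincr nu -> (forall i, nu i <= k)%N -> subset_bounded nu -> (s <= n)%N ->
  (\sum_(r <- cols k nu) minn r s <= tau s)%N.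
Proof.
move=> nuS nuk nud sn.
have cS : #|[set i : 'I_n | (i < s)%N]| = s by rewrite card_ltn_ord; apply/minn_idPl.
rewrite -{1 2}cS cols_top//; exact: prefix_set_ltn.
Qed.

Lemma sym_tperm p a (s : 'S_n) : p \is symmetric -> a \in msupp p ->
  Multinom [tuple a (s i) | i < n] \in msupp p.
Proof.
move=> /issymP ps; rewrite !mcoeff_msupp -[p in mcoeff a p](ps s).
by rewrite mcoeff_sym.
Qed.

(** The fundamental theorem on symmetric polynomials with control of the terms. The heaviest
    exponent [nu] is cancelled by the product of the elementary polynomials of the columns of [nu];
    all exponents of this product satisfy the same bounds, and only [nu] has its weight, so the
    weight bound drops. *)
Lemma sym_expansion p : p \is symmetric ->
  (forall a, a \in msupp p -> subset_bounded a /\ (\sum_i a i = k)%N) ->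
  exists l : seq (F * multinom n),
    p = \sum_(x <- l) x.1 *: \prod_(r <- cols k x.2) elsym_poly F n r /\
    forall x, x \in l -> nonincr x.2 /\ subset_bounded x.2 /\ (\sum_i x.2 i = k)%N.
Proof.
(* The base exceeds every entry, all being at most [k], and is at least 2 even for [k = 0], as
   [weight_tperm] demands. *)
pose W (a : multinom n) := weight k.+2 a.
move=> psym psupp.
have [N pN] : exists N, forall a, a \in msupp p -> (W a < N)%N.
  exists (\max_(a <- msupp p) W a).+1 => a ap; rewrite ltnS.
  by rewrite (big_rem a)//= leq_maxl.
elim: N p psym psupp pN => [|N IH] p psym psupp pN.
  exists [::]; rewrite big_nil; split=> //; apply/mpolyP => a; rewrite mcoeff0.
  by apply: memN_msupp_eq0; apply/negP => /pN.
have [/hasP[nu nup /eqP nuN]|/hasPn nN] := boolP (has (fun a => W a == N) (msupp p)); last first.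
  apply: IH => // a ap; have := pN a ap; rewrite ltnS leq_eqVlt (negbTE (nN a ap)) //.
have [nud nuk] := psupp nu nup; have nuk' := leq_sum_entry nuk.
(* Otherwise exchanging two entries would give a heavier exponent, which lies in the support by
   symmetry. *)
have nuS : nonincr nu.
  move=> i j; rewrite leq_eqVlt => /predU1P[/val_inj ->//|ij]; rewrite leqNgt; apply/negP => nuij.
  have := pN _ (sym_tperm (tperm i j) psym nup); rewrite ltnS -nuN leqNgt.
  move/negP; apply; rewrite /W.
  have := @weight_tperm k.+2 n nu i j isT ij nuij; congr (_ < _)%N.
  by apply: eq_bigr => l _; rewrite mnmE.
pose E := \prod_(r <- cols k nu) elsym_poly F n r.
have [e [eE e0]] := elsym_poly_prod_lead F (cols_le k nu).
have {eE} ? : e = nu by apply/mnmP => i; rewrite eE cols_lead.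
subst e; pose b := mcoeff nu p / mcoeff nu E.
have Esupp a : a \in msupp E -> [/\ subset_bounded a, (\sum_i a i = k)%N & (W a <= N)%N].
  move=> aE; have aS S := @elsym_poly_prod_le F n (cols k nu) S a aE.
  have ak : (\sum_i a i = k)%N.
    have /eqP := @elsym_poly_prod_eq F n (cols k nu) a aE; rewrite cols_sum// nuk => <-.
    by apply: eq_bigl => i; rewrite inE.
  split=> // [S|].
    apply: leq_trans (aS S) _; apply: cols_subset_bounded => //.
    by rewrite -[X in (_ <= X)%N]card_ord max_card.
  rewrite -nuN; apply: leq_sum_weight => [i j ij|S pS].
    by rewrite leq_exp2l//; lia.
  by rewrite -(cols_top nuS nuk' pS).
have := IH (p - b *: E); case.
- by rewrite rpredB// rpredZ// elsym_poly_prod_sym.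
- move=> a /msuppB_le; rewrite mem_cat => /orP[/psupp//|/msuppZ_le /Esupp[]//].
- move=> a aq; have [aN ak] : (W a <= N)%N /\ (\sum_i a i = k)%N.
    move: aq => /msuppB_le; rewrite mem_cat => /orP[ap|/msuppZ_le /Esupp[]//].
    by split; [exact: pN|have [] := psupp a ap].
  rewrite ltn_neqAle aN andbT; apply/eqP => aN'.
  (* An exponent of weight [N] has the digits of [nu], hence equals [nu], where the coefficient has
     just been cancelled. *)
  have /mnmP anu : a =1 nu.
    apply: (@weight_inj k.+2) => [i|i|]; last by rewrite -/(W a) aN' -nuN.
      by have := leq_sum_entry ak i; lia.
    by have := nuk' i; lia.
  move: aq; rewrite mcoeff_msupp anu mcoeffB mcoeffZ /b divfK ?subrr ?eqxx//.
  by rewrite gt_eqF.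
move=> l [pE ll]; exists ((b, nu) :: l); rewrite big_cons -pE addrC subrK; split=> // x.
by rewrite inE => /orP[/eqP ->|/ll//].
Qed.
End Expansion.

(** * Arrow matrices *)

Lemma coef_prod_elsym (K : comNzRingType) n (x : 'I_n -> K) (S : {set 'I_n}) r :
  (\prod_(j in S) (1 + x j *: 'X))`_r = elsym x S r.
Proof.
have [c cS] : exists c, #|S| = c by exists #|S|.
elim: c S cS r => [|c IH] S cS r.
  move/cards0_eq: cS => ->; rewrite big_set0 coef1; case: r => [|r]; first by rewrite elsym0.
  rewrite /elsym big1// => T /andP[]; rewrite subset0 => /eqP ->; by rewrite cards0.
have /set0Pn[k kS] : S != set0 by rewrite -card_gt0 cS.
rewrite (big_setD1 k)//= mulrDl mul1r coefD -scalerAl coefZ coefXM (elsym_rem x r kS).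
have cSk : #|S :\ k| = c by move: cS; rewrite (cardsD1 k) kS => -[].
by rewrite IH//; congr (_ + _ * _); case: r => //= r; rewrite IH.
Qed.

Section ArrowPoly.
Variables (F : fieldType) (m : nat) (A V : 'M[F]_(m + 1)) (mu : 'rV[F]_m) (lam : 'rV[F]_(m + 1)).
Hypothesis ulA : ulsubmx A = diag_mx mu.
Hypothesis AV : A *m V = V *m diag_mx lam.
Hypothesis VV : V^T *m V = 1%:M.

(* Both sides are the coefficient in the last row and column of the adjugate
   of [1 + 'X A]. *)
Lemma arrow_poly : \prod_j (1 + mu 0 j *: 'X) =
  \sum_i (V (rshift m 0) i ^+ 2) *: \prod_(j | j != i) (1 + lam 0 j *: 'X) :> {poly F}.
Proof.
pose Ap := map_mx polyC A; pose Vp := map_mx polyC V.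
pose d i : {poly F} := 1 + lam 0 i *: 'X.
pose D : {poly F} := \prod_i d i.
pose e i : {poly F} := \prod_(j | j != i) d j.
have deD i : d i * e i = D by rewrite /D (bigD1 i).
have VVp : Vp^T *m Vp = 1%:M by rewrite /Vp map_trmx -map_mxM VV map_mx1.
have VVp' : Vp *m Vp^T = 1%:M by exact: mulmx1C.
pose B := 1%:M + 'X *: Ap.
have BV : B *m Vp = Vp *m diag_mx (\row_i d i).
  rewrite mulmxDl mul1mx -scalemxAl -map_mxM AV map_mxM map_diag_mx.
  rewrite (_ : (\row_i d i) = const_mx 1 + 'X *: map_mx polyC lam); last first.
    by apply/rowP => i; rewrite !mxE /d -mul_polyC mulrC.
  by rewrite raddfD /= linearZ /= mulmxDr diag_const_mx mulmx1 -scalemxAr.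
have BE : B = Vp *m diag_mx (\row_i d i) *m Vp^T by rewrite -BV -mulmxA VVp' mulmx1.
(* The adjugate of [B], that is [D] times its inverse, written in the eigenbasis. *)
pose Z := Vp *m diag_mx (\row_i e i) *m Vp^T.
have BZ : B *m Z = D%:M.
  rewrite BE /Z !mulmxA -(mulmxA (Vp *m _) Vp^T Vp) VVp mulmx1 -(mulmxA Vp) mulmx_diag.
  rewrite (_ : (\row_j ((\row_i d i) 0 j * (\row_i e i) 0 j)) = const_mx D); last first.
    by apply/rowP => i; rewrite 4!mxE deD.
  by rewrite diag_const_mx mul_mx_scalar -scalemxAl VVp' scalemx1.
have detV : \det Vp * \det Vp^T = 1 by rewrite -det_mulmx VVp' det1.
have detB : \det B = D.
  rewrite BE !det_mulmx det_diag mulrAC detV mul1r.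
  by apply: eq_bigr => i _; rewrite mxE.
(* Cramer's rule: in [B *m L] the last column of [B] becomes that of [D%:M]. Two evaluations of the
   determinant give the last diagonal entry of [Z], after division by [D], which has constant term
   1. *)
pose L : 'M[{poly F}]_(m + 1) := block_mx 1%:M (ursubmx Z) 0 (drsubmx Z).
have BL : B *m L = block_mx (ulsubmx B) 0 (dlsubmx B) D%:M.
  rewrite -{1}(submxK B) mulmx_block !mulmx1 !mulmx0 !addr0.
  have := BZ; rewrite -{1}(submxK B) -{1}(submxK Z) mulmx_block scalar_mx_block.
  by move=> /eq_block_mx[_ -> _ ->].
have zn : drsubmx Z 0 0 = \sum_i (V (rshift m 0) i ^+ 2) *: e i.
  rewrite !mxE; apply: eq_bigr => i _; rewrite mul_mx_diag !mxE.
  by rewrite -mul_polyC expr2 polyCM mulrAC.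
have D0 : D != 0.
  apply/prodf_neq0 => i _; apply: contra (oner_neq0 F) => /eqP d0.
  by have := congr1 (fun p : {poly F} => p`_0) d0; rewrite coefD coef1 coefZ coefX mulr0 addr0 coef0 => h; apply/eqP; exact: h.
have := congr1 determinant BL; rewrite det_mulmx detB det_ublock det_lblock det1 mul1r.
rewrite det_scalar1 mulrC -/e => /(mulIf D0).
rewrite det_mx11 zn => ->.
have -> : ulsubmx B = diag_mx (\row_j (1 + mu 0 j *: 'X)).
  apply/matrixP => i j; rewrite !mxE !eq_lshift.
  have := congr1 (fun N : 'M_m => N i j) ulA; rewrite !mxE => ->.
  case: eqP => [->|_]; last by rewrite !mulr0n polyC0 mulr0 addr0.
  by rewrite !mulr1n -mul_polyC mulrC.
by rewrite det_diag; apply: eq_bigr => j _; rewrite mxE.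
Qed.

Lemma arrow_usym r :
  elsym (mu 0) setT r = usym (lam 0) (fun i => V (rshift m 0) i ^+ 2) r.
Proof.
have := congr1 (fun p : {poly F} => p`_r) arrow_poly.
rewrite coef_sum (eq_bigl (mem [set: 'I_m])) => [|j]; last by rewrite !inE.
rewrite coef_prod_elsym => ->; apply: eq_bigr => i _; rewrite coefZ -coef_prod_elsym.
by congr (_ * (polyseq _)`_r); apply: eq_bigl => j; rewrite !inE.
Qed.
End ArrowPoly.

From mathcomp Require Import all_classical all_reals all_analysis.
From mathcomp Require Import measurable_realfun.

Import Order.TTheory GRing.Theory Num.Theory.
Import numFieldNormedType.Exports.

(** * Uniqueness of Jack polynomials *)

Section EigenLead.
Local Open Scope classical_set_scope.
Variables (R : realType) (beta : R).

Lemma mcoeff_euler n (i : 'I_n) (a : multinom n) (p : mpoly n R) :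
  mcoeff a (mvar R i * mderiv i p) = (a i)%:R * mcoeff a p.
Proof.
elim/mpolyind: p => [|c b p _ _ IH]; first by rewrite raddf0 mulr0 !mcoeff0 mulr0.
rewrite raddfD /= mulrDr !mcoeffD IH mulrDr; congr (_ + _).
rewrite mderivZ mderivX -!scalerAr !mcoeffZ mcoeffX.
case: (posnP (b i)) => [bi|bi].
  rewrite bi mul0r mulr0; case: eqP => [<-|_]; last by rewrite !mulr0.
  by rewrite bi mul0r.
rewrite -mpolyXD mcoeffX (_ : mnm_add _ _ = b).
  by case: eqP => [->|_]; rewrite ?mulr1 ?mulr0 // mulrC.
by apply/mnmP => l; rewrite !mnmE; case: eqP => [<-|_] /=; lia.
Qed.

Lemma cvgr_sum (I : Type) (r : seq I) (P : pred I) (f : I -> R -> R) (l : I -> R)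
    (F : set_system R) : Filter F ->
  (forall i, P i -> f i x @[x --> F] --> l i) ->
  \sum_(i <- r | P i) f i x @[x --> F] --> \sum_(i <- r | P i) l i.
Proof.
move=> FF h; elim: r => [|i r IH].
  by rewrite big_nil; under eq_fun do rewrite big_nil; exact: cvg_cst.
rewrite big_cons; under eq_fun do rewrite big_cons.
by case: ifPn => // Pi; apply: cvgD => //; exact: h.
Qed.

Lemma exprn_cvg0 d : (x : R) ^+ d @[x --> 0^'+] --> ((d == 0)%N%:R : R).
Proof.
apply: cvg_at_right_filter; have := @exprn_continuous R d 0.
by rewrite /continuous_at expr0n.
Qed.

Variables (n B : nat).
Hypothesis B1 : (1 < B)%N.
Let w (i : 'I_n) : nat := (B ^ (n - i.+1))%N.
Let y (e : R) (i : 'I_n) : R := (e ^+ w i)^-1.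

Let w_lt (i j : 'I_n) : (i < j)%N -> (w j < w i)%N.
Proof. by move=> ij; rewrite /w ltn_exp2l//; have := ltn_ord j; lia. Qed.

Lemma meval_powers e (p : mpoly n R) N : 0 < e ->
  (forall a, a \in msupp p -> weight B a <= N)%N ->
  e ^+ N * meval (y e) p = \sum_(a <- msupp p) mcoeff a p * e ^+ (N - weight B a).
Proof.
move=> e0 h; rewrite mevalE mulr_sumr big_seq [RHS]big_seq; apply: eq_bigr => a ap.
rewrite mulrCA; congr (_ * _); rewrite /y.
have -> : \prod_i (e ^+ w i)^-1 ^+ a i = (e ^+ weight B a)^-1.
  under eq_bigr do rewrite exprVn -exprM.
  rewrite prodfV -expr_sum; congr (_ ^+ _)^-1; apply: eq_bigr => i _.
  by rewrite mulnC.
by rewrite -expfB_cond // (gt_eqF e0) add0n h.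
Qed.

Variables (p : mpoly n R) (nu : multinom n).
Hypothesis nup : nu \in msupp p.
Hypothesis numax : forall a, a \in msupp p -> (weight B a <= weight B nu)%N.
Hypothesis nuinj : forall a, a \in msupp p -> weight B a = weight B nu -> a = nu.

Lemma meval_powers_cvg q : {subset msupp q <= msupp p} ->
  (e ^+ weight B nu * meval (y e) q @[e --> 0^'+] --> mcoeff nu q)%classic.
Proof.
move=> qp.
have -> : mcoeff nu q = \sum_(a <- msupp q) mcoeff a q * (weight B nu - weight B a == 0)%N%:R.
  have nuE a : a \in msupp q -> (weight B nu - weight B a == 0)%N = (a == nu).
    move=> /qp ap; rewrite subn_eq0; apply/idP/eqP => [h|->//].
    by apply: nuinj => //; apply/eqP; rewrite eqn_leq h numax.
  rewrite big_seq (eq_bigr (fun a => mcoeff a q * (a == nu)%:R)) => [|a /nuE ->//].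
  rewrite -big_seq; case: (boolP (nu \in msupp q)) => nuq.
    rewrite (bigD1_seq nu)//= eqxx mulr1 big1 ?addr0// => a /negbTE ->.
    by rewrite mulr0.
  rewrite (memN_msupp_eq0 nuq) big1_seq// => a /andP[_ aq].
  by case: eqP aq nuq => [->->//|_ _ _]; rewrite mulr0.
have : \sum_(a <- msupp q) mcoeff a q * e ^+ (weight B nu - weight B a) @[e --> 0^'+] -->
    \sum_(a <- msupp q) mcoeff a q * (weight B nu - weight B a == 0)%N%:R.
  by apply: cvgr_sum => a _; apply: cvgMl_tmp; exact: exprn_cvg0.
apply: cvg_trans; apply: near_eq_cvg; near=> e.
rewrite (@meval_powers e q)// => a /qp; exact: numax.
Unshelve. all: by end_near. Qed.

(** [w] decreases strictly, so [y e i] dominates [y e j] for small [e] when [i < j]. *)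
Lemma frac_cvg (i j : 'I_n) : i != j ->
  (y e i / (y e i - y e j) @[e --> 0^'+] --> ((i < j)%N%:R : R))%classic.
Proof.
move=> ij.
have dcvg d : (0 < d)%N -> (e : R) ^+ d @[e --> 0^'+] --> (0 : R).
  by move=> d0; have := @exprn_cvg0 d; rewrite (gtn_eqF d0).
have e1 d (e : R) : (0 < d)%N -> 0 < e -> e < 1 -> 1 - e ^+ d != 0.
  by move=> d0 e0 e1; rewrite subr_eq0 gt_eqF// exprn_ilt1 ?ltW// -lt0n.
have [lij|lji] : (i < j)%N \/ (j < i)%N by move: ij; rewrite -val_eqE /=; lia.
  have d0 : (0 < w i - w j)%N by have := w_lt lij; lia.
  have h : (1 - e ^+ (w i - w j))^-1 @[e --> 0^'+] --> (1 - 0 : R)^-1.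
    apply: cvgV; first by rewrite subr0 oner_eq0.
    by apply: cvgB; [exact: cvg_cst|exact: dcvg].
  rewrite (_ : _%:R = (1 - 0)^-1); last by rewrite lij subr0 invr1.
  apply: cvg_trans h; apply: near_eq_cvg; near=> e.
  have e0 : 0 < e by near: e; exact: nbhs_right_gt.
  have el1 : e < 1 by near: e; exact: nbhs_right_lt.
  have wE : w i = (w j + (w i - w j))%N by have := w_lt lij; lia.
  rewrite /y [in RHS]wE exprD /=; have := e1 _ _ d0 e0 el1.
  have : e ^+ (w i - w j) != 0 by rewrite expf_neq0// gt_eqF.
  have : e ^+ w j != 0 by rewrite expf_neq0// gt_eqF.
  move: (e ^+ (w i - w j)) (e ^+ w j) => b a a0 b0 b1.
  by field; rewrite a0 b0 mulN1r b1.
have d0 : (0 < w j - w i)%N by have := w_lt lji; lia.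
have h : e ^+ (w j - w i) * - (1 - e ^+ (w j - w i))^-1 @[e --> 0^'+] --> 0 * - (1 - 0 : R)^-1.
  apply: cvgM; first exact: dcvg.
  apply: cvgN; apply: cvgV; first by rewrite subr0 oner_eq0.
  by apply: cvgB; [exact: cvg_cst|exact: dcvg].
rewrite (_ : _%:R = 0 * - (1 - 0)^-1); last by rewrite ltnNge ltnW// mul0r.
apply: cvg_trans h; apply: near_eq_cvg; near=> e.
have e0 : 0 < e by near: e; exact: nbhs_right_gt.
have el1 : e < 1 by near: e; exact: nbhs_right_lt.
have wE : w j = (w i + (w j - w i))%N by have := w_lt lji; lia.
rewrite /y [in RHS]wE exprD /=; have := e1 _ _ d0 e0 el1.
have : e ^+ (w j - w i) != 0 by rewrite expf_neq0// gt_eqF.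
have : e ^+ w i != 0 by rewrite expf_neq0// gt_eqF.
move: (e ^+ (w j - w i)) (e ^+ w i) => b a a0 b0 b1.
by field; rewrite b0 a0 b1 -[b - 1]opprB oppr_eq0 b1.
Unshelve. all: by end_near. Qed.

Lemma y_inj e : 0 < e -> e < 1 -> injective (y e).
Proof.
move=> e0 e1 i j /invr_inj; wlog ij : i j / (i < j)%N => [h yij|yij].
  have [ij|ji|/val_inj//] := ltngtP i j; first exact: h.
  by apply/esym; exact: h.
have : e ^+ w i < e ^+ w j by rewrite ltr_iXn2l// w_lt.
by rewrite yij ltxx.
Qed.

(* Put x_i = e^-w_i with widely spaced w and let e tend to 0: the monomial of
   largest weight dominates p and every x_i / (x_i - x_j) tends to 0 or 1. *)
Lemma eigen_lead E :
  (forall x : 'I_n -> R, injective x -> jack_op beta p x = E * meval x p) ->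
  E = \sum_(i < n) (nu i)%:R * ((nu i)%:R - 1) + beta * \sum_(i < n) (n - i.+1)%N%:R * (nu i)%:R.
Proof.
move=> eig.
(* The term x_i^2 d_i^2 is the square of [Eu i] minus [Eu i]. Euler operators act on monomials by
   scalars, so supports do not grow and the limit along powers of [e] applies to each term. *)
pose Eu i (q : mpoly n R) := mvar R i * mderiv i q.
have Eusub i q : {subset msupp q <= msupp p} -> {subset msupp (Eu i q) <= msupp p}.
  move=> qp a; rewrite mcoeff_msupp mcoeff_euler mulf_eq0 negb_or => /andP[_].
  by rewrite -mcoeff_msupp => /qp.
pose N := weight B nu.
have cE i q : {subset msupp q <= msupp p} ->
    e ^+ N * meval (y e) (Eu i q) @[e --> 0^'+] --> (nu i)%:R * mcoeff nu q.
  by move=> /(Eusub i) /meval_powers_cvg; rewrite mcoeff_euler.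
have pp : {subset msupp p <= msupp p} by [].
have lhs : \sum_i (e ^+ N * meval (y e) (Eu i (Eu i p)) - e ^+ N * meval (y e) (Eu i p)) +
    beta * \sum_i \sum_(j | i != j) y e i / (y e i - y e j) * (e ^+ N * meval (y e) (Eu i p))
    @[e --> 0^'+] --> \sum_i ((nu i)%:R * ((nu i)%:R * mcoeff nu p) - (nu i)%:R * mcoeff nu p) +
    beta * \sum_(i < n) \sum_(j < n | i != j) (i < j)%N%:R * ((nu i)%:R * mcoeff nu p).
  apply: cvgD.
    apply: cvgr_sum => i _; apply: cvgB; last exact: cE.
    by have := cE i _ (Eusub i _ pp); rewrite mcoeff_euler.
  apply: cvgMl_tmp; apply: cvgr_sum => i _; apply: cvgr_sum => j ij.
  by apply: cvgM; [exact: frac_cvg|exact: cE].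
have rhs : E * (e ^+ N * meval (y e) p) @[e --> 0^'+] --> E * mcoeff nu p.
  by apply: cvgMl_tmp; exact: meval_powers_cvg.
have {}rhs : \sum_i (e ^+ N * meval (y e) (Eu i (Eu i p)) - e ^+ N * meval (y e) (Eu i p)) +
    beta * \sum_i \sum_(j | i != j) y e i / (y e i - y e j) * (e ^+ N * meval (y e) (Eu i p))
    @[e --> 0^'+] --> E * mcoeff nu p.
  apply: cvg_trans rhs; apply: near_eq_cvg; near=> e.
  have e0 : 0 < e by near: e; exact: nbhs_right_gt.
  have e1 : e < 1 by near: e; exact: nbhs_right_lt.
  rewrite mulrCA -(eig _ (y_inj e0 e1)) /jack_op mulrDr mulr_sumr; congr (_ + _).
    apply: eq_bigr => i _; rewrite /Eu mderiv_derivation mderivXU eqxx mul1r.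
    rewrite mevalM mevalD !mevalM !mevalXU; ring.
  rewrite mulrCA; congr (_ * _); rewrite mulr_sumr; apply: eq_bigr => i _.
  rewrite mulr_sumr; apply: eq_bigr => j _; rewrite /Eu mevalM mevalXU.
  by move: (_ - _)^-1 => z; ring.
have e := cvg_unique (@Rhausdorff R) lhs rhs.
have pnu : mcoeff nu p != 0 by rewrite -mcoeff_msupp.
apply: (mulIf pnu); rewrite -[LHS]e mulrDl -mulrA !mulr_suml; congr (_ + _ * _).
  by apply: eq_bigr => i _; ring.
apply: eq_bigr => i _; rewrite -count_gt_ord natr_sum !mulr_suml.
by apply: eq_bigr => j _; ring.
Unshelve. all: by end_near. Qed.

End EigenLead.

(** * Monotonicity of the eigenvalue under dominance *)

Section Kappa.
Variables (n : nat) (kappa : seq nat).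
Hypothesis kn : (size kappa <= n)%N.
Local Open Scope nat_scope.

Definition part_mnm : multinom n := Multinom [tuple nth 0 kappa i | i < n].
Definition tau s := sumn (take s kappa).

Lemma part_mnmE i : part_mnm i = nth 0 kappa i. Proof. by rewrite mnmE. Qed.

Lemma tauE s : tau s = \sum_(i < n | i < s) part_mnm i.
Proof.
under eq_bigr do rewrite part_mnmE.
rewrite /tau; elim: s => [|s IH]; first by rewrite take0 big_pred0.
have [ks|sk] := leqP (size kappa) s.
  have -> : take s.+1 kappa = take s kappa by rewrite !take_oversize// (leq_trans ks).
  rewrite IH.
  rewrite big_mkcond [RHS]big_mkcond /=; apply: eq_bigr => i _.
  have [->|si] := eqVneq (i : nat) s; first by rewrite ltnn ltnS leqnn nth_default.
  by rewrite ltnS [in RHS]leq_eqVlt (negbTE si).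
rewrite (take_nth 0)// sumn_rcons IH.
have sn : s < n by apply: leq_trans kn.
rewrite [RHS](bigD1 (Ordinal sn))//= addnC; congr (_ + _).
by apply: eq_bigl => i; rewrite ltnS -val_eqE /=; case: ltngtP.
Qed.

Lemma leq_tau s s' : s <= s' -> tau s <= tau s'.
Proof.
move=> ss; rewrite !tauE big_mkcond [X in _ <= X]big_mkcond; apply: leq_sum => i _.
by case: ifP => // /leq_trans/(_ ss) ->.
Qed.

Lemma sum_part_mnm : \sum_i part_mnm i = sumn kappa.
Proof.
rewrite -[kappa in RHS](@take_oversize _ n)// -/(tau n) tauE.
by apply: eq_bigl => i; rewrite ltn_ord.
Qed.

Variable nu : multinom n.
Hypothesis nud : subset_bounded tau nu.
Hypothesis nuk : \sum_i nu i = sumn kappa.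

Lemma dom_prefix s : \sum_(i < n | i < s) nu i <= \sum_(i < n | i < s) part_mnm i.
Proof.
have [sn|ns] := leqP s n.
  have := nud [set i : 'I_n | i < s]; rewrite card_ltn_ord (minn_idPl sn) tauE.
  by rewrite (eq_bigl (fun i : 'I_n => i < s)) // => i; rewrite inE.
rewrite (eq_bigl xpredT) => [|i]; last by rewrite (ltn_trans (ltn_ord i)).
rewrite nuk -sum_part_mnm [X in _ <= X](eq_bigl xpredT)// => i.
by rewrite (ltn_trans (ltn_ord i)).
Qed.

(** On the set where [nu] exceeds [h], the left side is a sum of [nu] minus [h] times the
    cardinality; the bound by [tau] applies to this set. *)
Lemma sum_sub_le h : \sum_i (nu i - h) <= \sum_i (part_mnm i - h).
Proof.
pose S := [set i : 'I_n | h < nu i].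
have e : \sum_(i in S) nu i = \sum_i (nu i - h) + h * #|S|.
  rewrite mulnC -sum_nat_const [X in _ = X + _](bigID (mem S)) /=.
  rewrite [X in _ = _ + X + _]big1 => [|i]; last by rewrite inE -leqNgt => /eqP.
  by rewrite addn0 -big_split; apply: eq_bigr => i; rewrite inE => /ltnW /subnK.
have := nud S; rewrite e tauE => le1.
have Sn : #|S| <= n by rewrite -[X in _ <= X]card_ord max_card.
have le2 : \sum_(i < n | i < #|S|) part_mnm i <= \sum_i (part_mnm i - h) + h * #|S|.
  have -> : h * #|S| = \sum_(i < n | i < #|S|) h.
    rewrite -[in LHS](minn_idPl Sn) -card_ltn_ord mulnC -sum_nat_const.
    by apply: eq_bigl => i; rewrite inE.
  rewrite [X in _ <= X + _](bigID (fun i : 'I_n => i < #|S|)) /= addnAC -big_split /=.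
  by apply: leq_trans (leq_addr _ _); apply: leq_sum => i _; lia.
by move: (leq_trans le1 le2); rewrite leq_add2r.
Qed.

(** Majorization for the convex function x (x + 1), which is twice the sum over [h] of the truncated
    differences [x - h]. *)
Lemma sum_sq_le : \sum_i nu i * (nu i).+1 <= \sum_i part_mnm i * (part_mnm i).+1.
Proof.
have sqE H x : x <= H -> x * x.+1 = 2 * \sum_(h < H) (x - h).
  elim: H x => [|H IH] [|x] xH //; [by rewrite big1 ?muln0|by rewrite big1 ?muln0|].
  rewrite big_ord_recl subn0 mulnDr /=.
  rewrite (eq_bigr (fun h : 'I_H => x - h)) => [|h _]; last by rewrite /bump /= add1n subSS.
  by rewrite -IH//; lia.
pose H := sumn kappa.
have le1 i : nu i <= H by exact: leq_sum_entry.
have le2 i : part_mnm i <= H by apply: leq_sum_entry; exact: sum_part_mnm.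
under eq_bigr do rewrite (sqE H)//.
under [X in _ <= X]eq_bigr do rewrite (sqE H)//.
rewrite -!big_distrr /= leq_mul2l /= exchange_big [X in _ <= X]exchange_big /=.
by apply: leq_sum => h _; exact: sum_sub_le.
Qed.

Lemma sum_lin_prefix (a : 'I_n -> nat) :
  \sum_(i < n) (n - i.+1) * a i = \sum_(s < n) \sum_(i < n | i < s) a i.
Proof.
rewrite (exchange_big_dep xpredT) //=; apply: eq_bigr => i _.
rewrite sum_nat_cond_const; congr (_ * _).
rewrite -(count_gt_ord i) -sum1_card [RHS]big_mkcond /= big_mkcond.
rewrite [LHS]big_mkcond /=; apply: eq_bigr => j _.
by rewrite -val_eqE /= inE; case: ltngtP.
Qed.

Lemma sum_lin_le : \sum_(i < n) (n - i.+1) * nu i <= \sum_(i < n) (n - i.+1) * part_mnm i.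
Proof. by rewrite !sum_lin_prefix; apply: leq_sum => s _; exact: dom_prefix. Qed.

(** Both sides are sums of prefix sums, those of [nu] being at most those of [part_mnm]; equal
    totals force equality of each. *)
Lemma sum_lin_eq : \sum_(i < n) (n - i.+1) * nu i = \sum_(i < n) (n - i.+1) * part_mnm i -> nu = part_mnm.
Proof.
rewrite !sum_lin_prefix => e.
have pre s : s < n -> \sum_(i < n | i < s) nu i = \sum_(i < n | i < s) part_mnm i.
  move=> sn; have [_ /esym] := @leqif_sum _ xpredT
    (fun s : 'I_n => \sum_(i < n | i < s) nu i == \sum_(i < n | i < s) part_mnm i)
    _ _ (fun s _ => leqif_eq (dom_prefix s)).
  by rewrite e eqxx => /forallP/(_ (Ordinal sn)) /eqP.
have {}pre s : s <= n -> \sum_(i < n | i < s) nu i = \sum_(i < n | i < s) part_mnm i.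
  rewrite leq_eqVlt => /predU1P[->|/pre//].
  have allE (c : 'I_n -> nat) : \sum_(i < n | i < n) c i = \sum_i c i.
    by apply: eq_bigl => i; rewrite ltn_ord.
  by rewrite !allE nuk sum_part_mnm.
apply/mnmP => i.
have preD (a : multinom n) : \sum_(j < n | j < i.+1) a j = \sum_(j < n | j < i) a j + a i.
  rewrite (bigD1 i)//= addnC; congr (_ + _); apply: eq_bigl => j.
  by rewrite ltnS -val_eqE /=; case: ltngtP.
have := pre _ (ltn_ord i); rewrite (preD nu) (preD part_mnm) (pre i (ltnW (ltn_ord i))).
exact: addnI.
Qed.
End Kappa.

Section JackUnique.
Variables (R : realType) (beta : R) (n : nat) (kappa : seq nat).
Hypothesis kn : (size kappa <= n)%N.
Hypothesis beta0 : 0 < beta.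

Let E : R := rho beta kappa + beta * (sumn kappa)%:R * (n%:R - 1).
Let K : multinom n := part_mnm n kappa.

Lemma jack_eigenvalueE : E = \sum_(i < n) (K i)%:R * ((K i)%:R - 1) +
  beta * \sum_(i < n) (n - i.+1)%N%:R * (K i)%:R.
Proof.
rewrite /E /rho (big_ord_widen n (fun i => (nth 0%N kappa i)%:R *
  ((nth 0%N kappa i)%:R - 1 - beta * i%:R)))//.
rewrite -(sum_part_mnm kn) natr_sum mulrAC -mulrA !mulr_sumr big_mkcond -!big_split /=.
apply: eq_bigr => i _; rewrite /K part_mnmE natrB ?ltn_ord// -[i.+1]addn1 natrD.
case: leqP => [_|h]; [by ring|rewrite addn1 ltnS in h; rewrite (nth_default _ h)].
by rewrite !mul0r !mulr0.
Qed.

(** The quadratic and the linear part of the eigenvalue are both monotone for dominance, and [beta]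
    is positive; equal eigenvalues thus force equality in the linear part, which determines [nu]. *)
Lemma jack_eigenvalue_inj (nu : multinom n) : subset_bounded (tau kappa) nu ->
  (\sum_i nu i = sumn kappa)%N ->
  E = \sum_(i < n) (nu i)%:R * ((nu i)%:R - 1) +
    beta * \sum_(i < n) (n - i.+1)%N%:R * (nu i)%:R ->
  nu = K.
Proof.
move=> nud nuk; rewrite jack_eigenvalueE.
have sqE (a : multinom n) : \sum_(i < n) (a i)%:R * ((a i)%:R - 1) =
    (\sum_i a i * (a i).+1)%N%:R - 2 * (\sum_i a i)%N%:R :> R.
  rewrite !natr_sum mulr_sumr -sumrB; apply: eq_bigr => i _.
  by rewrite natrM -[(a i).+1]addn1 natrD; ring.
have linE (a : multinom n) : \sum_(i < n) (n - i.+1)%N%:R * (a i)%:R =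
    (\sum_(i < n) (n - i.+1) * a i)%N%:R :> R.
  by rewrite natr_sum; apply: eq_bigr => i _; rewrite natrM.
rewrite !sqE !linE nuk sum_part_mnm// => e.
apply: (sum_lin_eq kn nud nuk); apply/eqP; rewrite eqn_leq (sum_lin_le kn nud nuk) /=.
have sq : (\sum_i nu i * (nu i).+1)%N%:R <= (\sum_i K i * (K i).+1)%N%:R :> R.
  by rewrite ler_nat; exact: sum_sq_le.
rewrite -(ler_nat R) -(ler_pM2l beta0).
move: e sq; rewrite -/K.
move: (\sum_i nu i * (nu i).+1)%N%:R (\sum_i K i * (K i).+1)%N%:R => u v.
move: (beta * _) (beta * _) (2 * _) => a b c; lra.
Qed.

Definition jack_supp (p : mpoly n R) := forall a, a \in msupp p ->
  subset_bounded (tau kappa) a /\ (\sum_i a i = sumn kappa)%N.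

Lemma jack_op_linear a (p q : mpoly n R) x :
  jack_op beta (a *: p + q) x = a * jack_op beta p x + jack_op beta q x.
Proof.
have ev u v : meval x (a *: u + v) = a * meval x u + meval x v.
  by rewrite mevalD mevalZ.
have dv i u v : mderiv i (a *: u + v) = a *: mderiv i u + mderiv i v :> mpoly n R.
  exact: linearP.
rewrite /jack_op mulrDr addrACA; congr (_ + _).
  rewrite mulr_sumr -big_split; apply: eq_bigr => i _ /=.
  by rewrite !dv ev; ring.
rewrite mulrCA -mulrDr; congr (_ * _).
rewrite mulr_sumr -big_split; apply: eq_bigr => i _ /=.
rewrite mulr_sumr -big_split; apply: eq_bigr => j _ /=.
by rewrite !dv ev; ring.
Qed.

(** The difference [r] has coefficient 0 at [K]. If it were nonzero, its heaviest exponent would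
    have the eigenvalue [E] by [eigen_lead], hence would be [K]. *)
Lemma jack_unique (p q : mpoly n R) : jack_supp p -> jack_supp q ->
  (forall x : 'I_n -> R, injective x -> jack_op beta p x = E * meval x p) ->
  (forall x : 'I_n -> R, injective x -> jack_op beta q x = E * meval x q) ->
  mcoeff K q != 0 -> p = (mcoeff K p / mcoeff K q) *: q.
Proof.
move=> ps qs pe qe qK; set c := _ / _.
pose r := - c *: q + p; suff r0 : r = 0.
  by apply/eqP; rewrite -subr_eq0 addrC -scaleNr; apply/eqP.
have rs : jack_supp r.
  by move=> a /msuppD_le; rewrite mem_cat => /orP[/msuppZ_le/qs|/ps].
apply/eqP/negP => /negP r0.
pose B := (sumn kappa).+2.
have [nu nur numax] : exists2 nu, nu \in msupp r &
    forall a, a \in msupp r -> (weight B a <= weight B nu)%N.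
  move: r0; rewrite -msupp_eq0; elim: (msupp r) => [//|a s IH] _.
  have [->|/IH[nu nus h]] := eqVneq s [::].
    by exists a => [|b]; rewrite mem_seq1 ?eqxx// => /eqP ->.
  have [le|/ltnW le] := leqP (weight B a) (weight B nu).
    exists nu; first by rewrite inE nus orbT.
    by move=> b; rewrite inE => /orP[/eqP ->//|/h].
  exists a; first by rewrite mem_head.
  by move=> b; rewrite inE => /orP[/eqP ->//|/h /leq_trans]; exact.
have rB a : a \in msupp r -> forall i, (a i < B)%N.
  by move=> /rs[_ /leq_sum_entry h] i; rewrite ltnS (leq_trans (h i)).
have nuinj a : a \in msupp r -> weight B a = weight B nu -> a = nu.
  by move=> ar e; apply/mnmP; apply: (@weight_inj B) => //; exact: rB.
have re x : injective x -> jack_op beta r x = E * meval x r.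
  move=> xI; rewrite jack_op_linear pe// qe// mevalD mevalZ; ring.
have := @eigen_lead R beta n B isT r nu nur numax nuinj E re.
have [nud nuk] := rs _ nur.
move=> /(jack_eigenvalue_inj nud nuk) nuK.
move: nur; rewrite mcoeff_msupp nuK mcoeffD mcoeffZ /c.
by rewrite mulNr divfK// addNr eqxx.
Qed.
End JackUnique.

(** * Support, leading coefficient and symmetry of the Jack polynomials *)

Section JackFacts.
Variables (R : realType) (n : nat) (kappa : seq nat).
Hypothesis kn : (size kappa <= n)%N.
Hypothesis kpart : is_part kappa.

Lemma mcoeff_msym_poly mu (a : multinom n) :
  mcoeff a (msym_poly R n mu) = (perm_eq a (mu ++ nseq (n - size mu) 0%N))%:R.
Proof.
rewrite /msym_poly raddf_sum /=.
case: (boolP (perm_eq a _)) => ap; last first.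
  rewrite big1// => e ep; rewrite mcoeffX; case: eqP => // ea.
  by move: ap; rewrite -ea ep.
have dega : (mdeg a < (sumn mu).+1)%N.
  rewrite /mdeg (perm_big _ ap) /= big_cat /= big_nseq iter_addn_0 mul0n addn0.
  by rewrite sumnE.
rewrite (bigD1 (BMultinom dega))//= mcoeffX eqxx big1 ?addr0// => e /andP[_ ne].
rewrite mcoeffX; case: eqP => // ea; case/eqP: ne; exact: val_inj.
Qed.

Lemma sorted_padded mu c : is_part mu -> sorted geq (mu ++ nseq c 0%N).
Proof.
have gt : transitive geq by move=> a b d ba db; exact: leq_trans db ba.
move=> /andP[ms _]; rewrite (sorted_pairwise gt) pairwise_cat -(sorted_pairwise gt) ms.
apply/and3P; split => //; first by apply/allrelP => x y _; rewrite mem_nseq => /andP[_ /eqP ->].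
by elim: c => //= c ->; rewrite andbT; apply/allP => y; rewrite mem_nseq => /andP[_ /eqP ->].
Qed.

(** Take as threshold [h] the entry of [s] at position [#|S|]. A sum over [S] is at most the total
    excess over [h] plus [h * #|S|], and the first [#|S|] entries of [s] attain this bound. *)
Lemma perm_sorted_top (a : multinom n) s (S : {set 'I_n}) :
  perm_eq a s -> sorted geq s -> (\sum_(i in S) a i <= sumn (take #|S| s))%N.
Proof.
move=> ap ss; have gt : transitive geq by move=> x y z yx zy; exact: leq_trans zy yx.
have sE (f : nat -> nat) : (\sum_(x <- s) f x = \sum_i f (a i))%N.
  by rewrite -(perm_big _ ap) /= big_tuple.
have [sz|Ss] := leqP (size s) #|S|.
  rewrite take_oversize// sumnE sE [X in (_ <= X)%N](bigID (mem S)) /=.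
  exact: leq_addr.
set c := #|S|; pose h := nth 0%N s c.
move: ss; rewrite (sorted_pairwise gt) -{1}(cat_take_drop c s) pairwise_cat (drop_nth 0%N)// -/h.
move=> /and3P[/allrelP hi _ /= /andP[/allP lo _]].
apply: (@leq_trans (\sum_i (a i - h) + h * c)).
  rewrite [X in (_ <= X + _)%N](bigID (mem S)) /= addnAC mulnC -sum_nat_const -big_split /=.
  by apply: leq_trans (leq_addr _ _); apply: leq_sum => i _; lia.
rewrite -(sE (fun x => x - h)%N) -{1}(cat_take_drop c s) big_cat /= (drop_nth 0%N)// -/h big_cons subnn.
rewrite [X in (_ + (_ + X) + _)%N]big1_seq ?addn0; last first.
  by move=> x /andP[_ /lo /= xh]; apply/eqP; rewrite subn_eq0.
have {2}-> : c = size (take c s) by rewrite size_take Ss.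
rewrite sumnE; have : forall x, x \in take c s -> (h <= x)%N.
  by move=> x /hi; apply; rewrite mem_head.
elim: (take c s) => [|x t IH] ht; first by rewrite !big_nil muln0.
rewrite !big_cons /= mulnS.
have := ht x (mem_head _ _); have := IH (fun y yt => ht y (mem_behead (s := x :: t) yt)) => A B; rewrite addnACA subnK ?leq_add2l //.
Qed.

Variables (beta : R) (C : seq nat -> mpoly n R).
Hypothesis hC : is_jackC beta C.

Lemma jack_shapeC : exists2 a : seq nat -> R, a kappa != 0 &
  forall b, mcoeff b (C kappa) =
    \sum_(mu <- parts (sumn kappa) n | `[< dominated mu kappa >])
       a mu * (perm_eq b (mu ++ nseq (n - size mu) 0%N))%:R.
Proof.
case: hC => [/(_ kappa kpart kn)[[a ak ->] _] _]; exists a => // b.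
by rewrite raddf_sum; apply: eq_bigr => mu _ /=; rewrite mcoeffZ mcoeff_msym_poly.
Qed.

Lemma jack_suppC : jack_supp kappa (C kappa).
Proof.
have [a _ aE] := jack_shapeC => b; rewrite mcoeff_msupp aE => b0.
have [mu [mup mud bp]] : exists mu, [/\ mu \in parts (sumn kappa) n, dominated mu kappa &
    perm_eq b (mu ++ nseq (n - size mu) 0%N)].
  apply/not_existsP => h; case/eqP: b0; rewrite big1_seq// => mu /andP[/asboolP mud mup].
  case: (boolP (perm_eq _ _)) => bp; last by rewrite mulr0.
  by case: (h mu).
move: mup; rewrite mem_parts => /and3P[mpart /eqP msum msz]; split=> [S|].
  apply: leq_trans (perm_sorted_top S bp (sorted_padded _ mpart)) _.
  apply: leq_trans (mud #|S|); rewrite take_cat; case: ltnP => // mS.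
  have z c j : sumn (take j (nseq c 0%N)) = 0%N by elim: c j => [|c IH] [|j] //=; rewrite IH.
  by rewrite sumn_cat z addn0 take_oversize.
have := mdegE b; rewrite /mdeg (perm_big _ bp) /= big_cat /= big_nseq iter_addn_0 mul0n addn0.
by rewrite -sumnE msum => ->.
Qed.

Lemma part_mnm_seq : part_mnm n kappa = kappa ++ nseq (n - size kappa) 0%N :> seq nat.
Proof.
apply: (@eq_from_nth _ 0%N) => [|i].
  by rewrite size_tuple size_cat size_nseq subnKC.
rewrite size_tuple => i_n; rewrite -(mnm_nth 0%N (part_mnm n kappa) (Ordinal i_n)) part_mnmE nth_cat /=.
by case: ltnP => // h; rewrite nth_default// nth_nseq; case: ifP.
Qed.

(** Only [kappa] itself contributes: two padded partitions that are rearrangements of each other are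
    both sorted, hence equal. *)
Lemma mcoeff_part_mnm_jackC : mcoeff (part_mnm n kappa) (C kappa) != 0.
Proof.
have [a ak ->] := jack_shapeC.
rewrite big_mkcond (bigD1_seq kappa) ?parts_uniq//=; last first.
  by rewrite mem_parts kpart eqxx kn.
rewrite asboolT// part_mnm_seq perm_refl mulr1 big1_seq ?addr0// => mu /andP[muk mup].
case: ifP => // _; case: (boolP (perm_eq _ _)) => bp; last by rewrite mulr0.
move: mup; rewrite mem_parts => /and3P[mpart _ _].
have e : kappa ++ nseq (n - size kappa) 0%N = mu ++ nseq (n - size mu) 0%N.
  apply: (sorted_eq (leT := geq)) => //; try exact: sorted_padded.
  - by move=> x y z yx zy; exact: leq_trans zy yx.
  - by move=> x y; rewrite andbC => /anti_leq.
have part0 s c : is_part s -> [seq x <- s ++ nseq c 0%N | x != 0%N] = s.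
  move=> /andP[_ s0]; rewrite filter_cat (_ : [seq x <- nseq c _ | _] = [::]).
    by rewrite cats0; apply/all_filterP/allP => x xs; apply: contraNneq s0 => <-.
  by elim: c.
by move: muk; rewrite -(part0 mu (n - size mu)%N)// -e part0// eqxx.
Qed.

Lemma jackC_sym : C kappa \is symmetric.
Proof.
have [a _ aE] := jack_shapeC.
apply/issymP => s; apply/mpolyP => b; rewrite mcoeff_sym !aE.
have bs : perm_eq (Multinom [tuple b (s i) | i < n]) b.
  by apply/tuple_permP; exists s; congr val; apply: eq_mktuple => i; rewrite mnm_tnth.
by apply: eq_bigr => mu _; rewrite (permPl bs).
Qed.

Lemma jackC_eigen (x : 'I_n -> R) : injective x ->
  jack_op beta (C kappa) x =
  (rho beta kappa + beta * (sumn kappa)%:R * (n%:R - 1)) * meval x (C kappa).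
Proof.
move=> xI; have [/(_ kappa kpart kn)[_ /(_ (\row_i x i)) eig] _] := hC; move: eig.
have xE : (\row_i x i) 0 = x by apply/funext => i; rewrite mxE.
by rewrite /Dstar /evalv xE => /(_ xI) <-.
Qed.

End JackFacts.

(** * Linearity of the operators at a point, and the Euler identity *)

Section ScalarLinear.
Variables (R : numFieldType) (N : nat).
Implicit Types (D : mpoly N R -> R).

Definition sclinear D := forall a p q, D (a *: p + q) = a * D p + D q.

Lemma sclinearD D D' : sclinear D -> sclinear D' -> sclinear (fun p => D p + D' p).
Proof. by move=> h h' a p q; rewrite h h'; ring. Qed.

Lemma sclinearZ c D : sclinear D -> sclinear (fun p => c * D p).
Proof. by move=> h a p q; rewrite h; ring. Qed.

Lemma sclinear_sum (I : finType) (P : pred I) (D : I -> mpoly N R -> R) :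
  (forall i, P i -> sclinear (D i)) -> sclinear (fun p => \sum_(i | P i) D i p).
Proof.
move=> h a p q; rewrite mulr_sumr -big_split; apply: eq_bigr => i Pi.
by rewrite h.
Qed.

Lemma sclinear_meval v (d : mpoly N R -> mpoly N R) : linear d ->
  sclinear (fun p => meval v (d p)).
Proof. by move=> h a p q; rewrite h mevalD mevalZ. Qed.

Lemma sclinear_comb D (I : Type) (s : seq I) (c : I -> R) (f : I -> mpoly N R) :
  sclinear D -> D (\sum_(i <- s) c i *: f i) = \sum_(i <- s) c i * D (f i).
Proof.
move=> h; have D0 : D 0 = 0 by apply: addr_idem0; have := h 1 0 0; rewrite scaler0 addr0 mul1r.
by elim: s => [|i s IH]; rewrite ?big_nil// !big_cons h IH.
Qed.
End ScalarLinear.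

Section OperatorLinear.
Variables (R : numFieldType) (beta : R).

Lemma mu_op_sclinear m (mu : 'I_m -> R) : sclinear (mu_op beta mu).
Proof.
have dl i : linear (mderiv i : mpoly m R -> mpoly m R) by move=> a p q; rewrite linearP.
apply: sclinearD; last first.
  by apply/sclinearZ/sclinear_sum => i _; apply/sclinearZ/sclinear_meval.
apply: sclinearD.
  by apply: sclinear_sum => i _; apply/sclinearZ/sclinear_meval => a p q; rewrite !dl.
apply/sclinearZ/sclinear_sum => i _; apply: sclinear_sum => j _.
by apply/sclinearZ/sclinear_meval.
Qed.

Lemma xt_op_sclinear n (x t : 'I_n -> R) : sclinear (xt_op beta x t).
Proof.
have dl i : linear (mderiv i : mpoly (n + n) R -> mpoly (n + n) R).
  by move=> a p q; rewrite linearP.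
have dikl i k : linear (deriv_diff i k : mpoly (n + n) R -> mpoly (n + n) R).
  by move=> a p q; rewrite /deriv_diff !dl scalerBr opprD addrACA.
apply: sclinearD; first apply: sclinearD.
- by apply: sclinear_sum => i _; apply/sclinearZ/sclinear_meval => a p q; rewrite !dl.
- apply: sclinear_sum => i _; apply: sclinear_sum => j _.
  exact/sclinearZ/sclinear_meval.
apply: sclinear_sum => i _; apply: sclinear_sum => k _; apply: sclinearD.
  exact/sclinearZ/sclinear_meval.
by apply/sclinearZ/sclinear_meval => a p q; rewrite !dikl.
Qed.
End OperatorLinear.

Lemma euler_op_homog (R : realType) n k (p : mpoly n R) (x : 'I_n -> R) :
  (forall a, a \in msupp p -> (\sum_i a i = k)%N) -> euler_op p x = k%:R * meval x p.
Proof.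
move=> pk; rewrite /euler_op -mevalZ.
rewrite (_ : k%:R *: p = \sum_i mvar R i * mderiv i p).
  rewrite (raddf_sum (meval x)); apply: eq_bigr => i _.
  by apply/esym; apply: etrans (mevalM _ _ _) _; rewrite mevalXU.
apply/mpolyP => a; rewrite mcoeffZ raddf_sum /=.
under eq_bigr do rewrite mcoeff_euler.
rewrite -mulr_suml -natr_sum.
by case: (boolP (a \in msupp p)) => [/pk ->//|/memN_msupp_eq0 ->]; rewrite !mulr0.
Qed.

(** * The integrated polynomial is a nonzero multiple of the Jack polynomial *)

Section Transfer.
Variables (R : realType) (beta : R) (m : nat) (kappa : seq nat).
Variables (C : forall n, seq nat -> mpoly n R).
Variable (M : multinom (m + 1) -> R).
Hypothesis beta0 : 0 < beta.
Hypothesis km : (size kappa <= m)%N.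
Hypothesis kpart : is_part kappa.
Hypothesis hC : forall n, is_jackC beta (C n).
Hypothesis M0 : forall b, 0 < M b.
Hypothesis M_rec : forall (b : multinom (m + 1)) i k, i != k ->
  (beta / 2 + (b k)%:R) * M (mnm_add b (mnm1 i)) =
  (beta / 2 + (b i)%:R) * M (mnm_add b (mnm1 k)).

Definition simplex (t : 'I_(m + 1) -> R) := (forall i, 0 < t i) /\ \sum_i t i = 1.

Hypothesis M_ext : forall x (P Q : mpoly ((m + 1) + (m + 1)) R),
  (forall t, simplex t -> meval (join_pt x t) P = meval (join_pt x t) Q) ->
  meval x (moment_map M P) = meval x (moment_map M Q).
(** The identity in (x, t) is inherited from the eigenvalue equation in [mu], so each point of the
    simplex has to come from some [mu]. *)
Hypothesis arrow : forall x t, injective x -> simplex t ->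
  exists2 mu : 'I_m -> R, injective mu & forall r, elsymT mu r = usym x t r.

(** The expansion of [C m kappa] in products of elementary polynomials is kept term by term: the
    dominance bounds and the coefficient at [kappa] of the integral are read off from its terms. *)
Lemma jack_transfer : exists2 P : mpoly ((m + 1) + (m + 1)) R,
  exists2 c, c != 0 & C (m + 1) kappa = c *: moment_map M P &
  forall x t (mu : 'I_m -> R), injective x -> simplex t -> injective mu ->
    (forall r, elsymT mu r = usym x t r) -> meval mu (C m kappa) = meval (join_pt x t) P.
Proof.
have kn : (size kappa <= m + 1)%N by rewrite (leq_trans km)// leq_addr.
pose k := sumn kappa.
have [l [pE lP]] := sym_expansion (jackC_sym km kpart (hC m)) (jack_suppC km kpart (hC m)).
pose P : mpoly ((m + 1) + (m + 1)) R :=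
  \sum_(z <- l) z.1 *: \prod_(r <- cols k z.2) usym_poly R (m + 1) r.
have PE x t (mu : 'I_m -> R) : injective x -> injective mu ->
    (forall r, elsymT mu r = usym x t r) ->
    meval mu (C m kappa) = meval (join_pt x t) P /\ mu_op beta mu (C m kappa) = xt_op beta x t P.
  move=> xI muI eu; have nm : (m + 1 = m.+1)%N by rewrite addn1.
  have h (z : R * multinom m) := mu_op_xt_op beta (cols k z.2) nm muI xI eu.
  have id_lin N : linear (id : mpoly N R -> mpoly N R) by [].
  rewrite pE /P (sclinear_comb _ _ _ (@mu_op_sclinear _ beta _ mu)).
  rewrite (sclinear_comb _ _ _ (@xt_op_sclinear _ beta _ x t)).
  rewrite (sclinear_comb _ _ _ (@sclinear_meval _ _ mu _ (@id_lin _))).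
  rewrite (sclinear_comb _ _ _ (@sclinear_meval _ _ (join_pt x t) _ (@id_lin _))).
  by split; apply: eq_bigr => z _; congr (_ * _); have [] := h z.
exists P; last by move=> x t mu xI _ muI eu; have [] := PE x t mu xI muI eu.
pose Q := moment_map M P.
have Qeig x : injective x -> jack_op beta Q x =
    (rho beta kappa + beta * (sumn kappa)%:R * ((m + 1)%:R - 1)) * meval x Q.
  move=> xI; rewrite /Q (jack_op_moment_map M_rec).
  set E := (X in _ = X * _).
  rewrite -(mevalZ x E) -linearZ /=; apply: M_ext => t st.
  have [mu muI eu] := arrow xI st.
  have [e1 e2] := PE x t mu xI muI eu.
  rewrite meval_xt_op_poly -e2; apply: etrans _ (esym (mevalZ _ _ _)).
  rewrite -e1 /mu_op (jackC_eigen km kpart (hC m) muI) (@euler_op_homog _ _ (sumn kappa)).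
    by rewrite /E natrD; ring.
  by move=> a /(jack_suppC km kpart (hC m))[].
have zsupp z : z \in l -> forall a, a \in msupp (moment_map M (\prod_(r <- cols k z.2) usym_poly R (m + 1) r)) ->
    (forall S : {set 'I_(m + 1)}, \sum_(i in S) a i <= \sum_(r <- cols k z.2) minn r #|S|)%N /\
    (\sum_i a i = sumn kappa)%N.
  move=> zl a /msupp_moment_map[c cP <-]; have [zS [zd zk]] := lP z zl; split=> [S|].
    by have := @usym_poly_prod_le R (m + 1) (cols k z.2) S c cP; rewrite sum_lsh.
  have /eqP := @usym_poly_prod_eq R (m + 1) (cols k z.2) c cP.
  rewrite sum_lsh cols_sum//; last exact: leq_sum_entry.
  by rewrite zk => <-; apply: eq_bigl => i; rewrite inE.
(* Beyond [m] the left side no longer grows, as no column is longer than [m], while [tau] is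
   nondecreasing. *)
have colsle z : z \in l -> forall s, (\sum_(r <- cols k z.2) minn r s <= tau kappa s)%N.
  move=> zl s; have [zS [zd zk]] := lP z zl; have [sm|ms] := leqP s m.
    by apply: cols_subset_bounded => //; exact: leq_sum_entry.
  apply: leq_trans (leq_tau km (ltnW ms)).
  apply: leq_trans (cols_subset_bounded zS (leq_sum_entry zk) zd (leqnn m)).
  rewrite big_seq [X in (_ <= X)%N]big_seq; apply: leq_sum => r /(allP (cols_le k z.2)) rm.
  by rewrite (minn_idPl rm) geq_minl.
have Qsupp : jack_supp kappa Q.
  move=> a; rewrite /Q /P raddf_sum /= => aQ.
  have [z zl] : exists2 z, z \in l & a \in msupp (moment_map M (\prod_(r <- cols k z.2) usym_poly R (m + 1) r)).
    move: aQ; rewrite mcoeff_msupp raddf_sum /= => a0.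
    apply/not_exists2P => h; case/eqP: a0; rewrite big1_seq// => z /andP[_ zl].
    case: (h z) => // /negP; rewrite linearZ /= mcoeffZ => /memN_msupp_eq0 ->.
    by rewrite mulr0.
  move=> /(zsupp z zl)[aS ak]; split=> // S.
  exact: leq_trans (aS S) (colsle z zl _).
pose K := part_mnm m kappa.
have preE N (kN : (size kappa <= N)%N) s : (s <= N)%N ->
    #|[set i : 'I_N | (i < s)%N]%SET| = s /\
    (\sum_(i in [set i : 'I_N | (i < s)%N]%SET) part_mnm N kappa i = tau kappa s)%N.
  move=> sN; split; first by rewrite card_ltn_ord; apply/minn_idPl.
  by rewrite (tauE kN); apply: eq_bigl => i; rewrite inE.
(* A term whose column bounds reach those of [kappa] belongs to [kappa], because dominance then
   holds both ways. *)
have zK z : z \in l -> (forall s, (s <= m)%N -> (tau kappa s <= \sum_(r <- cols k z.2) minn r s)%N) ->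
    z.2 = K.
  move=> zl h; have [zS [zd zk]] := lP z zl.
  apply: (sum_lin_eq km zd zk); rewrite !sum_lin_prefix; apply: eq_bigr => s _.
  apply/eqP; rewrite eqn_leq (dom_prefix km zd zk) /= -(tauE km).
  have [cs _] := preE m km s (ltnW (ltn_ord s)).
  apply: leq_trans (h s (ltnW (ltn_ord s))) _.
  rewrite -{1}cs cols_top//; [|exact: leq_sum_entry|exact: prefix_set_ltn].
  by rewrite [X in (X <= _)%N](eq_bigl (fun i : 'I_m => (i < s)%N)) // => i; rewrite inE.
have K0 N (kN : (size kappa <= N)%N) z : (m <= N)%N -> z \in l ->
    (forall S : {set 'I_N}, \sum_(i in S) part_mnm N kappa i <= \sum_(r <- cols k z.2) minn r #|S|)%N ->
    z.2 = K.
  move=> mN zl h; apply: zK => // s sm; have [cs <-] := preE N kN s (leq_trans sm mN).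
  by rewrite -[in X in (_ <= X)%N]cs; exact: h.
pose e1 := mcoeff K (\prod_(r <- cols k K) elsym_poly R m r).
pose e2 := mcoeff (part_mnm (m + 1) kappa) (moment_map M (\prod_(r <- cols k K) usym_poly R (m + 1) r)).
(* [K] may occur several times in [l]. The same factor governs the coefficient at [kappa] before and
   after integration, so its nonvanishing passes from [C m kappa] to [Q]. *)
pose b := \sum_(z <- l | z.2 == K) z.1.
have c1 : mcoeff K (C m kappa) = b * e1.
  rewrite pE raddf_sum /= mulr_suml [RHS]big_mkcond big_seq [RHS]big_seq; apply: eq_bigr => z zl.
  rewrite mcoeffZ; case: eqP => [->//|zneq].
  rewrite memN_msupp_eq0 ?mulr0//; apply/negP => Kz; apply: zneq; apply: (K0 m km) => // S.
  exact: (@elsym_poly_prod_le R m (cols k z.2) S K Kz).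
have c2 : mcoeff (part_mnm (m + 1) kappa) Q = b * e2.
  rewrite /Q /P [moment_map M _]raddf_sum [mcoeff _ _]raddf_sum /= mulr_suml [RHS]big_mkcond big_seq [RHS]big_seq; apply: eq_bigr => z zl.
  rewrite linearZ /= mcoeffZ; case: eqP => [->//|zneq].
  rewrite memN_msupp_eq0 ?mulr0//; apply/negP => Kz; apply: zneq.
  by apply: (K0 (m + 1)%N kn) => //; [exact: leq_addr|have [] := zsupp z zl _ Kz].
have b0 : b != 0.
  have := mcoeff_part_mnm_jackC km kpart (hC m); rewrite -/K c1.
  by apply: contraNneq => ->; rewrite mul0r.
have Kl : exists2 z, z \in l & z.2 = K.
  apply/not_exists2P => h; case/eqP: b0; rewrite /b big1_seq// => z /andP[/eqP zK' zl].
  by case: (h z).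
have e20 : 0 < e2.
  have [z zl zK'] := Kl; have := lP z zl; rewrite zK' => -[KS [_ Kk]].
  have cn : all (fun r => r < m + 1)%N (cols k K).
    by rewrite addn1; apply/allP => r /(allP (cols_le k K)).
  have [e [eE eP]] := @usym_poly_prod_lead R (m + 1) (cols k K) cn.
  rewrite /e2 (_ : part_mnm (m + 1) kappa = lpart e); last first.
    apply/mnmP => i; rewrite eE part_mnmE; have [im|mi] := ltnP i m.
      have := cols_lead KS (leq_sum_entry Kk) (Ordinal im).
      by rewrite /K part_mnmE /= => <-.
    rewrite nth_default ?(leq_trans km)// big1_seq// => r /andP[_ /(allP (cols_le k K)) rm].
    by rewrite ltnNge (leq_trans rm mi).
  by apply: moment_map_gt0 => //; exact: nonneg_coef_usym_poly_prod.
have QK : mcoeff (part_mnm (m + 1) kappa) Q != 0 by rewrite c2 mulf_neq0// gt_eqF.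
have := jack_unique kn beta0 (jack_suppC kn kpart (hC _)) Qsupp (jackC_eigen kn kpart (hC _)) Qeig QK.
move=> CE; exists (mcoeff (part_mnm (m + 1) kappa) (C (m + 1)%N kappa) / mcoeff (part_mnm (m + 1) kappa) Q) => //.
by rewrite mulf_neq0// ?invr_eq0// (mcoeff_part_mnm_jackC kn kpart (hC _)).
Qed.
End Transfer.

(** [is_arrow] supplies unit eigenvectors one at a time; they form an orthogonal matrix because [A]
    is symmetric with distinct eigenvalues. *)
Lemma is_arrow_elsym (R : realType) m (lambda q : 'rV[R]_(m + 1)) (A : 'M[R]_(m + 1)) :
  injective (lambda 0) -> is_arrow lambda q A ->
  exists mu : 'rV[R]_m, [/\ ulsubmx A = diag_mx mu, injective (mu 0) &
    forall r, elsymT (mu 0) r = usym (lambda 0) (fun i => q 0 i ^+ 2) r].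
Proof.
move=> lI [[mu [c [cn [AE muD c0]]]] hv].
have [v vP] := choice hv.
have ulA : ulsubmx A = diag_mx mu by rewrite AE block_mxKul.
have At : A^T = A.
  by rewrite AE /arrow_mx tr_block_mx trmxK tr_diag_mx tr_scalar_mx.
pose V : 'M[R]_(m + 1) := \matrix_(i, j) v j i 0.
have AV : A *m V = V *m diag_mx lambda.
  apply/matrixP => i j; have [Av _ _] := vP j.
  have := congr1 (fun u : 'cV[R]_(m + 1) => u i 0) Av.
  rewrite mul_mx_diag !mxE mulrC => <-.
  by apply: eq_bigr => k _; rewrite mxE.
have VV : V^T *m V = 1%:M.
  apply/matrixP => i j; rewrite [RHS]mxE.
  have [<-{j}|ij] := eqVneq i j.
    by have [_ <- _] := vP i; rewrite !mxE; apply: eq_bigr => k _; rewrite !mxE expr2.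
  have : lambda 0 i * (V^T *m V) i j = lambda 0 j * (V^T *m V) i j.
    have e1 : V^T *m A *m V = diag_mx lambda *m (V^T *m V).
      by rewrite -[in LHS]At -trmx_mul AV trmx_mul tr_diag_mx mulmxA.
    have e2 : V^T *m A *m V = V^T *m V *m diag_mx lambda.
      by rewrite -mulmxA AV mulmxA.
    have := congr1 (fun N : 'M[R]_(m + 1) => N i j) (etrans (esym e1) e2).
    by rewrite mul_diag_mx mul_mx_diag ![(\matrix_(_, _) _) _ _]mxE => ->; rewrite mulrC.
  move/eqP; rewrite -subr_eq0 -mulrBl mulf_eq0 subr_eq0 (inj_eq lI) (negbTE ij) /=.
  by move/eqP.
exists mu; split=> // [i j|r].
  move=> e; apply/eqP; rewrite -val_eqE /=; case: ltngtP => // ij.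
    by have := muD _ _ ij; rewrite e ltxx.
  by have := muD _ _ ij; rewrite e ltxx.
rewrite (arrow_usym ulA AV VV); apply: eq_bigr => i _; rewrite mxE.
by have [_ _ ->] := vP i.
Qed.

(** * Dirichlet integrals on the sphere *)

Section UnitIntervalFTC.
Local Open Scope classical_set_scope.
Variable R : realType.
Notation mu := (@lebesgue_measure R).
Implicit Types (f F : R -> R).

(** The shift by 3 gives [a_ k < 1 - a_ k] already at [k = 0]. *)
Let a_ (k : nat) : R := k.+3%:R^-1.
Let b_ k : R := 1 - a_ k.

Let a_gt0 k : 0 < a_ k. Proof. by rewrite invr_gt0. Qed.

Let a_lt_b k : a_ k < b_ k.
Proof.
rewrite /b_ ltrBrDl -mulr2n -mulr_natr /a_ mulrC ltr_pdivrMr// mul1r ltr_nat.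
by [].
Qed.

Let a_decr j k : (j <= k)%N -> a_ k <= a_ j.
Proof. by move=> jk; rewrite /a_ lef_pV2 ?posrE// ler_nat. Qed.

Let a_cvg : a_ k @[k --> \oo] --> (0 : R).
Proof.
have := @cvg_harmonic R; rewrite -(cvg_shiftn 2).
by under eq_fun do rewrite addn2.
Qed.

Let oo_bigcup : `]0, 1[%classic = \bigcup_k `[a_ k, b_ k]%classic :> set R.
Proof.
apply/seteqP; split=> x /=; last first.
  move=> [k _ /=]; rewrite !in_itv/= => /andP[ax xb].
  by rewrite (lt_le_trans (a_gt0 k) ax)/= (le_lt_trans xb)// ltrBlDr ltrDl.
rewrite in_itv/= => /andP[x0 x1].
have [k hk] : exists k, a_ k < Num.min x (1 - x).
  have m0 : 0 < Num.min x (1 - x) by rewrite lt_min x0 subr_gt0.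
  have [N _ hN] := near_infty_natSinv_lt (PosNum m0).
  exists N; apply: le_lt_trans (hN N.+2 _); last by rewrite /= !leqW.
  exact: lexx.
exists k => //=; move: hk; rewrite lt_min => /andP[/ltW k1 k2].
by rewrite in_itv/= k1 /b_ lerBrDl -lerBrDr ltW.
Qed.

Let nd_itv : nondecreasing_seq (fun k => `[a_ k, b_ k]%classic : set R).
Proof.
move=> j k jk; apply/subsetPset => x /=; rewrite !in_itv/= => /andP[ax xb].
rewrite (le_trans (a_decr jk) ax)/= (le_trans xb)// lerB//.
exact: a_decr.
Qed.

Lemma cvg_integral_oo f : (forall x, 0 < x < 1 -> 0 <= f x) -> measurable_fun setT f ->
  (\int[mu]_(x in `[a_ k, b_ k]) (f x)%:E)%E @[k --> \oo] --> (\int[mu]_(x in `]0%R, 1%R[) (f x)%:E)%E.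
Proof.
move=> f0 mf; rewrite oo_bigcup.
apply: (@ge0_nondecreasing_set_cvg_integral _ (measurableTypeR R) R
  (fun k => `[a_ k, b_ k]%classic) (EFin \o f) mu nd_itv) => // k.
- by apply/measurable_EFinP; exact: measurable_funTS.
- move=> x abx; rewrite /= lee_fin f0//.
  suff : `]0, 1[%classic x by rewrite /= in_itv.
  by rewrite oo_bigcup; exists k.
Qed.

(** Either integral might be infinite, so the identity is stated without subtraction and for
    nonnegative integrands. It is the limit, by monotone convergence, of the usual one on
    [[a_ k, b_ k]]. *)
Lemma FTC_oo01 f1 f2 F (l0 l1 : R) :
  (forall x : R, 0 < x < 1 -> 0 <= f1 x) -> (forall x : R, 0 < x < 1 -> 0 <= f2 x) ->
  measurable_fun setT f1 -> measurable_fun setT f2 ->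
  (forall x : R, 0 < x < 1 -> {for x, continuous f1}) ->
  (forall x : R, 0 < x < 1 -> {for x, continuous f2}) ->
  (forall x : R, 0 < x < 1 -> is_derive x 1 F (f1 x - f2 x)) ->
  F x @[x --> 0^'+] --> l0 -> F x @[x --> 1^'-] --> l1 ->
  (\int[mu]_(x in `]0%R, 1%R[) (f1 x)%:E + l0%:E = \int[mu]_(x in `]0%R, 1%R[) (f2 x)%:E + l1%:E)%E.
Proof.
move=> f10 f20 mf1 mf2 cf1 cf2 dF Fl0 Fl1.
have ab01 k (x : R) : a_ k <= x <= b_ k -> 0 < x < 1.
  move=> xab; suff : `]0, 1[%classic x by rewrite /= in_itv.
  rewrite oo_bigcup; exists k => //=; rewrite in_itv.
have within f k : (forall x : R, 0 < x < 1 -> {for x, continuous f}) ->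
    {within `[a_ k, b_ k], continuous f}.
  move=> cf; apply: continuous_in_subspaceT => x /[!inE] /= xab.
  by apply/cf/(ab01 k); rewrite in_itv in xab.
have intf f k : (forall x : R, 0 < x < 1 -> {for x, continuous f}) ->
    mu.-integrable `[a_ k, b_ k] (EFin \o f).
  by move=> cf; apply: continuous_compact_integrable; [exact: segment_compact|exact: within].
have Fc (x : R) : 0 < x < 1 -> {for x, continuous F}.
  move=> /dF[dFx _]; exact/differentiable_continuous/derivable1_diffP.
have E k : (\int[mu]_(x in `[a_ k, b_ k]) (f1 x)%:E + (F (a_ k))%:E =
            \int[mu]_(x in `[a_ k, b_ k]) (f2 x)%:E + (F (b_ k))%:E)%E.
  have a01 : 0 < a_ k < 1 by apply: (ab01 k); rewrite lexx ltW.
  have b01 : 0 < b_ k < 1 by apply: (ab01 k); rewrite lexx ltW.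
  have cfB (x : R) : 0 < x < 1 -> {for x, continuous (f1 \- f2)}.
    by move=> x01; apply: cvgB; [exact: cf1|exact: cf2].
  have dLR : derivable_oo_LRcontinuous F (a_ k) (b_ k).
    split.
    - move=> x xab; have : 0 < x < 1.
        by apply: (ab01 k); move: xab; rewrite in_itv/= => /andP[/ltW -> /ltW ->].
      by move=> /dF[].
    - exact/cvg_at_right_filter/Fc.
    - exact/cvg_at_left_filter/Fc.
  have F' : {in `]a_ k, b_ k[%R, F^`() =1 f1 \- f2}.
    move=> x xab; have : 0 < x < 1.
      by apply: (ab01 k); move: xab; rewrite in_itv/= => /andP[/ltW -> /ltW ->].
    by move=> /dF[_]; rewrite derive1E.
  have := continuous_FTC2 (a_lt_b k) (within _ k cfB) dLR F'.
  rewrite integralB_EFin//; [|exact: intf|exact: intf].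
  have mI : measurable (`[a_ k, b_ k]%classic : set (measurableTypeR R)).
    exact: measurable_itv.
  have := integrable_fin_num mI (intf _ k cf1); have := integrable_fin_num mI (intf _ k cf2).
  move: (\int[mu]_(x in _) (f1 x)%:E)%E (\int[mu]_(x in _) (f2 x)%:E)%E => u v.
  move: u v => [u| |] [v| |] //= _ _ [] uv; congr EFin.
  by rewrite -[u](subrK v) uv; ring.
have c1 : (\int[mu]_(x in `[a_ k, b_ k]) (f1 x)%:E + (F (a_ k))%:E)%E @[k --> \oo] -->
    (\int[mu]_(x in `]0%R, 1%R[) (f1 x)%:E + l0%:E)%E.
  apply: cvgeD; [by rewrite fin_num_adde_defl|exact: cvg_integral_oo|].
  apply/cvg_EFin; first exact: nearW.
  by move/cvg_at_rightP : Fl0; apply; split.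
have c2 : (\int[mu]_(x in `[a_ k, b_ k]) (f2 x)%:E + (F (b_ k))%:E)%E @[k --> \oo] -->
    (\int[mu]_(x in `]0%R, 1%R[) (f2 x)%:E + l1%:E)%E.
  apply: cvgeD; [by rewrite fin_num_adde_defl|exact: cvg_integral_oo|].
  apply/cvg_EFin; first exact: nearW.
  move/cvg_at_leftP : Fl1; apply; split=> [k|]; first by rewrite ltrBlDr ltrDl.
  by rewrite -[X in _ --> X]subr0; apply: cvgB => //; exact: cvg_cst.
move: c1; rewrite (funext E) => c1.
exact: (cvg_unique (@ereal_hausdorff R) c1 c2).
Qed.
End UnitIntervalFTC.

(** * Beta integrals in the variable q *)

Section BetaIntegral.
Local Open Scope classical_set_scope.
Variable R : realType.
Notation mu := (@lebesgue_measure R).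
Implicit Types (p s x : R).

Definition beta_kernel p s x : R := x `^ (p - 1) * (1 - x ^+ 2) `^ (s - 1).

Let I01 : set (measurableTypeR R) := `]0, 1[%classic.

(** The substitution t = x^2 makes it half of Euler's B(p/2, s). *)
Definition beta_integral p s : \bar R := (\int[mu]_(x in I01) (beta_kernel p s x)%:E)%E.

Let mI01 : measurable I01. Proof. exact: measurable_itv. Qed.

Let I01P x : I01 x -> 0 < x < 1. Proof. by rewrite /I01 /= in_itv. Qed.

Lemma beta_kernel_ge0 p s x : 0 <= beta_kernel p s x.
Proof. by rewrite mulr_ge0// powR_ge0. Qed.

Lemma measurable_beta_kernel p s : measurable_fun setT (beta_kernel p s).
Proof.
apply: measurable_funM; first exact: measurable_powR.
have m1 : measurable_fun [set: R] (fun x : R => 1 - x ^+ 2).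
  by apply: measurable_funB => //; exact: exprn_measurable.
exact: (measurableT_comp (measurable_powR (s - 1)) m1).
Qed.

Let mE (f : R -> R) : measurable_fun [set: R] f -> measurable_fun I01 (EFin \o f).
Proof. by move=> mf; apply/measurable_EFinP; exact: measurable_funTS. Qed.

Lemma is_derive_1Bsqr_powR a x : 0 < x < 1 ->
  is_derive x 1 (fun z : R => (1 - z ^+ 2) `^ a) (- (2 * x) * (a * (1 - x ^+ 2) `^ (a - 1))).
Proof.
move=> /andP[x0 x1].
have d0 : 0 < 1 - x ^+ 2 by rewrite subr_gt0 exprn_ilt1// ltW.
have h1 : is_derive x 1 (fun z : R => 1 - z ^+ 2) (- (2 * x)).
  by apply: is_derive_eq; rewrite -[x%:A]/(x * 1); ring.
have h2 := @is_derive1_powR R a _ d0.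
have := @is_derive1_comp R (fun y : R => y `^ a) (fun z : R => 1 - z ^+ 2) x _ _ h2 h1.
by rewrite mulrC.
Qed.

Let cont_derive (f : R -> R) x d : is_derive x 1 f d -> {for x, continuous f}.
Proof. by case=> df _; exact/differentiable_continuous/derivable1_diffP. Qed.

Let cont_powR a x : 0 < x -> {for x, continuous (fun y : R => y `^ a)}.
Proof. by move=> x0; apply: cont_derive; exact: is_derive1_powR. Qed.

Lemma continuous_beta_kernel p s x : 0 < x < 1 -> {for x, continuous (beta_kernel p s)}.
Proof.
move=> x01; apply: cvgM; first by apply: cont_powR; case/andP: x01.
exact: (cont_derive (is_derive_1Bsqr_powR _ x01)).
Qed.

(** Derivative of x^p (1 - x^2)^s, which vanishes at both ends. It is stated in the extended reals
    because finiteness is deduced from it. *)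
Lemma beta_integral_ibp p s : 0 < p -> 0 < s ->
  (p%:E * beta_integral p (s + 1) = (2 * s)%:E * beta_integral (p + 2) s)%E.
Proof.
move=> p0 s0.
have Z a q r : 0 <= a -> (a%:E * beta_integral q r = \int[mu]_(x in I01) (a * beta_kernel q r x)%:E)%E.
  move=> a0; under [RHS]eq_integral do rewrite EFinM.
  rewrite ge0_integralZl_EFin//.
  - by move=> x _; rewrite lee_fin beta_kernel_ge0.
  - exact: (mE (measurable_beta_kernel q r)).
have s20 : 0 <= 2 * s by rewrite mulr_ge0// ltW.
rewrite (Z _ _ _ (ltW p0)) (Z _ _ _ s20).
pose F x := x `^ p * (1 - x ^+ 2) `^ s.
have := @FTC_oo01 R (fun x => p * beta_kernel p (s + 1) x) (fun x => (2 * s) * beta_kernel (p + 2) s x) F 0 0.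
rewrite adde0 adde0; apply.
- by move=> x _; rewrite mulr_ge0 ?beta_kernel_ge0// ltW.
- by move=> x _; rewrite mulr_ge0 ?beta_kernel_ge0// mulr_ge0// ltW.
- by apply: measurable_funM => //; exact: measurable_beta_kernel.
- by apply: measurable_funM => //; exact: measurable_beta_kernel.
- by move=> x x01; apply: cvgM; [exact: cvg_cst|exact: continuous_beta_kernel].
- by move=> x x01; apply: cvgM; [exact: cvg_cst|exact: continuous_beta_kernel].
- move=> x x01; have [x0 x1] := andP x01.
  have h1 := @is_derive1_powR R p _ x0; have h2 := is_derive_1Bsqr_powR s x01.
  have hF : is_derive x 1 F _ := is_deriveM h1 h2.
  apply: (is_derive_eq hF).
  rewrite /GRing.scale /= /beta_kernel addrK (_ : p + 2 - 1 = p + 1); last by ring.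
  have -> : x `^ (p + 1) = x `^ p * x.
    by rewrite powRD ?powRr1 ?(ltW x0)// (gt_eqF x0) implybT.
  by ring.
- rewrite -[X in _ --> X](mul0r 1); apply: cvgM; first exact: powR_cvg0.
  have e1 : (1 - 0 ^+ 2) `^ s = 1 :> R by rewrite expr0n subr0 powR1.
  apply: cvg_at_right_filter; rewrite -[X in _ --> X]e1.
  apply: (@continuous_cvg _ _ _ (nbhs (0 : R)) _ (fun x : R => 1 - x ^+ 2) (fun y : R => y `^ s)).
    by apply: cont_powR; rewrite expr0n subr0.
  by apply: cvgB; [exact: cvg_cst|exact: exprn_continuous].
- rewrite -[X in _ --> X](mulr0 (1 `^ p)); apply: cvgM.
    by apply: cvg_at_left_filter; exact: cont_powR.
  (* The limit of the power is taken from the right of 0, so the approach through positive values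
     has to be recorded. *)
  have h : (fun x : R => 1 - x ^+ 2) @ 1^'- --> 0^'+.
    have h0 : 1 - x ^+ 2 @[x --> 1^'-] --> (0 : R).
      rewrite -[X in _ --> X](subrr 1) -[X in _ --> _ - X](expr1n R 2).
      by apply: cvg_at_left_filter; apply: cvgB; [exact: cvg_cst|exact: exprn_continuous].
    move=> A /= [e e0 eA].
    have he : \forall x \near 1^'-, `|0 - (1 - x ^+ 2)| < e.
      by move/cvgrPdist_lt : h0; apply.
    suff : \forall x \near 1^'-, A (1 - x ^+ 2) by [].
    near=> x.
    have x0 : 0 <= x by near: x; exact: nbhs_left_ge.
    have x1 : x < 1 by near: x; exact: nbhs_left_lt.
    have xe : `|0 - (1 - x ^+ 2)| < e by near: x.
    by apply: eA => //=; rewrite subr_gt0 exprn_ilt1.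
  exact: (cvg_comp (fun x : R => 1 - x ^+ 2) (fun y : R => y `^ s) h (powR_cvg0 s0)).
Unshelve. all: by end_near.
Qed.

Lemma beta_integral_add p s : beta_integral p s = (beta_integral (p + 2) s + beta_integral p (s + 1))%E.
Proof.
rewrite /beta_integral -ge0_integralD//.
- apply: eq_integral => x /[!inE] /I01P /andP[x0 x1]; rewrite -EFinD; congr EFin.
  have d0 : 0 < 1 - x ^+ 2 by rewrite subr_gt0 exprn_ilt1// ltW.
  rewrite /beta_kernel addrK (_ : p + 2 - 1 = p - 1 + 2); last by ring.
  rewrite (powRD (r := p - 1)); last by rewrite (gt_eqF x0) implybT.
  rewrite -[X in _ + _ * (_ `^ X)](subrK 1) (powRD (r := s - 1)); last by rewrite (gt_eqF d0) implybT.
  rewrite (powR_mulrn 2 (ltW x0)) (powRr1 (ltW d0)).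
  ring.
- by move=> x _; rewrite lee_fin beta_kernel_ge0.
- exact: (mE (measurable_beta_kernel (p + 2) s)).
- by move=> x _; rewrite lee_fin beta_kernel_ge0.
- exact: (mE (measurable_beta_kernel p (s + 1))).
Qed.

(** With the exponent raised by 1, the factor in 1 - x^2 is at most 1, and x^(p-1) has integral
    1/p. *)
Lemma beta_integral_lty p s : 0 < p -> 0 < s -> (beta_integral p (s + 1) < +oo)%E.
Proof.
move=> p0 s0.
have e : (\int[mu]_(x in I01) (p * x `^ (p - 1))%:E = 1%:E)%E.
  have mp : measurable_fun setT (fun x : R => p * x `^ (p - 1)).
    by apply: measurable_funM => //; exact: measurable_powR.
  have := @FTC_oo01 R (fun x => p * x `^ (p - 1)) (fun=> 0) (fun x => x `^ p) 0 1.
  rewrite adde0 integral0 add0e; apply => //.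
  - by move=> x _; rewrite mulr_ge0 ?powR_ge0// ltW.
  - by move=> x /andP[x0 _]; apply: cvgM; [exact: cvg_cst|exact: cont_powR].
  - by move=> x _; exact: cvg_cst.
  - by move=> x /andP[x0 _]; rewrite subr0; exact: is_derive1_powR.
  - exact: powR_cvg0.
  - have e1 : 1 `^ p = 1 :> R by rewrite powR1.
    rewrite -[X in _ --> X]e1; apply: cvg_at_left_filter; exact: cont_powR.
have le : (p%:E * beta_integral p (s + 1) <= 1%:E)%E.
  rewrite -e /beta_integral -ge0_integralZl_EFin//; last 3 first.
  - by move=> x _; rewrite lee_fin beta_kernel_ge0.
  - exact: (mE (measurable_beta_kernel p (s + 1))).
  - exact: (ltW p0).
  apply: ge0_le_integral => //.
  - by move=> x _; rewrite -EFinM lee_fin mulr_ge0 ?beta_kernel_ge0// ltW.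
  - apply: (measurable_funeM p%:E); exact: (mE (measurable_beta_kernel p (s + 1))).
  - apply: (@mE (fun x : R => p * x `^ (p - 1))).
    by apply: measurable_funM => //; exact: measurable_powR.
  move=> x /I01P /andP[x0 x1]; rewrite -EFinM lee_fin ler_pM2l// /beta_kernel addrK.
  rewrite ler_piMr ?powR_ge0//.
  have d0 : 0 <= 1 - x ^+ 2 by rewrite subr_ge0 exprn_ile1// ltW.
  have e1 : 1 `^ s = 1 :> R by rewrite powR1.
  rewrite -[leRHS]e1; apply: ge0_ler_powR; rewrite ?nnegrE// ?ltW//.
  by rewrite ltrBlDr ltrDl exprn_gt0.
have b0 : (0 <= beta_integral p (s + 1))%E by apply: integral_ge0 => x _; rewrite lee_fin beta_kernel_ge0.
move: le b0; case: (beta_integral p (s + 1)) => [r| |] //=; first by rewrite ltry.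
by rewrite mulry gtr0_sg// mul1e.
Qed.

(** [beta_integral_add] splits the integral into a finite one and one that is a multiple of it by
    [beta_integral_ibp]. *)
Lemma beta_integral_fin_num p s : 0 < p -> 0 < s -> beta_integral p s \is a fin_num.
Proof.
move=> p0 s0; have b0 q r : (0 <= beta_integral q r)%E.
  by apply: integral_ge0 => x _; rewrite lee_fin beta_kernel_ge0.
have h1 : beta_integral p (s + 1) \is a fin_num by rewrite ge0_fin_numE// beta_integral_lty.
rewrite beta_integral_add fin_numD h1 andbT.
have := beta_integral_ibp p0 s0; move: h1 (b0 (p + 2) s).
case: (beta_integral p (s + 1)) => // u _; case: (beta_integral (p + 2) s) => // _.
by rewrite mulry gtr0_sg ?mulr_gt0// mul1e.
Qed.

Definition beta_fun p s : R := fine (beta_integral p s).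

Lemma beta_integralE p s : 0 < p -> 0 < s -> beta_integral p s = (beta_fun p s)%:E.
Proof. by move=> p0 s0; rewrite /beta_fun fineK// beta_integral_fin_num. Qed.

Lemma beta_fun_gt0 p s : 0 < p -> 0 < s -> 0 < beta_fun p s.
Proof.
move=> p0 s0; rewrite lt_neqAle; apply/andP; split; last first.
  by apply: fine_ge0; apply: integral_ge0 => x _; rewrite lee_fin beta_kernel_ge0.
apply/eqP => b0.
have : (\int[mu]_(x in I01) `|(EFin \o beta_kernel p s) x| = 0)%E.
  rewrite -[RHS]/(0%R%:E) b0 -beta_integralE//; apply: eq_integral => x _.
  by rewrite /= ger0_norm// beta_kernel_ge0.
move/(ae_eq_integral_abs mu mI01 (mE (measurable_beta_kernel p s))).
move=> [N [mN N0 sub]].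
have : (mu I01 <= mu N)%E.
  apply: le_measure; rewrite ?inE// => x xI; apply: sub => /= h.
  have /andP[x0 x1] := I01P xI; have := h xI; apply/eqP.
  by rewrite eqe mulf_eq0 !gt_eqF// powR_gt0// subr_gt0 exprn_ilt1// ltW.
by rewrite N0 lebesgue_measure_itv /= lte_fin ltr01 sube0 lee_fin ler10.
Qed.

Lemma beta_fun_rec p s : 0 < p -> 0 < s ->
  beta_fun (p + 2) s = p / (p + 2 * s) * beta_fun p s /\
  beta_fun p (s + 1) = 2 * s / (p + 2 * s) * beta_fun p s.
Proof.
move=> p0 s0; have p20 : 0 < p + 2 by rewrite addr_gt0.
have s10 : 0 < s + 1 by rewrite addr_gt0.
have ps0 : p + 2 * s != 0 by rewrite gt_eqF// addr_gt0// mulr_gt0.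
have := beta_integral_ibp p0 s0; have := beta_integral_add p s; rewrite !beta_integralE//.
move=> [->] [h]; set a := beta_fun (p + 2) s in h *; set b := beta_fun p (s + 1) in h *.
split; apply: (mulIf ps0); rewrite mulrAC divfK//; last first.
  by transitivity (p * b + 2 * s * b); [|rewrite h]; ring.
by transitivity (p * a + 2 * s * a); [|rewrite -h]; ring.
Qed.

End BetaIntegral.

Section Scaling.
Local Open Scope classical_set_scope.
Variable R : realType.
Notation mu := (@lebesgue_measure R).

(** By uniqueness on half-open intervals, Lebesgue measure is [r] times its image under
    multiplication by [r]. *)
Lemma ge0_integral_scale (r s : R) (f : R -> R) : 0 < r -> measurable_fun setT f ->
  (forall x, 0 <= f x) ->
  (\int[mu]_(x in (`]0%R, (r * s)%R[%classic : set (measurableTypeR R))) (f x)%:E =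
   r%:E * \int[mu]_(x in (`]0%R, s[%classic : set (measurableTypeR R))) (f (r * x)%R)%:E)%E.
Proof.
move=> r0 mf f0.
pose phi : measurableTypeR R -> measurableTypeR R := fun x => r * x.
have mphi : measurable_fun setT phi by exact: measurable_funM.
have phiK (b b' : bool) (u v : R) : phi @^-1` [set` Interval (BSide b (r * u)) (BSide b' (r * v))] = [set` Interval (BSide b u) (BSide b' v)].
  by apply/seteqP; split => x /=; rewrite !itv_boundlr /=; case: b; case: b'; rewrite !bnd_simp /phi ?(ler_pM2l r0) ?(ltr_pM2l r0).
pose nu0 : {measure set (measurableTypeR R) -> \bar R} := pushforward mu phi.
pose k : {nonneg R} := NngNum (ltW r0).
pose nu := mscale k (nu0 mphi).
have nuE A : measurable A -> mu A = nu A.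
  apply: lebesgue_measure_unique => X -[[a b] _ <-].
  rewrite [RHS](_ : _ = (r%:E * mu (phi @^-1` `]a, b]))%E)//.
  have -> : a = r * (a / r) by rewrite mulrC divfK// gt_eqF.
  have -> : b = r * (b / r) by rewrite mulrC divfK// gt_eqF.
  rewrite phiK; set u := a / r; set v := b / r.
  have muE (x y : R) : mu (`]x, y]%classic) = (if (x < y)%R then (y - x)%R%:E else 0)%E.
    by rewrite lebesgue_measure_itv /= lte_fin -EFinB.
  apply: (etrans (muE _ _)); rewrite (muE u v) ltr_pM2l//.
  by case: ifP => // _; [rewrite -EFinM mulrBr|rewrite mule0].
rewrite (@eq_measure_integral _ _ _ _ nu); last by move=> A mA _; exact: nuE.
have mI (a b : R) : measurable (`]a, b[%classic : set (measurableTypeR R)) by exact: measurable_itv.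
have mEf (D : set (measurableTypeR R)) : measurable_fun D (fun x => (f x)%:E).
  by apply/measurable_EFinP; exact: measurable_funTS.
rewrite ge0_integral_mscale//; last by move=> x _; rewrite lee_fin.
congr (_ * _)%E.
rewrite (ge0_integral_pushforward mphi)//; last by move=> x _; rewrite lee_fin.
by rewrite -{1}[0](mulr0 r) phiK.
Qed.

Lemma integral_beta_kernel_scale (S p s : R) : 0 < S -> 0 < p -> 0 < s ->
  (\int[mu]_(x in (`]0%R, (Num.sqrt S)[%classic : set (measurableTypeR R)))
     (x `^ (p - 1) * (S - x ^+ 2) `^ (s - 1))%:E = (S `^ (p / 2 + s - 1) * beta_fun p s)%:E)%E.
Proof.
move=> S0 p0 s0; set r := Num.sqrt S.
have r0 : 0 < r by rewrite sqrtr_gt0.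
have rS : S = r ^+ 2 by rewrite sqr_sqrtr// ltW.
rewrite -{1}[r]mulr1 ge0_integral_scale//; last 2 first.
- apply: measurable_funM; first exact: measurable_powR.
  have m1 : measurable_fun [set: R] (fun x : R => S - x ^+ 2).
    by apply: measurable_funB => //; exact: exprn_measurable.
  exact: (measurableT_comp (measurable_powR (s - 1)) m1).
- by move=> x; rewrite mulr_ge0// powR_ge0.
transitivity (r%:E * \int[mu]_(x in (`]0%R, 1%R[%classic : set (measurableTypeR R))) ((r `^ (p - 1) * S `^ (s - 1))%:E * (beta_kernel p s x)%:E))%E.
  congr (_ * _)%E; apply: eq_integral => x; rewrite inE /= in_itv /= => /andP[x0 x1].
  rewrite -EFinM; congr EFin; rewrite /beta_kernel (powRM _ (ltW r0) (ltW x0)).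
  have -> : S - (r * x) ^+ 2 = S * (1 - x ^+ 2) by rewrite exprMn -rS; ring.
  rewrite powRM ?(ltW S0)//; first by ring.
  by rewrite subr_ge0 exprn_ile1// ltW.
rewrite ge0_integralZl_EFin//; last 3 first.
- by move=> x _; rewrite lee_fin beta_kernel_ge0.
- by apply/measurable_EFinP; apply: measurable_funTS; exact: measurable_beta_kernel.
- by rewrite mulr_ge0// powR_ge0.
rewrite [X in (_ * (_ * X))%E](beta_integralE p0 s0) -!EFinM mulrA; congr ((_ * _)%:E).
have -> : S `^ (p / 2 + s - 1) = S `^ (p / 2) * S `^ (s - 1).
  by rewrite -addrA [LHS]powRD// (gt_eqF S0) implybT.
rewrite mulrA; congr (_ * _).
rewrite -{1}(powRr1 (ltW r0)) -powRD; last by rewrite (gt_eqF r0) implybT.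
rewrite addrCA subrr addr0 /r -(powR12_sqrt (ltW S0)) -powRrM.
by congr (_ `^ _); field.
Qed.
End Scaling.

(** * Dirichlet integrals over the positive part of a ball *)

Section Dirichlet.
Local Open Scope classical_set_scope.
Variable R : realType.
Local Notation TR := (measurableTypeR R).

Definition pos_ball m (S : R) : set (m.-tuple TR) :=
  [set t : m.-tuple TR | (forall i, 0 < tnth t i) /\ \sum_i tnth t i ^+ 2 < S]%R.

(** The squared radius [S] varies because fixing the first coordinate at [x] leaves a ball of
    squared radius [S - x ^+ 2]. *)
Definition dirichlet_weight m (p : 'I_m -> R) (s S : R) (t : m.-tuple TR) : R :=
  \prod_i tnth t i `^ (p i - 1) * (S - \sum_i tnth t i ^+ 2) `^ (s - 1).

(** Integrating out all coordinates but the first raises [s] by half the sum of their [p]. In Gamma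
    functions the product telescopes to 2^-m prod_i Gamma(p_i/2) Gamma(s) / Gamma(sum_i p_i/2 +
    s). *)
Fixpoint dirichlet_const m : ('I_m -> R) -> R -> R :=
  match m with
  | 0 => fun _ _ => 1
  | m'.+1 => fun p s => beta_fun (p ord0) ((\sum_i p (lift ord0 i)) / 2 + s) * dirichlet_const (p \o lift ord0) s
  end.

Lemma dirichlet_weight_ge0 m (p : 'I_m -> R) s S t : 0 <= dirichlet_weight p s S t.
Proof. by rewrite mulr_ge0 ?powR_ge0// prodr_ge0// => i _; exact: powR_ge0. Qed.

Lemma measurable_sumsq m : measurable_fun setT (fun t : m.-tuple TR => \sum_i tnth t i ^+ 2 : R).
Proof.
apply: measurable_sum => i.
have h : measurable_fun [set: TR] (fun x : R => x ^+ 2) by exact: exprn_measurable.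
exact: (measurableT_comp h (measurable_tnth i)).
Qed.

Lemma measurable_dirichlet_weight m (p : 'I_m -> R) s S : measurable_fun setT (dirichlet_weight p s S).
Proof.
apply: measurable_funM.
  apply: measurable_prod => i _.
  exact: (measurableT_comp (measurable_powR (p i - 1)) (measurable_tnth i)).
apply: (measurableT_comp (measurable_powR (s - 1))).
by apply: measurable_funB => //; exact: measurable_sumsq.
Qed.

Lemma measurable_pos_ball m S : measurable (@pos_ball m S).
Proof.
have -> : @pos_ball m S = (\bigcap_(i in [set: 'I_m]) ((fun t : m.-tuple TR => tnth t i) @^-1` `]0%R, +oo[))
   `&` ((fun t : m.-tuple TR => \sum_i tnth t i ^+ 2 : R) @^-1` `]-oo, S[).
  apply/seteqP; split=> t [/= h0 h1]; split => /=; rewrite ?in_itv//=.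
    by move=> i _ /=; rewrite in_itv /= h0.
  by move=> i; have := h0 i I; rewrite /= in_itv /= andbT.
apply: measurableI; last by rewrite -[X in measurable X]setTI; apply: measurable_sumsq.
apply: fin_bigcap_measurable => // i _.
by rewrite -[X in measurable X]setTI; apply: measurable_tnth.
Qed.

Lemma dirichlet_const_gt0 m (p : 'I_m -> R) s : (forall i, 0 < p i) -> 0 < s -> 0 < dirichlet_const p s.
Proof.
elim: m p => [|m IH] p p0 s0 //=.
rewrite mulr_gt0 ?IH//; last by move=> i; exact: p0.
by rewrite beta_fun_gt0// ltr_wpDl// divr_ge0// sumr_ge0// => i _; exact: ltW.
Qed.

Lemma dirichlet_integral m (p : 'I_m -> R) (s S : R) :
  0 < S -> (forall i, 0 < p i) -> 0 < s ->
  (\int[@lebesgue_tuple R m]_(t in @pos_ball m S) (dirichlet_weight p s S t)%:E =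
   (S `^ ((\sum_i p i) / 2 + s - 1) * dirichlet_const p s)%:E)%E.
Proof.
elim: m p S => [|m IH] p S S0 p0 s0.
  rewrite /= integral_dirac; last 2 first.
  - exact: measurable_pos_ball.
  - by apply/measurable_EFinP; apply: measurable_funTS; exact: measurable_dirichlet_weight.
  rewrite diracE mem_set ?mul1e; last by split; [case|rewrite big_ord0].
  by rewrite /dirichlet_weight !big_ord0 subr0 mul0r add0r mul1r mulr1.
have [mu muE] := lebesgue_tuple_measure R m.
set p' := p \o lift ord0; set s' := (\sum_i p' i) / 2 + s.
have p'0 i : 0 < p' i by exact: p0.
have s'0 : 0 < s' by rewrite ltr_wpDl// divr_ge0// sumr_ge0// => i _; exact: ltW.
set D := @pos_ball m.+1 S.
(* Extension by 0 moves the dependence of the slices on [x] from the domain to the integrand, as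
   Tonelli's theorem requires. *)
pose f := (fun t => (dirichlet_weight p s S t)%:E) \_ D.
have mf : measurable_fun setT f.
  apply/(measurable_restrictT _ _).1 => //; first exact: measurable_pos_ball.
  by apply/measurable_EFinP; apply: measurable_funTS; exact: measurable_dirichlet_weight.
have f0 t : (0 <= f t)%E by apply: erestrict_ge0 => u _; rewrite lee_fin dirichlet_weight_ge0.
have -> : @lebesgue_tuple R m.+1 = cons_measure mu by rewrite /= -muE.
rewrite integral_mkcond -/f.
have E1 := @ge0_integral_pushforward _ _ _ _ R _ (@measurable_tcons R m) (product_measure1 (@lebesgue_measure R) mu) setT f measurableT mf (fun t _ => f0 t).
apply: (etrans E1).
rewrite preimage_setT fubini_tonelli1/=; last 2 first.
- by apply: (measurableT_comp mf); exact: measurable_tcons.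
- by move=> t; exact: f0.
pose I := `]0%R, (Num.sqrt S)[%classic : set TR.
have mI : measurable I by exact: measurable_itv.
(* The inner integral is the induction hypothesis at squared radius [S - x ^+ 2]; it is 0 when the
   slice is empty. *)
have key x : (fubini_F mu (f \o @tcons R m) x =
   ((fun x => (dirichlet_const p' s)%:E * (x `^ (p ord0 - 1) * (S - x ^+ 2) `^ (s' - 1))%:E) \_ I) x)%E.
  have bE y : pos_ball S (tcons (x, y)) <-> 0 < x /\ pos_ball (S - x ^+ 2) y.
    have eS : \sum_i tnth (tcons (x, y)) (lift ord0 i) ^+ 2 = \sum_i tnth y i ^+ 2.
      by apply: eq_bigr => i _; rewrite tnthS.
    rewrite /pos_ball /= big_ord_recl /= eS; split.
      move=> [h0 h1]; split; first exact: (h0 ord0).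
      split; first by move=> i; have := h0 (lift ord0 i); rewrite tnthS.
      by rewrite ltrBrDl.
    move=> [x0 [h0 h1]]; split.
      by move=> i; case: (unliftP ord0 i) => [j|] ->; rewrite ?tnthS.
    by rewrite -ltrBrDl.
  rewrite /fubini_F patchE; case: ifPn => [|xI].
    rewrite inE /I /= in_itv /= => /andP[x0 xS].
    have S'0 : 0 < S - x ^+ 2.
      by rewrite subr_gt0 -[ltRHS](sqr_sqrtr (ltW S0)) ltr_pXn2r// nnegrE ?sqrtr_ge0// ltW.
    have e y : f (tcons (x, y)) = ((fun y => (x `^ (p ord0 - 1))%:E * (dirichlet_weight p' s (S - x ^+ 2) y)%:E) \_ (pos_ball (S - x ^+ 2)))%E y.
      rewrite /f !patchE.
      have -> : (tcons (x, y) \in D) = (y \in pos_ball (S - x ^+ 2)).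
        by apply/idP/idP; rewrite !inE /D bE => // -[].
      case: ifP => // _; rewrite -EFinM; congr EFin.
      rewrite /dirichlet_weight big_ord_recl [in X in _ * X]big_ord_recl /= -mulrA opprD addrA.
      congr (_ * (_ * (_ - _) `^ _)); last by apply: eq_bigr => i _; rewrite tnthS.
      by apply: eq_bigr => i _; rewrite tnthS.
    under eq_integral do rewrite /= e.
    rewrite -integral_mkcond ge0_integralZl_EFin//; last 4 first.
    - exact: measurable_pos_ball.
    - by move=> t _; rewrite lee_fin dirichlet_weight_ge0.
    - by apply/measurable_EFinP; apply: measurable_funTS; exact: measurable_dirichlet_weight.
    - exact: powR_ge0.
    have IH' := IH p' _ S'0 p'0 s0; rewrite -muE in IH'.
    apply: (etrans (congr1 (fun z => (_ * z)%E) IH')); rewrite -!EFinM -/s'; congr EFin; ring.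
  apply: integral0_eq => y _ /=; rewrite /f patchE; case: ifPn => //.
  rewrite inE /D bE => -[x0 [_ h]]; move: xI; rewrite notin_setE /I /= in_itv /= x0 /=.
  case; have : 0 < S - x ^+ 2 by apply: le_lt_trans h; apply: sumr_ge0 => i _; exact: sqr_ge0.
  by rewrite subr_gt0 => h'; rewrite -(ger0_norm (ltW x0)) -sqrtr_sqr ltr_sqrt.
under eq_integral do rewrite key.
rewrite -integral_mkcond ge0_integralZl_EFin//; last 3 first.
- by move=> x _; rewrite lee_fin mulr_ge0 ?powR_ge0.
- apply/measurable_EFinP; apply: measurable_funTS.
  apply: measurable_funM; first exact: measurable_powR.
  have m1 : measurable_fun [set: R] (fun x : R => S - x ^+ 2).
    by apply: measurable_funB => //; exact: exprn_measurable.
  exact: (measurableT_comp (measurable_powR (s' - 1)) m1).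
- by apply/ltW/dirichlet_const_gt0.
rewrite (integral_beta_kernel_scale S0 (p0 ord0) s'0) -EFinM; congr EFin.
rewrite /= -/p' -/s' big_ord_recl -/p'.
rewrite (_ : (p ord0 + \sum_i p (lift ord0 i)) / 2 + s - 1 = p ord0 / 2 + s' - 1); last by rewrite /s'; field.
ring.
Qed.
End Dirichlet.

Section DirichletRec.
Variable R : realType.
Implicit Types s : R.

(** Raising [s] by 1 inserts the square of the last coordinate of the sphere; raising [p i] by 2, as
    in [dirichlet_const_recp], inserts that of another coordinate. *)
Lemma dirichlet_const_recs m (p : 'I_m -> R) s : (forall i, 0 < p i) -> 0 < s ->
  (\sum_i p i + 2 * s) * dirichlet_const p (s + 1) = 2 * s * dirichlet_const p s.
Proof.
elim: m p => [|m IH] p p0 s0; first by rewrite big_ord0 /= add0r.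
rewrite /= big_ord_recl; set p' := p \o lift ord0; set u := \sum_i p (lift ord0 i).
have p'0 i : 0 < p' i by exact: p0.
have u0 : 0 <= u by apply: sumr_ge0 => i _; exact: ltW.
have := IH p' p'0 s0; rewrite -[\sum_i p' i]/u => IH'.
have v0 : 0 < u / 2 + s by rewrite ltr_wpDl// divr_ge0.
rewrite addrA (beta_fun_rec (p0 ord0) v0).2.
have w0 : p ord0 + 2 * (u / 2 + s) != 0 by rewrite gt_eqF// addr_gt0// mulr_gt0.
have -> : p ord0 + u + 2 * s = p ord0 + 2 * (u / 2 + s) by field.
move: (p ord0 + 2 * (u / 2 + s)) w0 => w w0.
transitivity (beta_fun (p ord0) (u / 2 + s) * ((u + 2 * s) * dirichlet_const p' (s + 1))); first by field; rewrite ?w0.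
by rewrite IH'; field.
Qed.

Lemma dirichlet_const_recp m (p : 'I_m -> R) s i : (forall i, 0 < p i) -> 0 < s ->
  (\sum_i p i + 2 * s) * dirichlet_const (fun k => p k + 2 *+ (k == i)) s = p i * dirichlet_const p s.
Proof.
elim: m p i => [|m IH] p i p0 s0; first by case: i.
rewrite /= big_ord_recl; set p' := p \o lift ord0; set u := \sum_i p (lift ord0 i).
have p'0 j : 0 < p' j by exact: p0.
have u0 : 0 <= u by apply: sumr_ge0 => j _; exact: ltW.
have v0 : 0 < u / 2 + s by rewrite ltr_wpDl// divr_ge0.
have w0 : p ord0 + 2 * (u / 2 + s) != 0 by rewrite gt_eqF// addr_gt0// mulr_gt0.
have -> : p ord0 + u + 2 * s = p ord0 + 2 * (u / 2 + s) by field.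
have := beta_fun_rec (p0 ord0) v0; move: (p ord0 + 2 * (u / 2 + s)) w0 => w w0 [be1 be2].
(* Raising a later exponent by 2 raises the second argument of the first beta factor by 1; raising
   the first exponent changes that factor alone. *)
case: (unliftP ord0 i) => [j|] ->.
  have -> : \sum_k (p (lift ord0 k) + 2 *+ (lift ord0 k == lift ord0 j)) = u + 2.
    rewrite big_split /=; congr (_ + _).
    rewrite (bigD1 j)//= eqxx big1 ?addr0// => k kj.
    by rewrite (inj_eq lift_inj) (negbTE kj).
  have -> : (fun k => p k + 2 *+ (k == lift ord0 j)) \o lift ord0 = (fun k => p' k + 2 *+ (k == j)).
    by apply/funext => k; rewrite /= (inj_eq lift_inj).
  rewrite addr0 mulrDl divff// addrAC be2.
  have := IH p' j p'0 s0; rewrite -[\sum_i p' i]/u => IH'.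
  transitivity (beta_fun (p ord0) (u / 2 + s) * ((u + 2 * s) * dirichlet_const (fun k => p' k + 2 *+ (k == j)) s)); first by field.
  by rewrite IH' -[p' j]/(p (lift ord0 j)); ring.
rewrite eqxx (_ : (fun k => p k + 2 *+ (k == ord0)) \o lift ord0 = p'); last first.
  by apply/funext => k; rewrite /= addr0.
under eq_bigr do rewrite addr0.
by rewrite be1; field.
Qed.

(* moments of prod_i t_i^(beta/2 - 1) on the simplex, up to a common factor *)
Definition dirichlet_moment m (beta : R) (b : multinom (m + 1)) : R :=
  dirichlet_const (fun i : 'I_m => beta + 2 * (b (lshift 1 i))%:R) (beta / 2 + (b (rshift m ord0))%:R).

Lemma dirichlet_moment_gt0 m (beta : R) (b : multinom (m + 1)) : 0 < beta -> 0 < dirichlet_moment beta b.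
Proof.
move=> b0; apply: dirichlet_const_gt0 => [i|]; first by rewrite ltr_pwDl// mulr_ge0.
by rewrite ltr_pwDl// divr_gt0.
Qed.

(** The last coordinate enters through [s] and the others through [p], yet all of them obey the same
    rule. *)
Lemma dirichlet_moment_step m (beta : R) (b : multinom (m + 1)) i : 0 < beta ->
  (\sum_k (beta / 2 + (b k)%:R)) * dirichlet_moment beta (mnm_add b (mnm1 i)) =
  (beta / 2 + (b i)%:R) * dirichlet_moment beta b.
Proof.
move=> b0.
have p0 j : 0 < beta + 2 * (b (lshift 1 j))%:R :> R by rewrite ltr_pwDl// mulr_ge0.
have s0 : 0 < beta / 2 + (b (rshift m ord0))%:R :> R by rewrite ltr_pwDl// divr_gt0.
have -> : \sum_k (beta / 2 + (b k)%:R) = (\sum_j (beta + 2 * (b (lshift 1 j))%:R) + 2 * (beta / 2 + (b (rshift m ord0))%:R)) / 2.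
  rewrite big_split_ord /= big_ord1 mulrDl mulr_suml; congr (_ + _); last by field.
  by apply: eq_bigr => j _; field.
case: (fintype.split_ordP i) => j ->.
  pose b' := mnm_add b (mnm1 (lshift 1 j)).
  pose p (k : 'I_m) : R := beta + 2 * (b' (lshift 1 k))%:R.
  pose s : R := beta / 2 + (b' (rshift m ord0))%:R.
  rewrite -[dirichlet_moment beta (mnm_add _ _)]/(dirichlet_const p s) /dirichlet_moment.
  have := dirichlet_const_recp j p0 s0.
  have -> : (fun k : 'I_m => beta + 2 * (b (lshift 1 k))%:R + 2 *+ (k == j)) = p.
    apply/funext => k; rewrite /p /b' mnmDE mnm1E (inj_eq (@lshift_inj _ _)) natrD eq_sym.
    by case: (_ == _); rewrite ?addr0 ?mulr1n; ring.
  have -> : beta / 2 + (b (rshift m ord0))%:R = s.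
    by rewrite /s /b' mnmDE mnm1E eq_lrshift addn0.
  move=> h; apply: (mulIf (_ : 2 != 0 :> R)) => //.
  by rewrite mulrAC divfK// h; field.
rewrite (ord1 j); pose b' := mnm_add b (mnm1 (rshift m ord0)).
pose p (k : 'I_m) : R := beta + 2 * (b' (lshift 1 k))%:R.
pose s : R := beta / 2 + (b' (rshift m ord0))%:R.
rewrite -[dirichlet_moment beta (mnm_add _ _)]/(dirichlet_const p s) /dirichlet_moment.
have := dirichlet_const_recs p0 s0.
have -> : (fun k : 'I_m => beta + 2 * (b (lshift 1 k))%:R) = p.
  by apply/funext => k; rewrite /p /b' mnmDE mnm1E eq_rlshift addn0.
have -> : beta / 2 + (b (rshift m ord0))%:R + 1 = s.
  by rewrite /s /b' mnmDE mnm1E eqxx natrD addrA.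
move=> h; apply: (mulIf (_ : 2 != 0 :> R)) => //.
by rewrite mulrAC divfK// h; field.
Qed.

Lemma dirichlet_moment_rec m (beta : R) (b : multinom (m + 1)) i k : 0 < beta ->
  (beta / 2 + (b k)%:R) * dirichlet_moment beta (mnm_add b (mnm1 i)) =
  (beta / 2 + (b i)%:R) * dirichlet_moment beta (mnm_add b (mnm1 k)).
Proof.
move=> b0; have n0 : \sum_k (beta / 2 + (b k)%:R) != 0 :> R.
  rewrite gt_eqF// big_split_ord /= big_ord1 ltr_wpDl//.
    by apply: sumr_ge0 => j _; rewrite addr_ge0// divr_ge0// ltW.
  by rewrite ltr_pwDl// divr_gt0.
apply: (mulfI n0); rewrite mulrCA dirichlet_moment_step// [RHS]mulrCA dirichlet_moment_step//; ring.
Qed.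
End DirichletRec.

(** * Surface element of the sphere as a graph *)

Section GraphArea.
Local Open Scope classical_set_scope.
Variables (R : realType) (m : nat).
Implicit Types u : 'rV[R]_m.

Lemma derive_sphere_graph u i : \sum_j u 0 j ^+ 2 < 1 ->
  'D_(delta_mx 0 i) (@sphere_graph R m) u = - u 0 i / sphere_graph u.
Proof.
move=> u1; set S := 1 - \sum_j u 0 j ^+ 2.
have S0 : 0 < S by rewrite subr_gt0.
(* Restriction to the line in direction [i] reduces the partial derivative to one variable. *)
pose phi (h : R) : R := Num.sqrt (S - 2 * h * u 0 i - h ^+ 2).
have phiE h : sphere_graph (h *: delta_mx 0 i + u) = phi h.
  congr Num.sqrt; rewrite /S (bigD1 i)//= [in RHS](bigD1 i)//= !mxE !eqxx /= mulr1.
  rewrite (eq_bigr (fun j => u 0 j ^+ 2)) => [|j ji]; first by ring.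
  by rewrite !mxE (negbTE ji) andbF mulr0 add0r.
have -> : 'D_(delta_mx 0 i) (@sphere_graph R m) u = 'D_1 phi 0.
  rewrite /derive; set F := (X in lim (X @ _)); set G := (X in _ = lim (X @ _)).
  suff -> : F = G by [].
  apply/funext => h; rewrite /F /G /=.
  by rewrite -[h%:A]/(h * 1) mulr1 addr0 phiE -(phiE 0) scale0r add0r.
have h1 : is_derive (0 : R) 1 (fun h : R => S - 2 * h * u 0 i - h ^+ 2) (- (2 * u 0 i)).
  by apply: is_derive_eq; rewrite -?[1%:A]/(1 * 1 : R); rewrite /GRing.scale /=; ring.
pose q := fun y : R => y `^ 2^-1.
have e0 : S = S - 2 * 0 * u 0 i - 0 ^+ 2 by rewrite mulr0 mul0r expr0n !subr0.
(* Near the positive point [S] the square root coincides with the power 1/2, whose derivative is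
   known. *)
have h2 : is_derive S 1 (@Num.sqrt R) (2^-1 * S `^ (2^-1 - 1)).
  apply: (@near_eq_is_derive _ _ _ q).
  - by near=> y; rewrite /q powR12_sqrt//; apply: ltW; rewrite -oppr_lt0; near: y; apply: Nlt_nbhsl; rewrite oppr_lt0.
  - exact: is_derive1_powR.
have S0' : 0 < S - 2 * 0 * u 0 i - 0 ^+ 2 by rewrite -e0.
rewrite {1}e0 in h2.
have := @is_derive1_comp R (@Num.sqrt R) _ 0 _ _ h2 h1.
move=> h3; rewrite [LHS](derive_val (is_derive:=h3)).
have -> : 2^-1 - 1 = - 2^-1 :> R by field.
rewrite powRN powR12_sqrt ?(ltW S0)// -[sphere_graph u]/(Num.sqrt S).
have : Num.sqrt S != 0 by rewrite gt_eqF// sqrtr_gt0.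
by move: (Num.sqrt S) => g g0; field.
Unshelve. all: by end_near.
Qed.

Lemma graph_area_sphere u : \sum_j u 0 j ^+ 2 < 1 ->
  graph_area (@sphere_graph R m) u = (sphere_graph u)^-1.
Proof.
move=> u1; rewrite /graph_area.
have S0 : 0 < 1 - \sum_j u 0 j ^+ 2 by rewrite subr_gt0.
have g0 : 0 < sphere_graph u by rewrite sqrtr_gt0.
have g2 : sphere_graph u ^+ 2 = 1 - \sum_j u 0 j ^+ 2 by rewrite sqr_sqrtr// ltW.
under eq_bigr do rewrite derive_sphere_graph// exprMn sqrrN.
rewrite -mulr_suml exprVn g2.
have -> : 1 + (\sum_i u 0 i ^+ 2) / (1 - \sum_j u 0 j ^+ 2) = (sphere_graph u)^-1 ^+ 2.
  by rewrite exprVn g2; field; rewrite gt_eqF.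
by rewrite sqrtr_sqr ger0_norm// invr_ge0 ltW.
Qed.
End GraphArea.

(** * Moments of the squared coordinates on the sphere *)

Section SphereMoments.
Local Open Scope classical_set_scope.
Variables (R : realType) (m : nat).
Local Notation TR := (measurableTypeR R).

Definition graph_pt (t : m.-tuple TR) : 'rV[R]_(m + 1) :=
  let u : 'rV[R]_m := \row_i tnth t i in row_mx u (sphere_graph u)%:M.

Lemma graph_ptl t i : graph_pt t 0 (lshift 1 i) = tnth t i.
Proof. by rewrite row_mxEl mxE. Qed.

Lemma graph_ptr t : graph_pt t 0 (rshift m ord0) = Num.sqrt (1 - \sum_i tnth t i ^+ 2).
Proof.
rewrite row_mxEr mxE eqxx mulr1n; congr (Num.sqrt (1 - _)).
by apply: eq_bigr => i _; rewrite mxE.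
Qed.

Lemma pos_unit_graph_pt t : pos_ball 1 t -> pos_unit (graph_pt t).
Proof.
move=> [t0 t1]; split=> [i|].
  case: (fintype.split_ordP i) => j ->; first by rewrite graph_ptl.
  by rewrite (ord1 j) graph_ptr sqrtr_gt0 subr_gt0.
rewrite big_split_ord /= big_ord1 graph_ptr sqr_sqrtr ?subr_ge0 ?ltW//.
under eq_bigr do rewrite graph_ptl.
by rewrite addrC subrK.
Qed.

Lemma int_pos_sphereE (f : 'rV[R]_(m + 1) -> R) :
  int_pos_sphere f = (\int[@lebesgue_tuple R m]_(t in @pos_ball R m 1)
    (f (graph_pt t) * (graph_pt t 0 (rshift m ord0))^-1)%:E)%E.
Proof.
rewrite /int_pos_sphere.
have [mu <-] := lebesgue_tuple_measure R m.
apply: eq_integral => t; rewrite inE => -[t0 t1]; congr ((_ * _)%:E).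
rewrite graph_area_sphere; first by rewrite /graph_pt row_mxEr mxE eqxx mulr1n.
by under eq_bigr do rewrite mxE.
Qed.

Lemma eq_int_pos_sphere (f g : 'rV[R]_(m + 1) -> R) :
  (forall q, pos_unit q -> f q = g q) -> int_pos_sphere f = int_pos_sphere g.
Proof.
move=> fg; rewrite !int_pos_sphereE; have [mu <-] := lebesgue_tuple_measure R m.
by apply: eq_integral => t; rewrite inE => /pos_unit_graph_pt /fg ->.
Qed.

Variable beta : R.
Hypothesis beta0 : 0 < beta.

(** The surface density, the reciprocal of the last coordinate, lowers the exponent beta - 1 of that
    coordinate to beta - 2. Written as a power of its square, this gives the parameter beta/2 in
    place of beta. *)
Lemma dirichlet_weight_graph_pt (b : multinom (m + 1)) t : pos_ball 1 t ->
  (\prod_i graph_pt t 0 i `^ (beta - 1)) * (\prod_i (graph_pt t 0 i ^+ 2) ^+ b i) /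
    graph_pt t 0 (rshift m ord0) =
  dirichlet_weight (fun i => beta + 2 * (b (lshift 1 i))%:R) (beta / 2 + (b (rshift m ord0))%:R) 1 t.
Proof.
move=> bt; have [q0 _] := pos_unit_graph_pt bt; case: bt => t0 t1.
have W0 : 0 < 1 - \sum_i tnth t i ^+ 2 by rewrite subr_gt0.
rewrite -big_split big_split_ord /= big_ord1 /dirichlet_weight -mulrA; congr (_ * _).
  apply: eq_bigr => i _; rewrite graph_ptl.
  rewrite -exprM -powR_mulrn ?(ltW (t0 i))// -powRD; last by rewrite (gt_eqF (t0 i)) implybT.
  by congr (_ `^ _); rewrite natrM; ring.
rewrite -exprM -powR_mulrn ?(ltW (q0 _))// -powR_inv1 ?(ltW (q0 _))//.
rewrite -!powRD ?(gt_eqF (q0 _)) ?implybT//.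
rewrite graph_ptr -powR12_sqrt ?(ltW W0)// -powRrM; congr (_ `^ _).
by rewrite natrM; field.
Qed.

Lemma int_pos_sphere_meval (x : 'I_(m + 1) -> R) (Q : mpoly ((m + 1) + (m + 1)) R) :
  int_pos_sphere (fun q => (\prod_i q 0 i `^ (beta - 1)) *
    meval (join_pt x (fun i => q 0 i ^+ 2)) Q) =
  (meval x (moment_map (dirichlet_moment beta) Q))%:E.
Proof.
rewrite int_pos_sphereE.
pose a c := mcoeff c Q * \prod_i x i ^+ lpart c i.
pose w (c : multinom ((m + 1) + (m + 1))) := @dirichlet_weight R m (fun i => beta + 2 * (rpart c (lshift 1 i))%:R)
  (beta / 2 + (rpart c (rshift m ord0))%:R) 1.
have w_int c : (\int[@lebesgue_tuple R m]_(t in @pos_ball R m 1) (w c t)%:E = (dirichlet_moment beta (rpart c))%:E)%E.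
  rewrite dirichlet_integral//; first by rewrite powR1 mul1r.
    by move=> i; rewrite ltr_pwDl// mulr_ge0.
  by rewrite ltr_pwDl// divr_gt0.
transitivity (\int[@lebesgue_tuple R m]_(t in @pos_ball R m 1) (\sum_(c <- msupp Q) (a c)%:E * (w c t)%:E))%E.
  have [mu <-] := lebesgue_tuple_measure R m.
  apply: eq_integral => t; rewrite inE => bt.
  have -> : meval (join_pt x (fun i => graph_pt t 0 i ^+ 2)) Q =
      \sum_(c <- msupp Q) a c * \prod_i (graph_pt t 0 i ^+ 2) ^+ rpart c i.
    rewrite mevalE; apply: eq_bigr => c _; rewrite /a -mulrA; congr (_ * _).
    rewrite big_split_ord /=; congr (_ * _); apply: eq_bigr => i _; rewrite mnmE ?join_ptl ?join_ptr//.
  rewrite mulr_sumr mulr_suml -sumEFin; apply: eq_bigr => c _.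
  rewrite -EFinM /w -dirichlet_weight_graph_pt//; congr EFin; ring.
have [mu muE] := lebesgue_tuple_measure R m; rewrite -muE in w_int *.
have mw c : measurable_fun (@pos_ball R m 1) (fun t => (w c t)%:E).
  by apply/measurable_EFinP; apply: measurable_funTS; exact: measurable_dirichlet_weight.
(* The coefficients [a c] may have either sign, so exchanging sum and integral rests on
   integrability. *)
have iw c : mu.-integrable (@pos_ball R m 1) (fun t => (w c t)%:E).
  apply/integrableP; split; first exact: mw.
  under eq_integral do rewrite gee0_abs ?lee_fin ?dirichlet_weight_ge0//.
  by rewrite w_int ltry.
rewrite integral_sum//; last 2 first.
- exact: measurable_pos_ball.
- by move=> c; apply: integrableZl; [exact: measurable_pos_ball|exact: iw].
transitivity (\sum_(c <- msupp Q) (a c * dirichlet_moment beta (rpart c))%:E)%E.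
  apply: eq_bigr => c _; rewrite integralZl//; last exact: measurable_pos_ball.
  exact: (etrans (congr1 (fun z => ((a c)%:E * z)%E) (w_int c)) (esym (EFinM _ _))).
have -> : meval x (moment_map (dirichlet_moment beta) Q) = \sum_(c <- msupp Q) a c * dirichlet_moment beta (rpart c).
  rewrite [moment_map _ _]/linext raddf_sum /=; apply: eq_bigr => c _.
  by rewrite !mevalZ mevalX /a; ring.
by rewrite -sumEFin.
Qed.

End SphereMoments.

Theorem theorem2 (R : realType) (beta : R) (m : nat) (kappa : seq nat)
    (C : forall n : nat, seq nat -> mpoly n R)
    (A : 'rV[R]_(m + 1) -> 'rV[R]_(m + 1) -> 'M[R]_(m + 1))
    (hbeta : 0 < beta) (hn : (2 <= m + 1)%N)
    (hkappa : is_part kappa) (hl : (size kappa < m + 1)%N)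
    (hC : forall n : nat, is_jackC beta (C n))
    (hA : forall lambda q : 'rV[R]_(m + 1),
        injective (lambda 0) -> pos_unit q -> is_arrow lambda q (A lambda q)) :
  exists2 c : R, c != 0 &
    forall lambda : 'rV[R]_(m + 1), injective (lambda 0) ->
      (eval_diag (C (m + 1)%N kappa) (diag_mx lambda))%:E =
      (c%:E * int_pos_sphere (fun q : 'rV[R]_(m + 1) =>
         (\prod_i q 0 i `^ (beta - 1)) *
         eval_diag (C m kappa) (ulsubmx (A lambda q)))%R)%E.
Proof.
have km : (size kappa <= m)%N by rewrite addn1 ltnS in hl.
(* A point of the simplex is reached from the unit vector of the square roots of its coordinates,
   whose arrow matrix is the value of [A]. *)
have arrow (x t : 'I_(m + 1) -> R) : injective x -> simplex t ->
    exists2 mu : 'I_m -> R, injective mu & forall r, elsymT mu r = usym x t r.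
  move=> xI [t0 t1]; pose lambda : 'rV[R]_(m + 1) := \row_i x i.
  pose q : 'rV[R]_(m + 1) := \row_i Num.sqrt (t i).
  have q2 i : q 0 i ^+ 2 = t i by rewrite mxE sqr_sqrtr// ltW.
  have lE : lambda 0 = x by apply/funext => i; rewrite mxE.
  have lI : injective (lambda 0) by rewrite lE.
  have qU : pos_unit q.
    split=> [i|]; first by rewrite mxE sqrtr_gt0.
    by under eq_bigr do rewrite q2.
  have [mu [_ muI muE]] := is_arrow_elsym lI (hA lambda q lI qU).
  exists (mu 0) => // r; rewrite muE lE; congr usym; exact/funext.
(* The functional is an integral over the sphere, which involves only the points [t i = q 0 i ^+ 2]
   of the simplex. *)
have M_ext x (P Q : mpoly ((m + 1) + (m + 1)) R) :
    (forall t, simplex t -> meval (join_pt x t) P = meval (join_pt x t) Q) ->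
    meval x (moment_map (dirichlet_moment beta) P) = meval x (moment_map (dirichlet_moment beta) Q).
  move=> PQ; apply: EFin_inj; rewrite -!int_pos_sphere_meval//.
  by apply: eq_int_pos_sphere => q [q0 q1]; rewrite PQ//; split => // i; rewrite exprn_gt0.
have [P [c c0 CE] PE] := @jack_transfer R beta m kappa C (@dirichlet_moment R m beta) hbeta km hkappa hC
  (fun b => dirichlet_moment_gt0 b hbeta) (fun b i k _ => dirichlet_moment_rec b i k hbeta) M_ext arrow.
have evD n (p : mpoly n R) (l : 'rV[R]_n) : eval_diag p (diag_mx l) = meval (l 0) p.
  rewrite /eval_diag /evalv; congr meval; apply/funext => i.
  by rewrite !mxE eqxx.
exists c => // lambda lI; rewrite evD CE mevalZ EFinM -int_pos_sphere_meval//.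
congr (_ * _)%E; apply: eq_int_pos_sphere => q qU; congr (_ * _).
have [mu [-> muI muE]] := is_arrow_elsym lI (hA lambda q lI qU).
have [q0 q1] := qU.
by rewrite evD (PE (lambda 0) (fun i => q 0 i ^+ 2))//; split => // i; rewrite exprn_gt0.
Qed.
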